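(* Let $F:\mathbb R\to\mathbb R$ be a locally Lipschitz continuous function. Suppose that $u\in H^2_{loc}(\mathbb R^2)\cap C^1(\mathbb R^2)$ solves $\Delta u=F'(u)$ in $\mathbb R^2$. Assume there exists a constant $C>0$ such that $$\sup_{|x|\le R}|\nabla u(x)|\le C\sqrt{\log R}\quad\text{for all }R>100.$$ Then $u$ is a one-dimensional solution, that is, $u=u(\mathbf e\cdot x)$ for some unit vector $\mathbf e\in\mathbb R^2$, if one of the following is satisfied: (i) There exist $\theta_0\in\mathbb R$ and $\beta\in(0,\pi)$ such that $\Theta(\nabla u;\mathbb R^2)\subset\mathcal S_{\theta_0,\beta}$. (ii) $u\in W^{3,1}_{loc}(\mathbb R^2)$ and $\Theta(\nabla u;\mathbb R^2)\subsetneqq S^1$.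
   Context: Since $F'$ is only (locally) bounded and measurable, the equation $\Delta u=F'(u)$ is understood in the sense that $\Delta u\,\nabla u=\nabla (F(u))$ a.e. in $\mathbb R^2$. For a vector field $\mathbf u$ on a set $D$, the set of flow angles is $$\Theta(\mathbf u;D)=\left\{\tfrac{\mathbf u(x)}{|\mathbf u(x)|}: x\in D,\ |\mathbf u(x)|>0\right\}\subset S^1 .$$ For $\theta_0\in\mathbb R$ and $\beta\in(0,\pi)$, $$\mathcal S_{\theta_0,\beta}=\{(\cos\theta,\sin\theta)\in S^1: -\pi+\beta+\theta_0\le\theta\le\pi-\beta+\theta_0\}.$$ *)

(* Defs.v *)
From HB Require Import structures.
From mathcomp Require Import all_boot all_order all_algebra.
From mathcomp Require Import all_classical all_reals all_analysis.
Set Implicit Arguments.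
Unset Strict Implicit.
Unset Printing Implicit Defensive.
Import Order.TTheory GRing.Theory Num.Theory.
Import numFieldNormedType.Exports.
Local Open Scope classical_set_scope.
Local Open Scope ring_scope.

Section Plane.
Context {R : realType}.
Implicit Types (u f g phi : R * R -> R) (x y : R * R) (i : 'I_2).

(* [measurableTypeR R] is [R] itself, with the Borel sigma-algebra carried by
   the library's Lebesgue measure. *)
Definition lebesgue2 :
    {measure set (measurableTypeR R * measurableTypeR R) -> \bar R} :=
  (@lebesgue_measure R \x @lebesgue_measure R)%E.

Definition dot x y : R := x.1 * y.1 + x.2 * y.2.

(* The library norm `|x| on R * R is the max norm. *)
Definition enorm x : R := Num.sqrt (dot x x).

Definition circle : set (R * R) := [set z | enorm z = 1].

Definition basis_vec i : R * R := if i == 0 then (1, 0) else (0, 1).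

Definition grad u x : R * R :=
  ('D_(basis_vec 0) u x, 'D_(basis_vec 1) u x).

(* Iterated partial derivative; the list of directions plays the role of a
   multi-index, and its size that of the order. *)
Definition partial (s : seq 'I_2) u : R * R -> R :=
  foldr (fun i f x => 'D_(basis_vec i) f x) u s.

(* 'D_v is total, hence the explicit existence of partial derivatives. *)
Definition class_C (k : nat) u : Prop :=
  forall s : seq 'I_2, (size s <= k)%N ->
    continuous (partial s u) /\
    ((size s < k)%N -> forall i x, derivable (partial s u) x (basis_vec i)).

Definition test_function phi : Prop :=
  (forall k, class_C k phi) /\ compact (closure [set x | phi x != 0]).

Definition Lloc (p : \bar R) f : Prop :=
  forall K : set (R * R), compact K -> f \_ K \in Lfun lebesgue2 p.

Definition weak_partial (s : seq 'I_2) f g : Prop :=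
  [/\ Lloc 1%E f, Lloc 1%E g & forall phi, test_function phi ->
    \int[lebesgue2]_x (f x * partial s phi x) =
    (-1) ^+ size s * \int[lebesgue2]_x (g x * phi x)].

Definition Wloc (k : nat) (p : \bar R) f : Prop :=
  forall s : seq 'I_2, (size s <= k)%N ->
    exists2 g, weak_partial s f g & Lloc p g.

Definition locally_lipschitz (F : R -> R) : Prop :=
  forall t : R, exists2 U : set R, nbhs t U & [lipschitz F s | s in U].

(* Delta u = F'(u), in the sense Delta u * grad u = grad (F(u)) a.e., where
   Delta u = h0 + h1 and grad (F(u)) = (g0, g1) are weak derivatives. *)
Definition solves_semilinear (F : R -> R) u : Prop :=
  exists h0 h1 g0 g1 : R * R -> R,
    [/\ weak_partial [:: 0; 0] u h0 /\ weak_partial [:: 1; 1] u h1,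
        weak_partial [:: 0] (F \o u) g0 /\ weak_partial [:: 1] (F \o u) g1
      & {ae lebesgue2, forall x,
          (h0 x + h1 x) *: grad u x = (g0 x, g1 x)}].

Definition flow_angles (v : R * R -> R * R) (D : set (R * R)) : set (R * R) :=
  [set (enorm (v x))^-1 *: v x | x in D `&` [set x | 0 < enorm (v x)]].

Definition sector (theta0 beta : R) : set (R * R) :=
  [set (cos theta, sin theta) | theta in
    [set theta | - pi + beta + theta0 <= theta <= pi - beta + theta0]].

Definition one_dimensional u : Prop :=
  exists (e : R * R) (U : R -> R), enorm e = 1 /\ forall x, u x = U (dot e x).

End Plane.

(* Main.v *)
Require Import Defs.
From HB Require Import structures.
From mathcomp Require Import all_boot all_order all_algebra.
From mathcomp Require Import all_classical all_reals all_analysis.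
From mathcomp Require Import measurable_realfun.
From mathcomp Require Import zify ring lra.
Set Implicit Arguments.
Unset Strict Implicit.
Unset Printing Implicit Defensive.
Import Order.TTheory GRing.Theory Num.Theory.
Import numFieldNormedType.Exports.
Local Open Scope classical_set_scope.
Local Open Scope ring_scope.

(**
  Write [a, b] for the partial derivatives of [u], [q = a^2 + b^2] and
  [V = a grad b - b grad a = q grad (angle)].  Off the zero set of the gradient
  the equation says that [V] is the rotated gradient of [P = q/2 - F(u)], so [V]
  is divergence free and the angle solves [div (q grad (angle)) = 0].
  In both cases some unit vector [d] is not a flow angle, hence the angle has a
  bounded determination away from [d]; half of it is [Theta].  Testing with
  [eta^2 Theta], cut off where [q] is small, gives the Caccioppoli estimate
  [int eta^2 |V|^2 / q <= C int q |grad eta|^2].  As [q] grows at most like the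
  logarithm, a logarithmic cutoff sends the right-hand side to 0, so [V = 0]: the
  direction of the gradient is locally constant where the gradient is nonzero.
  Then the gradient is constant along the line orthogonal to it, and two such
  lines cannot cross, so all gradients are parallel.
  Sobolev functions enter only through their absolutely continuous restrictions
  to lines.
*)

(** * Absolutely continuous functions of one variable *)

Section OneVariable.
Context {R : realType}.
Notation mu := (@lebesgue_measure R).
Implicit Types (f g h : R -> R) (s t : R).

(** The gradient of [u] is only continuous with square integrable derivatives, so the divergence of
    [V] makes sense only as a pairing of two [H1] functions. The proof keeps one inequality of that
    pairing, [null_lagrangian], which is enough because only an upper bound for the coercive term is
    wanted; no smoothing of [u] or of the angle takes place. Half the angle is used because the
    tangent half-angle formula is a single smooth expression off one closed ray, with no branches to
    glue. The angle has no limit at zeros of the gradient. Cutting it off between [q = e] and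
    [q = 2 * e] costs a factor [1/e], but the factor multiplying it, [V] paired with [grad q], is at
    most [q |D^2 u|^2]. The error is thus of size [|D^2 u|^2] on [e < q < 2 * e], uniformly in [e],
    and disappears by dominated convergence because no point stays in these sets as [e] tends to 0.
    Logarithmic growth of [q] is the borderline: the cutoff at scale [2^k] costs about [k], and the
    harmonic weights [1/k] still have a divergent sum. *)

Definition lint g := forall s t, mu.-integrable `[s, t] (EFin \o g).

(* [f] is locally absolutely continuous with derivative [g]. *)
Definition AC f g :=
  lint g /\ forall s t, s <= t -> f t - f s = \int[mu]_(x in `[s, t]) g x.

(* Strict differentiability at [(a, b)]: both increments are free, which is what
   makes composition preserve [AC]. *)
Definition sd (G : R -> R -> R) a b v1 v2 := forall e : R, 0 < e ->
  exists2 d : R, 0 < d & forall a1 b1 a2 b2, `|a1 - a| < d -> `|b1 - b| < d ->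
    `|a2 - a| < d -> `|b2 - b| < d ->
    `|G a1 b1 - G a2 b2 - (v1 * (a1 - a2) + v2 * (b1 - b2))|
      <= e * (`|a1 - a2| + `|b1 - b2|).

Lemma lint_cont g : continuous g -> lint g.
Proof.
move=> cg s t; apply: continuous_compact_integrable; first exact: segment_compact.
exact: continuous_subspaceT.
Qed.

Lemma lintD g h : lint g -> lint h -> lint (fun x => g x + h x).
Proof. by move=> lg lh s t; exact: (integrableD _ (lg s t) (lh s t)). Qed.

Lemma lintB g h : lint g -> lint h -> lint (fun x => g x - h x).
Proof. by move=> lg lh s t; exact: (integrableB _ (lg s t) (lh s t)). Qed.

Lemma lint_norm g : lint g -> lint (fun x => `|g x|).
Proof. by move=> lg s t; apply: integrable_norm => //; exact: measurable_itv. Qed.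

Lemma lintM h g : continuous h -> lint g -> lint (fun x => h x * g x).
Proof.
move=> ch lg s t; apply: (@integrableMr _ _ _ mu _ _ h (EFin \o g)) => //.
  apply: measurable_funTS; exact: continuous_measurable_fun.
have /compact_bounded[M [Mr HM]] : compact (h @` `[s, t]).
  apply: continuous_compact; last exact: segment_compact.
  exact: continuous_subspaceT.
by exists M; split => // y My x xst; apply: (HM _ My); exists x.
Qed.

Lemma lintZ k g : lint g -> lint (fun x => k * g x).
Proof. by move=> lg; apply: lintM => // x; exact: cst_continuous. Qed.

Lemma lint_measurable g : lint g -> measurable_fun setT g.
Proof.
move=> lg.
have -> : [set: R] = \bigcup_(n : nat) (`[- n%:R, n%:R]%classic : set R).
  apply/esym; rewrite -subTset => x _.
  have [n /andP[] Hn1 Hn2] : exists n : nat, - n%:R <= x <= n%:R.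
    exists (Num.truncn `|x|).+1; rewrite -ler_norml ltW//.
    by rewrite truncnS_gt.
  by exists n => //=; rewrite in_itv/= Hn1 Hn2.
apply/measurable_fun_bigcup => [n|n]; first exact: measurable_itv.
by have /integrableP[/measurable_EFinP] := lg (- n%:R) n%:R.
Qed.

Lemma int_split g s t r : lint g -> s <= t -> t <= r ->
  \int[mu]_(x in `[s, r]) g x =
  \int[mu]_(x in `[s, t]) g x + \int[mu]_(x in `[t, r]) g x.
Proof.
move=> lg st tr.
rewrite -(@Rintegral_itv_obnd_cbnd _ t); last first.
  apply: integrableS (lg t r) => //.
  by apply: subset_itvr; rewrite bnd_simp.
rewrite -(@Rintegral_itvB _ g (BLeft s) (BRight r) t) ?bnd_simp//.
by rewrite addrC subrK.
Qed.

Lemma int_abs g s t : lint g ->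
  `|\int[mu]_(x in `[s, t]) g x| <= \int[mu]_(x in `[s, t]) `|g x|.
Proof. by move=> lg; apply: le_normr_Rintegral => //; exact: measurable_itv. Qed.

Lemma int_le g h s t : lint g -> lint h ->
  (forall x, s <= x <= t -> g x <= h x) ->
  \int[mu]_(x in `[s, t]) g x <= \int[mu]_(x in `[s, t]) h x.
Proof.
move=> lg lh gh; by apply: le_Rintegral => // x /=; rewrite in_itv/=; exact: gh.
Qed.

Lemma int_cst (k : R) s t : s <= t -> \int[mu]_(x in `[s, t]) k = k * (t - s).
Proof.
move=> st; rewrite Rintegral_cst//.
rewrite [X in fine X](_ : _ = lebesgue_measure (`[s, t]%classic : set R))//.
rewrite lebesgue_measure_itv/= lte_fin; by case: ltgtP st => //= -> _; rewrite subrr.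
Qed.

Lemma int_point g s : \int[mu]_(x in `[s, s]) g x = 0.
Proof. by rewrite set_itv1 Rintegral_set1. Qed.

Lemma intD g h s t : lint g -> lint h -> \int[mu]_(x in `[s, t]) (g x + h x) =
  \int[mu]_(x in `[s, t]) g x + \int[mu]_(x in `[s, t]) h x.
Proof. by move=> lg lh; apply: RintegralD => //; exact: measurable_itv. Qed.

Lemma intB g h s t : lint g -> lint h -> \int[mu]_(x in `[s, t]) (g x - h x) =
  \int[mu]_(x in `[s, t]) g x - \int[mu]_(x in `[s, t]) h x.
Proof. by move=> lg lh; apply: RintegralB => //; exact: measurable_itv. Qed.

Lemma intZ k g s t : lint g -> \int[mu]_(x in `[s, t]) (k * g x) =
  k * \int[mu]_(x in `[s, t]) g x.
Proof. by move=> lg; apply: RintegralZl => //; exact: measurable_itv. Qed.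

(** Real induction: the supremum of the points up to which the bound holds can always be passed
    unless it is [b]. The majorant [M] is an indefinite integral in the chain rule [AC_sd], and a
    linear function when constancy along a segment is proved. *)
Lemma local_to_global (f M : R -> R) a b : a <= b ->
  (forall t, a <= t <= b -> exists2 r : R, 0 < r &
     forall s s', a <= s -> s <= s' -> s' <= b -> `|s - t| < r -> `|s' - t| < r ->
       `|f s' - f s| <= M s' - M s) ->
  `|f b - f a| <= M b - M a.
Proof.
move=> ab loc.
pose S := [set t | a <= t <= b /\ forall s, a <= s <= t -> `|f s - f a| <= M s - M a].
have Sa : S a.
  split; first by rewrite lexx.
  move=> s /andP[s1 s2]; have -> : s = a by apply/le_anti; rewrite s1 s2.
  by rewrite !subrr normr0.
have hS : has_sup S.
  by split; [exists a | exists b => t [/andP[]]].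
set c := sup S.
have ac : a <= c by apply: sup_upper_bound.
have cb : c <= b by apply: ge_sup; [exists a|move=> t [/andP[]]].
have [r r0 Hr] : exists2 r : R, 0 < r &
     forall s s', a <= s -> s <= s' -> s' <= b -> `|s - c| < r -> `|s' - c| < r ->
       `|f s' - f s| <= M s' - M s by apply: loc; rewrite ac cb.
have [t [/andP[at_ tb] St] tc] := sup_adherent r0 hS.
have tlec : t <= c by apply: sup_upper_bound => //; split => //; rewrite at_ tb.
(* A point beyond the supremum [c], unless [c] is [b], that still belongs to [S]. *)
pose d := Num.min b (c + r / 2).
have Sd : S d.
  split.
    rewrite /d ge_min lexx /= le_min ab /=; lra.
  move=> s /andP[as_ sd].
  have [st|ts] := leP s t; first by apply: St; rewrite as_ st.
  have sb : s <= b by move: sd; rewrite /d le_min => /andP[].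
  have sc : s <= c + r / 2 by move: sd; rewrite /d le_min => /andP[].
  have h1 : `|f t - f a| <= M t - M a by apply: St; rewrite at_ lexx.
  have h2 : `|f s - f t| <= M s - M t.
    apply: Hr => //; first exact: ltW.
      by rewrite ltr_norml; apply/andP; split; rewrite -/c in tc *; lra.
    by rewrite ltr_norml; apply/andP; split; rewrite -/c in tc *; lra.
  have -> : f s - f a = (f s - f t) + (f t - f a) by ring.
  apply: (le_trans (ler_normD _ _)); lra.
have dc : d <= c by apply: sup_upper_bound.
have bd : d = b.
  have bc : b <= c by move: dc; rewrite ge_min => /orP[//|h]; exfalso; lra.
  by rewrite /d min_l//; lra.
case: Sd => _ /(_ b); apply; rewrite bd ab lexx//.
Qed.

(** Near each [t] the increment of [G (f1, f2)] differs from the integral of the proposed density by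
    at most [2 * d] times the integral of [|g1| + |g2|]: one [d] comes from strict differentiability
    at [t], the other from freezing the continuous coefficients at [t]. [local_to_global] adds these
    errors up, and [d] is arbitrary. *)
Lemma AC_sd (G v1 v2 : R -> R -> R) f1 g1 f2 g2 :
  continuous f1 -> continuous f2 -> AC f1 g1 -> AC f2 g2 ->
  (forall t, sd G (f1 t) (f2 t) (v1 (f1 t) (f2 t)) (v2 (f1 t) (f2 t))) ->
  continuous (fun t => v1 (f1 t) (f2 t)) -> continuous (fun t => v2 (f1 t) (f2 t)) ->
  AC (fun t => G (f1 t) (f2 t))
     (fun t => v1 (f1 t) (f2 t) * g1 t + v2 (f1 t) (f2 t) * g2 t).
Proof.
move=> cf1 cf2 [lg1 H1] [lg2 H2] sG cw1 cw2.
set w1 := fun t => v1 (f1 t) (f2 t); set w2 := fun t => v2 (f1 t) (f2 t).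
set F := fun t => G (f1 t) (f2 t).
have lw1 : lint (fun t => w1 t * g1 t) by exact: lintM.
have lw2 : lint (fun t => w2 t * g2 t) by exact: lintM.
set g := fun t => w1 t * g1 t + w2 t * g2 t.
have lg : lint g by exact: lintD.
split => // a b ab.
pose K : R -> R := fun t => `|g1 t| + `|g2 t|.
have lK : lint K by apply: lintD; exact: lint_norm.
apply/eqP; rewrite -subr_eq0 -normr_le0; apply/ler_addgt0Pl => e; rewrite -[0 < e]/(0 < (e : R)) => e0; rewrite addr0.
set KK := \int[mu]_(x in `[a, b]) K x.
have KK0 : 0 <= KK by apply: Rintegral_ge0 => x _; rewrite /K addr_ge0.
(* The total error is [2 * d * KK <= e]; the [+ 1] covers [KK = 0]. *)
pose d : R := e / (2 * (KK + 1)).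
have d0 : 0 < d by rewrite divr_gt0// mulr_gt0//; lra.
(* The vanishing integral over [[a, a]] turns the quantity into an increment of one function, as
   [local_to_global] expects. *)
have -> : F b - F a - \int[mu]_(x in `[a, b]) g x =
  (F b - \int[mu]_(x in `[a, b]) g x) - (F a - \int[mu]_(x in `[a, a]) g x).
  rewrite int_point; ring.
have : `|(F b - \int[mu]_(x in `[a, b]) g x) - (F a - \int[mu]_(x in `[a, a]) g x)|
  <= 2 * d * KK - 2 * d * \int[mu]_(x in `[a, a]) K x.
  apply: (@local_to_global (fun t => F t - \int[mu]_(x in `[a, t]) g x)
    (fun t => 2 * d * \int[mu]_(x in `[a, t]) K x)) => // t /andP[at_ tb].
  have [r1 r10 Hr1] := sG t _ d0.
  have nf (h : R -> R) (ch : continuous h) e' : 0 < e' -> exists2 r : R, 0 < r & forall s, `|s - t| < r -> `|h s - h t| < e'.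
    move=> e'0; have /cvgrPdist_lt /(_ _ e'0) [r /= r0 Hr] := ch t.
    by exists r => // s st; rewrite distrC; apply: Hr; rewrite /= distrC.
  have [q1 q10 Q1] := nf _ cf1 _ r10.
  have [q2 q20 Q2] := nf _ cf2 _ r10.
  have [q3 q30 Q3] := nf _ cw1 _ d0.
  have [q4 q40 Q4] := nf _ cw2 _ d0.
  exists (Num.min (Num.min q1 q2) (Num.min q3 q4)); first by rewrite !lt_min q10 q20 q30 q40.
  move=> s s' as_ ss' s'b; rewrite !lt_min => /andP[/andP[a1 a2] /andP[a3 a4]] /andP[/andP[b1 b2] /andP[b3 b4]].
  rewrite (int_split lg as_ ss') (int_split lK as_ ss').
  rewrite mulrDr (addrC (2 * d * _)) addrK.
  set I1 := \int[mu]_(x in `[a, s]) g x.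
  have -> : F s' - (I1 + \int[mu]_(x in `[s, s']) g x) - (F s - I1) =
    (F s' - F s - (w1 t * (f1 s' - f1 s) + w2 t * (f2 s' - f2 s))) +
    (w1 t * (f1 s' - f1 s) + w2 t * (f2 s' - f2 s) - \int[mu]_(x in `[s, s']) g x) by ring.
  apply: (le_trans (ler_normD _ _)).
  have ss1 : `|f1 s' - f1 s| + `|f2 s' - f2 s| <= \int[mu]_(x in `[s, s']) K x.
    by rewrite intD; [rewrite H1// H2//; apply: lerD; exact: int_abs|exact: lint_norm|exact: lint_norm].
  have p1 : `|F s' - F s - (w1 t * (f1 s' - f1 s) + w2 t * (f2 s' - f2 s))| <=
     d * \int[mu]_(x in `[s, s']) K x.
    apply: (le_trans (Hr1 _ _ _ _ (Q1 _ b1) (Q2 _ b2) (Q1 _ a1) (Q2 _ a2))).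
    by rewrite ler_pM2l.
  have p2 : `|w1 t * (f1 s' - f1 s) + w2 t * (f2 s' - f2 s) - \int[mu]_(x in `[s, s']) g x| <=
     d * \int[mu]_(x in `[s, s']) K x.
    rewrite H1// H2// -!intZ// -intD; [|exact: lintZ|exact: lintZ].
    have l12 : lint (fun x => w1 t * g1 x + w2 t * g2 x) by apply: lintD; exact: lintZ.
    rewrite -intB//.
    apply: (le_trans (int_abs _ _ (lintB l12 lg))).
    apply: int_le; [apply: lint_norm; exact: lintB|exact: lintZ|].
    move=> x /andP[sx xs'].
    have xt (r : R) : `|s - t| < r -> `|s' - t| < r -> `|x - t| < r.
      by rewrite !ltr_norml => /andP[? ?] /andP[? ?]; apply/andP; split; lra.
    have -> : w1 t * g1 x + w2 t * g2 x - g x = (w1 t - w1 x) * g1 x + (w2 t - w2 x) * g2 x.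
      rewrite /g; ring.
    rewrite /K mulrDr; apply: (le_trans (ler_normD _ _)); rewrite !normrM.
    apply: lerD; apply: ler_wpM2r => //; rewrite distrC ltW//.
      by apply: Q3; exact: xt.
    by apply: Q4; exact: xt.
  have -> : 2 * d * \int[mu]_(x in `[s, s']) K x =
    d * \int[mu]_(x in `[s, s']) K x + d * \int[mu]_(x in `[s, s']) K x by ring.
  exact: lerD.
rewrite (int_point K) mulr0 subr0 => /le_trans; apply.
rewrite /d; rewrite (_ : 2 * (e / (2 * (KK + 1))) * KK = e * (KK / (KK + 1))); last first.
  by field; apply/eqP; lra.
rewrite ger_pMr// ler_pdivrMr; lra.
Qed.

End OneVariable.

(** * Smooth cutoffs *)

Section Bumps.
Context {R : realType}.
Notation mu := (@lebesgue_measure R).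
Implicit Types (f g h b c : R -> R) (s t x : R).

Lemma is_derive_eps f x l :
  (forall e : R, 0 < e -> exists2 d : R, 0 < d & forall y, `|y - x| < d ->
     `|f y - f x - l * (y - x)| <= e * `|y - x|) <-> is_derive x 1 f l.
Proof.
split => [H|[df dl] e e0].
  suff cv : (fun h : R => h^-1 *: ((f \o shift x) (h *: (1 : R)) - f x)) @ 0^' --> l.
    by apply: DeriveDef; [apply/cvg_ex; exists l|exact: cvg_lim].
  apply/cvgrPdist_le => e e0; have [d d0 Hd] := H _ e0.
  near=> h.
  have h0 : h != 0 by near: h; exact: nbhs_dnbhs_neq.
  have hd : `|h| < d by near: h; apply: dnbhs0_lt.
  have := Hd (h + x); rewrite addrK => /(_ hd) H1.
  have -> : l - h^-1 *: ((f \o shift x) (h *: (1 : R)) - f x) =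
     - (h^-1 * (f (h + x) - f x - l * h)).
    rewrite /= [h *: 1]mulr1 /GRing.scale/=; field; exact: h0.
  by rewrite normrN normrM normfV ler_pdivrMl ?normr_gt0// (le_trans H1)// mulrC.
have cv : (fun h : R => h^-1 *: ((f \o shift x) (h *: (1 : R)) - f x)) @ 0^' --> l.
  by rewrite -dl; exact: df.
have /cvgrPdist_le /(_ _ e0) [d /= d0 Hd] := cv.
exists d => // y yd.
have [->|yx] := eqVneq y x; first by rewrite !subrr mulr0 subrr normr0 mulr0.
have h0 : y - x != 0 by rewrite subr_eq0.
have /= := Hd (y - x); rewrite sub0r normrN => /(_ yd h0).
rewrite [(y - x) *: 1]mulr1 subrK /GRing.scale/= => H1.
have -> : f y - f x - l * (y - x) = - ((y - x) * (l - (y - x)^-1 * (f y - f x))).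
  by field.
by rewrite normrN normrM mulrC ler_wpM2r.
Unshelve. all: by end_near. Qed.

Lemma is_derive_continuous f x l : is_derive x 1 f l -> {for x, continuous f}.
Proof. by move=> [df _]; apply: differentiable_continuous; apply/derivable1_diffP. Qed.

Lemma is_derive_continuousT f g : (forall x, is_derive x 1 f (g x)) -> continuous f.
Proof. by move=> H x; exact: is_derive_continuous (H x). Qed.

(** Class C^k with the derivative as an existential witness, so that closure under sums, products
    and inverses is a plain induction without formulas for iterated derivatives. *)
Fixpoint sm k f := if k is k'.+1 then
  exists2 g, (forall x, is_derive x 1 f (g x)) & sm k' g else continuous f.

Definition smooth f := forall k, sm k f.

Lemma sm_cont k f : sm k f -> continuous f.
Proof. by case: k => [//|k [g Hg _]]; exact: is_derive_continuousT Hg. Qed.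

Lemma smS k f : sm k.+1 f -> sm k f.
Proof.
elim: k f => [|k IH] f; first by exact: sm_cont.
by move=> [g Hg sg]; exists g => //; exact: IH.
Qed.

Lemma smD k f g : sm k f -> sm k g -> sm k (fun x => f x + g x).
Proof.
elim: k f g => [|k IH] f g; first by move=> cf cg x; apply: cvgD; [exact: cf|exact: cg].
move=> [f' Hf sf] [g' Hg sg]; exists (fun x => f' x + g' x); last exact: IH.
by move=> x; apply: is_deriveD.
Qed.

Lemma smM k f g : sm k f -> sm k g -> sm k (fun x => f x * g x).
Proof.
elim: k f g => [|k IH] f g; first by move=> cf cg x; apply: cvgM; [exact: cf|exact: cg].
move=> Hf Hg; have sf := smS Hf; have sg := smS Hg.
case: Hf Hg => [f' Hf sf'] [g' Hg sg'].
exists (fun x => f x * g' x + g x * f' x); last by apply: smD; exact: IH.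
by move=> x; exact: is_deriveM.
Qed.

Lemma sm_cst k (a : R) : sm k (fun=> a).
Proof.
elim: k a => [|k IH] a; first by move=> x; exact: cst_continuous.
by exists (fun=> 0) => // x; exact: is_derive_cst.
Qed.

Lemma smV k f : (forall x, f x != 0) -> sm k f -> sm k (fun x => (f x)^-1).
Proof.
move=> f0; elim: k => [|k IH]; first by move=> cf x; apply: cvgV; [exact: f0|exact: cf].
move=> Hf; have sf := smS Hf; case: Hf => [f' Hf sf'].
exists (fun x => - 1 * (f' x * ((f x)^-1 * (f x)^-1))); last first.
  by apply: smM; [exact: sm_cst|apply: smM => //; apply: smM; exact: IH].
move=> x; have [df dl] := Hf x.
apply: DeriveDef; first exact: derivableV.
rewrite deriveV// dl /GRing.scale/= mulN1r mulNr; congr (- _).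
by rewrite mulrC -expr2 exprVn.
Qed.

Lemma sm_affine k f p q : sm k f -> sm k (fun x => f (p * x + q)).
Proof.
elim: k f => [|k IH] f.
  move=> cf x; apply: (@continuous_comp _ _ _ (fun x => p * x + q) f); last exact: cf.
  by apply: cvgD; [apply: cvgM; [exact: cvg_cst|exact: cvg_id]|exact: cvg_cst].
move=> [f' Hf sf]; exists (fun x => f' (p * x + q) * p); last first.
  by apply: smM; [exact: IH|exact: sm_cst].
move=> x; apply: (@is_derive1_comp _ f (fun x => p * x + q) x (f' (p * x + q)) p).
apply/is_derive_eps => e e0; exists 1 => // y _.
have -> : p * y + q - (p * x + q) - p * (y - x) = 0 by ring.
by rewrite normr0 mulr_ge0// ltW.
Qed.

(* The extra factor [x^-m] makes the family stable under differentiation. *)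
Definition flat_exp (m : nat) x : R := if 0 < x then x^-1 ^+ m * expR (- x^-1) else 0.

Lemma flat_exp_ge0 m x : 0 <= flat_exp m x.
Proof. by rewrite /flat_exp; case: ifP => // x0; rewrite mulr_ge0 ?expR_ge0// exprn_ge0// invr_ge0 ltW. Qed.

(** Comes from [exp y >= y^(m+2) / (m+2)!] at [y = 1/x]. A quadratic bound is what makes the
    derivative at the origin exist and vanish. *)
Lemma flat_exp_le m x : 0 < x -> flat_exp m x <= (m.+2)`!%:R * x ^+ 2.
Proof.
move=> x0; rewrite /flat_exp x0 expRN.
have xi : 0 < x^-1 by rewrite invr_gt0.
have H := expR_ge1Dxn m.+1 (ltW xi).
rewrite -ler_pdivlMl ?exprn_gt0//.
have p0 : 0 < x^-1 ^+ m.+2 / (m.+2)`!%:R :> R by rewrite divr_gt0 ?exprn_gt0 ?ltr0n ?fact_gt0.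
apply: (@le_trans _ _ (x^-1 ^+ m.+2 / (m.+2)`!%:R)^-1).
  by rewrite lef_pV2 ?posrE ?expR_gt0//; lra.
rewrite invfM invrK !exprVn !invrK le_eqVlt; apply/orP; left; apply/eqP.
have fx : x != 0 by rewrite gt_eqF.
rewrite -[in X in X * _]addn2 exprD; ring.
Qed.

Lemma flat_exp_derive m x :
  is_derive x 1 (flat_exp m) (flat_exp m.+2 x - m%:R * flat_exp m.+1 x).
Proof.
case: (ltgtP 0 x) => [x0|x0|<-]; last first.
- rewrite {2 3}/flat_exp ltxx mulr0 subrr.
  apply/is_derive_eps => e e0.
  have f0 : 0 < (m.+2)`!%:R :> R by rewrite ltr0n fact_gt0.
  exists (e / (m.+2)`!%:R); first by rewrite divr_gt0.
  move=> y; rewrite subr0 {2}/flat_exp ltxx subr0 mul0r subr0 => yd.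
  rewrite ger0_norm ?flat_exp_ge0//.
  have [y0|y0] := ltP 0 y; last by rewrite /flat_exp ltNge y0/= mulr_ge0// ltW.
  apply: (le_trans (flat_exp_le m y0)).
  rewrite (gtr0_norm y0) in yd *.
  rewrite expr2 mulrA ler_pM2r// mulrC -ler_pdivlMr//; exact: ltW.
- have -> : flat_exp m.+2 x - m%:R * flat_exp m.+1 x = 0.
    by rewrite /flat_exp ltNge (ltW x0)/= mulr0 subrr.
  apply: (near_eq_is_derive (f := cst (0 : R))).
  by near=> y; rewrite /flat_exp ltNge (_ : y <= 0)//; apply: ltW; near: y; exact: lt_nbhsl.
- have xn0 : x != 0 by rewrite gt_eqF.
  apply: (@near_eq_is_derive _ _ _ (fun y : R => y^-1 ^+ m * expR (- y^-1))).
    by near=> y; rewrite /flat_exp (_ : 0 < y)//; near: y; exact: lt_nbhsr.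
  have dV : is_derive x 1 (fun y : R => y^-1) (- x ^- 2).
    apply: DeriveDef; first by apply: derivableV => //; exact: derivable_id.
    by rewrite deriveV// derive_id /GRing.scale/= mulr1.
  have dV' : is_derive x 1 (fun y : R => - y^-1) (x ^- 2).
    by rewrite -[x ^- 2]opprK; exact: is_deriveN.
  have d1 : is_derive x 1 (fun y : R => y^-1 ^+ m) (m%:R * x^-1 ^+ m.-1 * (- x ^- 2)).
    have -> : (fun y : R => y^-1 ^+ m) = (fun y : R => y^-1) ^+ m by apply/funext => y; rewrite exprfctE.
    by apply: (is_derive_eq (is_deriveX m dV)).
  have d2 : is_derive x 1 (fun y : R => expR (- y^-1)) (expR (- x^-1) * x ^- 2).
    by apply: (@is_derive1_comp _ expR (fun y => - y^-1)).
  have d3 := is_deriveM d1 d2.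
  apply: (is_derive_eq d3).
  rewrite /flat_exp x0 /GRing.scale/= -!exprVn.
  by case: m {d1 d3} => [|m] /=; rewrite ?mulr0 ?mul0r ?subr0 ?exprS; ring.
Unshelve. all: by end_near. Qed.

Lemma flat_exp_smooth m : smooth (flat_exp m).
Proof.
move=> k; elim: k m => [|k IH] m.
  exact: is_derive_continuousT (flat_exp_derive m).
exists (fun x => flat_exp m.+2 x + (- m%:R) * flat_exp m.+1 x).
  by move=> x; rewrite mulNr; exact: flat_exp_derive.
by apply: smD => //; apply: smM => //; exact: sm_cst.
Qed.

(** The usual smooth transition from 0 on [x <= 0] to 1 on [x >= 1]. Writing [- 1 * x + 1] for
    [1 - x] matches the pattern of [sm_affine]. *)
Definition step x : R := flat_exp 0 x * (flat_exp 0 x + flat_exp 0 (- 1 * x + 1))^-1.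

Lemma flat_exp0_gt0 x : 0 < x -> 0 < flat_exp 0 x.
Proof. by move=> x0; rewrite /flat_exp x0 expr0 mul1r expR_gt0. Qed.

Lemma step_den x : 0 < flat_exp 0 x + flat_exp 0 (- 1 * x + 1).
Proof.
have := flat_exp_ge0 0 x; have := flat_exp_ge0 0 (- 1 * x + 1).
have [x0|x0] := ltP 0 x; first by have := flat_exp0_gt0 x0; lra.
by have : 0 < flat_exp 0 (- 1 * x + 1); [apply: flat_exp0_gt0; lra|lra].
Qed.

Lemma step_smooth : smooth step.
Proof.
move=> k; apply: smM; first exact: flat_exp_smooth.
apply: smV; first by move=> x; rewrite gt_eqF// step_den.
apply: smD; first exact: flat_exp_smooth.
by apply: (@sm_affine _ (flat_exp 0)); exact: flat_exp_smooth.
Qed.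

Lemma step_le0 x : x <= 0 -> step x = 0.
Proof. by move=> x0; rewrite /step {1}/flat_exp ltNge x0/= mul0r. Qed.

Lemma step_ge1 x : 1 <= x -> step x = 1.
Proof.
move=> x1; rewrite /step; have := step_den x.
have -> : flat_exp 0 (- 1 * x + 1) = 0 by rewrite /flat_exp ifF//; apply/negbTE; rewrite -leNgt; lra.
by rewrite addr0 => d; rewrite divff// gt_eqF.
Qed.

Lemma step_ge0 x : 0 <= step x.
Proof. by rewrite /step mulr_ge0 ?flat_exp_ge0// invr_ge0 ltW// step_den. Qed.

Lemma step_le1 x : step x <= 1.
Proof.
rewrite /step ler_pdivrMr ?step_den// mul1r.
by have := flat_exp_ge0 0 (- 1 * x + 1); lra.
Qed.

Lemma smooth_derive f : smooth f -> forall x, is_derive x 1 f (f^`()%classic x).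
Proof. by move=> sf x; have [g Hg _] := sf 1; rewrite derive1E; apply: derivableP; case: (Hg x). Qed.

Lemma smooth_derive1 f : smooth f -> smooth f^`()%classic.
Proof.
move=> sf k; have [g Hg sg] := sf k.+1.
suff -> : f^`()%classic = g by [].
by apply/funext => x; rewrite derive1E; case: (Hg x).
Qed.

Lemma smooth_cont f : smooth f -> continuous f.
Proof. by move=> /(_ 0). Qed.

Lemma derive1_cst_near f x : (exists2 d : R, 0 < d & forall y, `|y - x| < d -> f y = f x) ->
  f^`()%classic x = 0.
Proof.
move=> [d d0 H]; rewrite derive1E.
suff [] : is_derive x 1 f 0 by [].
apply/is_derive_eps => e e0; exists d => // y yd.
by rewrite H// subrr mul0r subr0 normr0 mulr_ge0// ltW.
Qed.

Definition step' := step^`()%classic.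

Lemma step'_out x : ~~ (0 < x < 1) -> step' x = 0.
Proof.
have cs' : continuous step' := smooth_cont (smooth_derive1 step_smooth).
have lt0 y : y < 0 -> step' y = 0.
  move=> y0; apply: derive1_cst_near; exists (- y); first lra.
  by move=> z; rewrite ltr_norml => /andP[_ ?]; rewrite !step_le0//; lra.
have gt1 y : 1 < y -> step' y = 0.
  move=> y0; apply: derive1_cst_near; exists (y - 1); first lra.
  by move=> z; rewrite ltr_norml => /andP[? ?]; rewrite !step_ge1//; lra.
rewrite negb_and -!leNgt => /orP[x0|x1].
  (* At the end points 0 and 1 the value is found by continuity of [step'], as a limit of zeros from
     outside. *)
  move: x0; rewrite le_eqVlt => /orP[/eqP->|/lt0//].
  apply/eqP; rewrite -normr_le0; apply/ler_addgt0Pl => e e0; rewrite addr0.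
  have /cvgrPdist_le/(_ _ e0)[d /= d0 Hd] := cs' 0.
  have := Hd (- (d / 2)); rewrite (lt0 (- (d / 2))) ?subr0; last by rewrite oppr_lt0 divr_gt0.
  apply; rewrite /= sub0r opprK gtr0_norm ?divr_gt0//; lra.
move: x1; rewrite le_eqVlt => /orP[/eqP<-|/gt1//].
apply/eqP; rewrite -normr_le0; apply/ler_addgt0Pl => e e0; rewrite addr0.
have /cvgrPdist_le/(_ _ e0)[d /= d0 Hd] := cs' 1.
have := Hd (1 + (d / 2)); rewrite (gt1 (1 + (d / 2))) ?subr0; last by rewrite ltrDl divr_gt0.
by apply; rewrite /= opprD addrA subrr sub0r normrN gtr0_norm ?divr_gt0//; lra.
Qed.

Lemma step'_bound : exists2 M : R, 0 < M & forall x, `|step' x| <= M.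
Proof.
have cs' : continuous step' := smooth_cont (smooth_derive1 step_smooth).
have /compact_bounded[M [Mr HM]] : compact (step' @` `[0, 1]).
  apply: continuous_compact; last exact: segment_compact.
  exact: continuous_subspaceT.
have M1 : M < `|M| + 1 by have := ler_norm M; lra.
exists (`|M| + 1) => [|x]; first by have := normr_ge0 M; lra.
have [/andP[x0 x1]|/step'_out->] := boolP (0 < x < 1); last by rewrite normr0; have := normr_ge0 M; lra.
by apply: (HM _ M1); exists x => //=; rewrite in_itv/= !ltW.
Qed.

(** Smooth approximation of the indicator of []s, t]]: both ramps have width [1/(n+1)] and lie to
    the right of [s] and of [t], so the support stays in [[s, t + 1]] for every [n]. *)
Definition bump (n : nat) s t x := step (n.+1%:R * x + - (n.+1%:R * s)) +
  - 1 * step (n.+1%:R * x + - (n.+1%:R * t)).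

Lemma bump_smooth n s t : smooth (bump n s t).
Proof.
move=> k; apply: smD.
  by apply: (@sm_affine _ step); exact: step_smooth.
by apply: smM; [exact: sm_cst|apply: (@sm_affine _ step); exact: step_smooth].
Qed.

Lemma step_aff n (s x : R) : [/\ x <= s -> step (n.+1%:R * x + - (n.+1%:R * s)) = 0,
  s + n.+1%:R^-1 <= x -> step (n.+1%:R * x + - (n.+1%:R * s)) = 1,
  x <= s -> step' (n.+1%:R * x + - (n.+1%:R * s)) = 0 &
  s + n.+1%:R^-1 <= x -> step' (n.+1%:R * x + - (n.+1%:R * s)) = 0].
Proof.
have n0 : 0 < n.+1%:R :> R by rewrite ltr0n.
have -> : n.+1%:R * x + - (n.+1%:R * s) = n.+1%:R * (x - s) by ring.
have H1 : x <= s -> n.+1%:R * (x - s) <= 0 by move=> xs; rewrite pmulr_rle0//; lra.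
have H2 : s + n.+1%:R^-1 <= x -> 1 <= n.+1%:R * (x - s).
  by move=> xs; rewrite -ler_pdivrMl// mulr1 lerBrDl.
split => [/H1 h|/H2 h|/H1 h|/H2 h].
- exact: step_le0.
- exact: step_ge1.
- by apply: step'_out; rewrite negb_and -leNgt h.
- by apply: step'_out; rewrite negb_and -!leNgt h orbT.
Qed.

Lemma invS_le1 n : n.+1%:R^-1 <= 1 :> R.
Proof. by rewrite invf_le1 ?ltr0n// ler1n. Qed.

Lemma bump_out n s t x : s <= t -> ~~ (s <= x <= t + 1) -> bump n s t x = 0.
Proof.
move=> st; rewrite negb_and -!ltNge /bump.
have [h1 h2 _ _] := step_aff n s x; have [k1 k2 _ _] := step_aff n t x.
have n1 := invS_le1 n.
move: (n.+1%:R^-1) n1 h2 k2 => i n1 h2 k2.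
by move=> /orP[xs|tx]; [rewrite h1 ?k1|rewrite h2 ?k2]; rewrite ?mulr0 ?addr0 ?mulr1 ?subrr//; lra.
Qed.

Lemma bump_norm n s t x : `|bump n s t x| <= 1.
Proof.
rewrite /bump ler_norml; set a := step _; set b := step _.
have := step_ge0 (n.+1%:R * x + - (n.+1%:R * s)); have := step_le1 (n.+1%:R * x + - (n.+1%:R * s)).
have := step_ge0 (n.+1%:R * x + - (n.+1%:R * t)); have := step_le1 (n.+1%:R * x + - (n.+1%:R * t)).
by rewrite -/a -/b => ? ? ? ?; apply/andP; split; lra.
Qed.

Lemma bump_deriv n s t x : is_derive x 1 (bump n s t)
  (n.+1%:R * step' (n.+1%:R * x + - (n.+1%:R * s)) - n.+1%:R * step' (n.+1%:R * x + - (n.+1%:R * t))).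
Proof.
have D r : is_derive x 1 (fun x => step (n.+1%:R * x + - (n.+1%:R * r)))
    (n.+1%:R * step' (n.+1%:R * x + - (n.+1%:R * r))).
  have ds := smooth_derive step_smooth (n.+1%:R * x + - (n.+1%:R * r)).
  rewrite [n.+1%:R * step' _]mulrC; apply: (@is_derive1_comp _ step (fun x => n.+1%:R * x + - (n.+1%:R * r)) x (step' _) n.+1%:R).
  apply/is_derive_eps => e e0; exists 1 => // y _.
  have -> : n.+1%:R * y - n.+1%:R * r - (n.+1%:R * x - n.+1%:R * r) - n.+1%:R * (y - x) = 0 by ring.
  by rewrite normr0 mulr_ge0// ltW.
have -> : bump n s t = (fun x => step (n.+1%:R * x + - (n.+1%:R * s))) - (fun x => step (n.+1%:R * x + - (n.+1%:R * t))).
  by apply/funext => y; rewrite /bump mulN1r.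
exact: is_deriveB.
Qed.

End Bumps.

(** * Almost-everywhere reasoning and dominated convergence *)

Lemma ae_imp d (T : measurableType d) (R : realType) (mu : {measure set T -> \bar R})
    (P Q : T -> Prop) :
  (forall x, P x -> Q x) -> {ae mu, forall x, P x} -> {ae mu, forall x, Q x}.
Proof. by move=> PQ; apply: filterS. Qed.

Lemma ae_and d (T : measurableType d) (R : realType) (mu : {measure set T -> \bar R})
    (P Q : T -> Prop) :
  {ae mu, forall x, P x} -> {ae mu, forall x, Q x} -> {ae mu, forall x, P x /\ Q x}.
Proof. by apply: filterS2. Qed.

Lemma ae_countable d (T : measurableType d) (R : realType) (mu : {measure set T -> \bar R})
    (I : countType) (P : I -> T -> Prop) :
  (forall i, {ae mu, forall x, P i x}) -> {ae mu, forall x, forall i, P i x}.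
Proof.
move=> H.
have Hn (n : nat) : {ae mu, forall x, if @unpickle I n is Some i then P i x else True}.
  by case: (unpickle n) => [i|]; [exact: H|exact: aeW].
have := ae_foralln Hn.
by apply: ae_imp => x Hx i; have := Hx (pickle i); rewrite pickleK.
Qed.

Lemma Rdominated_cvg d (T : measurableType d) (R : realType)
    (mu : {measure set T -> \bar R}) (D : set T) (mD : measurable D)
    (f_ : nat -> T -> R) (f g : T -> R) :
  (forall n, measurable_fun D (f_ n)) -> measurable_fun D f ->
  {ae mu, forall x, D x -> f_ ^~ x @ \oo --> f x} ->
  mu.-integrable D (EFin \o g) ->
  (forall n x, D x -> `|f_ n x| <= g x) ->
  (fun n => \int[mu]_(x in D) f_ n x) @ \oo --> \int[mu]_(x in D) f x.
Proof.
move=> mf_ mf cf ig fg.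
have [] := @dominated_convergence _ _ _ mu D mD (fun n => EFin \o f_ n) (EFin \o f) (EFin \o g).
- by move=> n; apply/measurable_EFinP.
- exact/measurable_EFinP.
- by apply: filterS cf => x cfx Dx; apply: cvg_EFin; [exact: nearW|exact: cfx].
- exact: ig.
- by apply: aeW => x n Dx; rewrite /= lee_fin fg.
move=> intf _ cv; apply: fine_cvg.
rewrite fineK; first exact: cv.
exact: integrable_fin_num.
Qed.

(** * Weak derivatives on the line *)

Section FundamentalLemma.
Context {R : realType}.
Notation mu := (@lebesgue_measure R).
Implicit Types (f g h b c : R -> R) (s t x : R).

Lemma int_supp h s t : (forall x, ~~ (s <= x <= t) -> h x = 0) ->
  \int[mu]_x h x = \int[mu]_(x in `[s, t]) h x.
Proof.
move=> h0; rewrite [RHS]Rintegral_mkcond; apply: eq_Rintegral => x _.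
rewrite patchE; case: ifPn => // /negP xst; apply: h0; apply/negP => st; apply: xst.
by rewrite inE/= in_itv.
Qed.

Lemma integrable_supp h s t : lint h -> (forall x, ~~ (s <= x <= t) -> h x = 0) ->
  mu.-integrable setT (EFin \o h).
Proof.
move=> lh h0.
have -> : EFin \o h = (EFin \o h) \_ `[s, t].
  apply/funext => x; rewrite patchE; case: ifPn => // /negP xst /=; rewrite h0//.
  by apply/negP => st; apply: xst; rewrite inE/= in_itv.
by apply: (integrable_mkcond _ _).1 => //; exact: lh.
Qed.

Definition csm b := smooth b /\ exists N : R, forall x, ~~ (- N <= x <= N) -> b x = 0.

Lemma bump_csm n s t : s <= t -> csm (bump n s t).
Proof.
move=> st; split; first exact: bump_smooth.
exists (`|s| + `|t| + 1) => x xN; apply: bump_out => //; apply: contra xN => /andP[sx xt].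
have := ler_norm t; have := ler_norm (- s); rewrite normrN; have := normr_ge0 s; have := normr_ge0 t.
by move=> ? ? ? ?; apply/andP; split; lra.
Qed.

Lemma near_addinv r x : r < x -> \forall n \near \oo, r + n.+1%:R^-1 <= x.
Proof.
move=> rx; have xr : 0 < x - r by lra.
have := near_infty_natSinv_lt (PosNum xr); apply: filterS => n /= h.
by move: (n.+1%:R^-1) h => i h; lra.
Qed.

Lemma bump_lim s t x : s < t ->
  \forall n \near \oo, bump n s t x = if s < x <= t then 1 else 0.
Proof.
move=> st; rewrite /bump.
have [xs|sx] := leP x s => /=.
  apply: nearW => n; have [h1 _ _ _] := step_aff n s x; have [k1 _ _ _] := step_aff n t x.
  by rewrite h1 ?k1 ?mulr0 ?addr0//; lra.
have [xt|tx] := leP x t.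
  apply: filterS (near_addinv sx) => n xn.
  have [_ h1 _ _] := step_aff n s x; have [k1 _ _ _] := step_aff n t x.
  by rewrite h1 ?k1 ?mulr0 ?addr0.
apply: filterS2 (near_addinv sx) (near_addinv tx) => n xn tn.
have [_ h1 _ _] := step_aff n s x; have [_ k1 _ _] := step_aff n t x.
by rewrite h1 ?k1//; ring.
Qed.

Lemma bump_cvg g s t : lint g -> s < t ->
  (fun n => \int[mu]_x (g x * bump n s t x)) @ \oo --> \int[mu]_(x in `[s, t]) g x.
Proof.
move=> lg st.
have -> : (fun n => \int[mu]_x (g x * bump n s t x)) =
          (fun n => \int[mu]_(x in `[s, t + 1]) (g x * bump n s t x)).
  by apply/funext => n; apply: int_supp => x xst; rewrite bump_out ?mulr0// ltW.
have -> : \int[mu]_(x in `[s, t]) g x = \int[mu]_(x in `[s, t + 1]) (g \_ `]s, t]) x.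
  rewrite -Rintegral_mkcondr.
  have -> : `[s, t + 1] `&` `]s, t] = (`]s, t]%classic : set R).
    apply/seteqP; split => x /=; rewrite !in_itv/=; first by case.
    by move=> /andP[? ?]; split => //; apply/andP; split; lra.
  rewrite Rintegral_itv_obnd_cbnd//.
  by apply: integrableS (lg s t) => //; apply: subset_itvr; rewrite bnd_simp.
have mg := lint_measurable lg.
apply: (@Rdominated_cvg _ _ _ mu _ _ _ _ (fun x => `|g x|)).
- exact: measurable_itv.
- move=> n; apply: measurable_funTS; apply: measurable_funM => //.
  by apply: continuous_measurable_fun; apply: smooth_cont; exact: bump_smooth.
- apply: measurable_funTS; apply/(measurable_restrictT g); first exact: measurable_itv.
  exact: measurable_funTS.
- apply: aeW => x _; apply: cvg_near_cst.
  apply: filterS (bump_lim x st) => n ->.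
  by rewrite patchE mem_setE in_itv/=; case: ifP; rewrite ?mulr1 ?mulr0.
- exact: (lint_norm lg s (t + 1)).
- by move=> n x _; rewrite normrM ler_piMr// bump_norm.
Qed.

Lemma C1_AC f g : (forall x, is_derive x 1 f (g x)) -> continuous g -> AC f g.
Proof.
move=> df cg; split; first exact: lint_cont.
move=> s t; rewrite le_eqVlt => /orP[/eqP->|st]; first by rewrite int_point subrr.
have cf : continuous f by exact: is_derive_continuousT df.
rewrite /Rintegral (@continuous_FTC2 _ g f)//.
- exact: continuous_subspaceT.
- split; first by move=> x _; case: (df x).
  + by apply: cvg_at_right_filter; exact: cf.
  + by apply: cvg_at_left_filter; exact: cf.
- by move=> x _; rewrite derive1E; case: (df x).
Qed.

(** The derivative of one ramp: an approximate identity concentrated just to the right of [s]. *)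
Definition dstep n s x := n.+1%:R * step' (n.+1%:R * x + - (n.+1%:R * s)) : R.
Definition dbump n s t x := dstep n s x - dstep n t x.

Lemma dstep_cont n s : continuous (dstep n s).
Proof.
move=> x; apply: cvgM; first exact: cvg_cst.
apply: (@continuous_comp _ _ _ (fun x => n.+1%:R * x + - (n.+1%:R * s)) step').
  by apply: cvgD; [apply: cvgM; [exact: cvg_cst|exact: cvg_id]|exact: cvg_cst].
exact: (smooth_cont (smooth_derive1 step_smooth)).
Qed.

Lemma dstep_out n s x : ~~ (s <= x <= s + n.+1%:R^-1) -> dstep n s x = 0.
Proof.
have [_ _ h k] := step_aff n s x.
rewrite negb_and -!ltNge => /orP[/ltW/h|/ltW/k]; rewrite /dstep => ->; exact: mulr0.
Qed.

(** The kernel has integral 1 on an interval of length [1/(n+1)] and is at most [(n+1) * M] in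
    absolute value. Its L1 norm is therefore bounded by [M], which replaces a positivity
    argument. *)
Lemma dstep_cvg f s : continuous f ->
  (fun n => \int[mu]_x (f x * dstep n s x)) @ \oo --> f s.
Proof.
move=> cf; have [M M0 HM] := @step'_bound R.
apply/cvgrPdist_le => e e0.
have eM : 0 < e / M by rewrite divr_gt0.
have /cvgrPdist_le/(_ _ eM)[d /= d0 Hd] := cf s.
have sd_ : s < s + d / 2 by rewrite ltrDl divr_gt0.
apply: filterS (near_addinv sd_) => n nd.
rewrite (@int_supp _ s (s + n.+1%:R^-1)); last first.
  by move=> x xs; rewrite dstep_out ?mulr0.
set i := n.+1%:R^-1 in nd *.
have i0 : 0 < i by rewrite /i invr_gt0 ltr0n.
have si : s <= s + i by lra.
have ck : continuous (dstep n s) by exact: dstep_cont.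
have lk := lint_cont ck.
have lfk : lint (fun x => f x * dstep n s x) by exact: lintM.
have I1 : \int[mu]_(x in `[s, s + i]) dstep n s x = 1.
  have [_ H] : AC (fun x => step (n.+1%:R * x + - (n.+1%:R * s))) (dstep n s).
    apply: C1_AC => // x; rewrite /dstep.
    have ds := smooth_derive step_smooth (n.+1%:R * x + - (n.+1%:R * s)).
    rewrite [n.+1%:R * step' _]mulrC; apply: (@is_derive1_comp _ step (fun x => n.+1%:R * x + - (n.+1%:R * s)) x (step' _) n.+1%:R).
    apply/is_derive_eps => e' e'0; exists 1 => // y _.
    have -> : n.+1%:R * y - n.+1%:R * s - (n.+1%:R * x - n.+1%:R * s) - n.+1%:R * (y - x) = 0 by ring.
    by rewrite normr0 mulr_ge0// ltW.
  rewrite -H//; have [h1 _ _ _] := step_aff n s s; have [_ k1 _ _] := step_aff n s (s + i).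
  by rewrite h1// k1// subr0.
rewrite -[f s]mulr1 -I1 -intZ// -intB//; last exact: lintZ.
have lz : lint (fun x => f s * dstep n s x) by exact: lintZ.
apply: le_trans (int_abs _ _ (lintB lz lfk)) _.
(* Writes [e] as the integral of a constant over the support, so that a pointwise comparison
   suffices. *)
have -> : e = (e * n.+1%:R) * (s + i - s) by rewrite addrAC subrr add0r /i mulfK// pnatr_eq0.
rewrite -int_cst//; apply: int_le.
- by apply: lint_norm; exact: lintB.
- by apply: lint_cont => x; exact: cst_continuous.
move=> x /andP[sx xs]; rewrite -mulrBl normrM /dstep normrM.
have H1 : `|f s - f x| <= e / M.
  apply: Hd => /=; rewrite distrC ger0_norm ?subr_ge0//.
  by move: nd; lra.
have -> : e * n.+1%:R = e / M * (n.+1%:R * M) by field; rewrite gt_eqF.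
apply: ler_pM => //.
by rewrite normr_nat ler_pM2l ?ltr0n.
Qed.

Lemma dbump_cvg f s t : continuous f ->
  (fun n => \int[mu]_x (f x * dbump n s t x)) @ \oo --> f s - f t.
Proof.
move=> cf.
have I n r : mu.-integrable setT (EFin \o (fun x => f x * dstep n r x)).
  apply: (@integrable_supp _ r (r + n.+1%:R^-1)).
    by apply: lintM => //; apply: lint_cont; exact: dstep_cont.
  by move=> x xr; rewrite dstep_out ?mulr0.
have -> : (fun n => \int[mu]_x (f x * dbump n s t x)) =
    (fun n => \int[mu]_x (f x * dstep n s x) - \int[mu]_x (f x * dstep n t x)).
  apply/funext => n; rewrite -RintegralB//.
  by apply: eq_Rintegral => x _; rewrite mulrBr.
by apply: cvgB; exact: dstep_cvg.
Qed.

Lemma lint_locally g : lint g -> locally_integrable setT g.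
Proof.
move=> lk.
split => //; [exact: lint_measurable|exact: openT|].
move=> K _ cK; have /compact_bounded[M [Mr HM]] := cK.
have M1 : M < `|M| + 1 by have := ler_norm M; lra.
have KM : K `<=` `[- (`|M| + 1), `|M| + 1].
  by move=> x /(HM _ M1); rewrite /= in_itv/= ler_norml.
have mK := compact_measurable cK.
have : mu.-integrable K (EFin \o g) by apply: integrableS (lk _ _) => //; exact: KM.
by case/integrableP.
Qed.

(** Lebesgue differentiation of the integral taken from the base point [- n]; a countable union over
    [n] covers the line. *)
Lemma AC_ae_derive f g : AC f g -> {ae mu, forall x, is_derive (x : R) 1 f (g x)}.
Proof.
move=> [lg Hf].
have Hn (n : nat) : {ae mu, forall x, - n%:R < (x : R) -> is_derive (x : R) 1 f (g x)}.
  have := @FTC1 _ g (BLeft (- n%:R)) (fun y => lg _ _) (lint_locally lg).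
  apply: filterS; first exact: (ae_filter_ringOfSetsType mu).
  move=> x H1 nx; have [|d1 d2] := H1; first by rewrite lte_fin.
  have d3 : is_derive x 1 (fun x : R => \int[mu]_(t in `[- n%:R, x]) g t) (g x).
    by apply: DeriveDef; [exact: d1|rewrite -derive1E; exact: d2].
  apply/is_derive_eps => e e0; have [d d0 Hd] := (is_derive_eps _ _ _).2 d3 e e0.
  have xn : 0 < x + n%:R by lra.
  exists (Num.min d (x + n%:R)) => [|y]; first by rewrite lt_min d0.
  rewrite lt_min => /andP[yd]; rewrite ltr_norml => /andP[y1 y2].
  have := Hd y yd.
  have <- : f x - f (- n%:R) = \int[mu]_(t in `[- n%:R, x]) g t by apply: Hf; exact: ltW.
  have <- : f y - f (- n%:R) = \int[mu]_(t in `[- n%:R, y]) g t by apply: Hf; lra.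
  by have -> : f y - f (- n%:R) - (f x - f (- n%:R)) = f y - f x by ring.
have := ae_foralln Hn; apply: filterS => x Hx.
apply: (Hx (Num.truncn `|x|).+1).
by have := truncnS_gt `|x|; have := ler_norm (- x); rewrite normrN; lra.
Qed.

(** The hypothesis says that the zero function is absolutely continuous with density [k], so [k] is
    almost everywhere its derivative. *)
Lemma lint_ae0 k : lint k -> (forall s t, s < t -> \int[mu]_(x in `[s, t]) k x = 0) ->
  {ae mu, forall x, k x = 0}.
Proof.
move=> lk H.
have k0 : AC (fun=> 0) k.
  split => // s t; rewrite subrr le_eqVlt => /orP[/eqP->|/H //]; exact/esym/int_point.
by apply: ae_imp (AC_ae_derive k0) => x [_ <-]; exact: derive_cst.
Qed.

Lemma fundamental_lemma k : lint k ->
  (forall c, csm c -> \int[mu]_x (k x * c x) = 0) -> {ae mu, forall x, k x = 0}.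
Proof.
move=> lk H; apply: lint_ae0 => // s t st.
have := bump_cvg lk st.
have -> : (fun n => \int[mu]_x (k x * bump n s t x)) = (fun=> 0).
  by apply/funext => n; apply: H; apply: bump_csm; exact: ltW.
move=> /cvg_lim <- //; exact: lim_cst.
Qed.

(** The test functions form a countable family, so that on the plane the hypothesis can hold for all
    of them at once on almost every line. Letting [n] grow gives the formula for rational end
    points, and continuity gives the rest. *)
Lemma AC_weak f g : continuous f -> lint g ->
  (forall (i j : rat) n, ratr i < ratr j :> R ->
     \int[mu]_x (f x * dbump n (ratr i) (ratr j) x) = - \int[mu]_x (g x * bump n (ratr i) (ratr j) x)) ->
  AC f g.
Proof.
move=> cf lg H; split => //.
have Hr (i j : rat) : ratr i < ratr j :> R ->
    f (ratr j) - f (ratr i) = \int[mu]_(x in `[ratr i, ratr j]) g x.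
  move=> ij.
  have h1 := @dbump_cvg f (ratr i) (ratr j) cf.
  have h2 := bump_cvg lg ij.
  have h3 : (fun n => \int[mu]_x (f x * dbump n (ratr i) (ratr j) x)) @ \oo -->
      - \int[mu]_(x in `[ratr i, ratr j]) g x.
    rewrite (_ : (fun _ => _) = (fun n => - \int[mu]_x (g x * bump n (ratr i) (ratr j) x))).
      exact: cvgN.
    by apply/funext => n; exact: H.
  have := cvg_unique _ h1 h3; move=> /(_ (@Rhausdorff R)) h.
  by rewrite -[RHS]opprK -h opprB.
move=> s t st.
(* This function takes a single value at the rationals beyond [s - 1]. Starting one unit before [s]
   makes [s] an interior point, where [Psi] is continuous. *)
pose Psi x := f x - \int[mu]_(y in `[s - 1, x]) g y.
have PsiQ (i j : rat) : s - 1 < ratr i -> ratr i < ratr j :> R -> Psi (ratr i) = Psi (ratr j).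
  move=> si ij; rewrite /Psi (@int_split _ _ (s - 1) (ratr i) (ratr j))//; [|exact: ltW|exact: ltW].
  by rewrite -Hr//; ring.
have cPsi x : s - 1 < x -> x < t + 1 -> {for x, continuous Psi}.
  move=> sx xt; apply: cvgB; first exact: cf.
  have ab : s - 1 < t + 1 by lra.
  have := parameterized_integral_continuous (ltW ab) (lg (s - 1) (t + 1)).
  move=> /(continuous_within_itvP _ ab)[+ _ _]; apply.
  by rewrite in_itv/= sx xt.
have PsiQ' (i j : rat) : s - 1 < ratr i -> s - 1 < ratr j -> Psi (ratr i) = Psi (ratr j).
  move=> si sj; have [ij|ji|->//] := ltgtP (ratr i : R) (ratr j); first exact: PsiQ.
  by apply/esym; exact: PsiQ.
have near x : s - 1 < x -> x < t + 1 -> forall e : R, 0 < e ->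
    exists2 i : rat, s - 1 < ratr i & `|Psi x - Psi (ratr i)| <= e.
  move=> sx xt e e0; have /cvgrPdist_le/(_ _ e0)[d /= d0 Hd] := cPsi _ sx xt.
  have [q] := @rat_in_itvoo R x (x + d) ltac:(lra).
  rewrite in_itv/= => /andP[q1 q2]; exists q; first lra.
  by apply: Hd; rewrite /= distrC gtr0_norm; lra.
suff E : Psi s = Psi t.
  have E' : f t = Psi t + \int[mu]_(y in `[s - 1, t]) g y by rewrite /Psi subrK.
  have E'' : f s = Psi s + \int[mu]_(y in `[s - 1, s]) g y by rewrite /Psi subrK.
  rewrite E' E'' E (@int_split _ _ (s - 1) s t)//; [ring|lra].
apply/eqP; rewrite -subr_eq0 -normr_le0; apply/ler_addgt0Pl => e; rewrite addr0 => e0.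
have e20 : 0 < e / 2 by rewrite divr_gt0.
have [i si Hi] := near s ltac:(lra) ltac:(lra) _ e20.
have [j sj Hj] := near t ltac:(lra) ltac:(lra) _ e20.
have -> : Psi s - Psi t = (Psi s - Psi (ratr i)) - (Psi t - Psi (ratr j)).
  by rewrite (PsiQ' i j)//; ring.
apply: (le_trans (ler_normB _ _)); lra.
Qed.

End FundamentalLemma.

(** * Lebesgue measure on the plane and restriction to lines *)

Section Plane.
Context {R : realType}.
Notation MR := (measurableTypeR R).
Notation mu := (@lebesgue_measure R).
Notation L2 := (@lebesgue2 R).
Implicit Types (f g h : R * R -> R).

Definition mf2 f := @measurable_fun _ _ (MR * MR)%type MR setT f.

(** An open set is the countable union of the rational rectangles it contains; this links the
    topology of the plane to the product sigma-algebra. *)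
Lemma open2_measurable (U : set (R * R)) : open U ->
  @measurable _ (MR * MR)%type U.
Proof.
move=> oU.
pose rect (i : rat * rat * (rat * rat)) : set (R * R) :=
  `]ratr i.1.1, ratr i.1.2[ `*` `]ratr i.2.1, ratr i.2.2[.
pose F i := if `[< rect i `<=` U >] then rect i else set0.
have -> : U = \bigcup_i F i.
  apply/seteqP; split => [[x y] Uxy|z [i _]]; last by rewrite /F; case: asboolP => // + h; apply.
  have [[A B] /= [[a a0 Ha] [b b0 Hb]] AB] : nbhs (x, y) U by exact: open_nbhs_nbhs.
  have [p] := @rat_in_itvoo R (x - a) x ltac:(rewrite ltrBlDr ltrDl; exact: a0).
  rewrite in_itv/= => /andP[p1 p2].
  have [q] := @rat_in_itvoo R x (x + a) ltac:(rewrite ltrDl; exact: a0).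
  rewrite in_itv/= => /andP[q1 q2].
  have [r] := @rat_in_itvoo R (y - b) y ltac:(rewrite ltrBlDr ltrDl; exact: b0).
  rewrite in_itv/= => /andP[r1 r2].
  have [s] := @rat_in_itvoo R y (y + b) ltac:(rewrite ltrDl; exact: b0).
  rewrite in_itv/= => /andP[s1 s2].
  exists (p, q, (r, s)) => //; rewrite /F; case: asboolP => [_|]; last first.
    case; move=> [x' y'] [/= +  +]; rewrite !in_itv/= => /andP[? ?] /andP[? ?].
    apply: AB; split => /=.
      by apply: Ha; rewrite /ball_/= ltr_norml; apply/andP; split; lra.
    by apply: Hb; rewrite /ball_/= ltr_norml; apply/andP; split; lra.
  by split; rewrite /= in_itv/= ?p2 ?q1 ?r2 ?s1.
apply: countable_bigcupT_measurable => [|i]; first exact: countableP.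
rewrite /F; case: asboolP => // _.
by apply: measurableX; exact: measurable_itv.
Qed.

Lemma cont_mf2 f : continuous f -> mf2 f.
Proof.
move=> cf; rewrite /mf2.
apply: (measurability _ (RGenOInfty.measurableE R)).
move=> /= _ [_ [a ->]] <-; rewrite setTI; apply: open2_measurable.
by apply: open_comp => // z _; exact: cf.
Qed.

Definition pres (phi : R * R -> R * R) :=
  @measurable_fun _ _ (MR * MR)%type (MR * MR)%type setT phi /\
  forall A, @measurable _ (MR * MR)%type A -> L2 (phi @^-1` A) = L2 A.

Lemma pres_integral phi (F : R * R -> \bar R) : pres phi ->
  @measurable_fun _ _ (MR * MR)%type _ setT F ->
  (\int[L2]_z F (phi z) = \int[L2]_z F z)%E.
Proof.
move=> [mphi Hphi] mF.
have G (H : R * R -> \bar R) : @measurable_fun _ _ (MR * MR)%type _ setT H ->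
    (forall z, 0 <= H z)%E -> (\int[L2]_z H (phi z) = \int[L2]_z H z)%E.
  move=> mH H0.
  have := ge0_integral_pushforward mphi L2 measurableT mH (fun z _ => H0 z).
  rewrite preimage_setT => <-.
  by apply: eq_measure_integral => A mA _; exact: Hphi.
rewrite integralE [RHS]integralE; congr (_ - _)%E.
  rewrite -(G (F^\+)%E); last 2 first.
  - exact: measurable_funepos.
  - by move=> z; exact: funepos_ge0.
  by apply: eq_integral => z _; rewrite !funeposE.
rewrite -(G (F^\-)%E); last 2 first.
- exact: measurable_funeneg.
- by move=> z; exact: funeneg_ge0.
by apply: eq_integral => z _; rewrite !funenegE.
Qed.

Lemma pres_Rintegral phi f : pres phi -> mf2 f ->
  \int[L2]_z f (phi z) = \int[L2]_z f z.
Proof. by move=> pp mf; congr fine; apply: pres_integral => //; exact/measurable_EFinP. Qed.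

Lemma pres_integrable phi f : pres phi -> L2.-integrable setT (EFin \o f) ->
  L2.-integrable setT (EFin \o (f \o phi)).
Proof.
move=> pp /integrableP[mf fi]; apply/integrableP; split.
  exact: (measurableT_comp mf pp.1).
by rewrite (@pres_integral phi (fun z => `|(f z)%:E|)%E)//; exact: measurableT_comp.
Qed.

Lemma L2X (A B : set MR) : measurable A -> measurable B -> L2 (A `*` B) = (mu A * mu B)%E.
Proof. by move=> mA mB; exact: (@product_measure1E _ _ _ _ _ mu mu A B mA mB). Qed.

Lemma product_pres (p1 p2 : MR -> MR) :
  measurable_fun setT p1 -> measurable_fun setT p2 ->
  (forall A, measurable A -> mu (p1 @^-1` A) = mu A) ->
  (forall A, measurable A -> mu (p2 @^-1` A) = mu A) ->
  pres (fun z => (p1 z.1, p2 z.2)).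
Proof.
move=> m1 m2 H1 H2.
have mp : @measurable_fun _ _ (MR * MR)%type (MR * MR)%type setT (fun z => (p1 z.1, p2 z.2)).
  by apply: measurable_fun_pair; exact: measurableT_comp.
split => // A mA.
apply/esym; apply: (@product_measure_unique _ _ _ _ _ mu mu (pushforward L2 (fun z => (p1 z.1, p2 z.2)))) => //.
move=> B C mB mC; rewrite /pushforward.
transitivity (L2 ((p1 @^-1` B) `*` (p2 @^-1` C))); first by [].
rewrite L2X.
- by rewrite H1// H2.
- by rewrite -[X in measurable X]setTI; exact: m1.
- by rewrite -[X in measurable X]setTI; exact: m2.
Qed.

Lemma shift1_pres (h : R) (A : set MR) : measurable A -> mu ((fun x : MR => x + h : MR) @^-1` A) = mu A.
Proof.
move=> mA; apply/esym.
have ms : measurable_fun setT (fun x : MR => x + h : MR).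
  by apply: continuous_measurable_fun => x; apply: cvgD; [exact: cvg_id|exact: cvg_cst].
apply: (@lebesgue_measure_unique _ (pushforward mu (fun x : MR => x + h : MR))) => //.
move=> _ [[a b] _ <-]; rewrite /pushforward.
transitivity (mu (`]a - h, b - h]%classic : set R)); last first.
  congr (mu _); apply/seteqP; split => x /=; rewrite !in_itv/= => /andP[? ?]; apply/andP; split; lra.
rewrite !lebesgue_measure_itv/= !lte_fin ltrD2r; case: ifP => // _.
by rewrite -!EFinD; congr EFin; ring.
Qed.

Definition vshift (h : R) (z : R * R) : R * R := (z.1, z.2 + h).
(** Exchanging the coordinates reduces every statement about the first variable to one about the
    second. *)
Definition sw (z : R * R) : R * R := (z.2, z.1).

Lemma vshift_pres (h : R) : pres (vshift h).
Proof.
apply: (@product_pres (fun x => x) (fun x => x + h)) => //.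
- by apply: continuous_measurable_fun => x; apply: cvgD; [exact: cvg_id|exact: cvg_cst].
- exact: shift1_pres.
Qed.

Lemma sw_pres : pres sw.
Proof.
have mp : @measurable_fun _ _ (MR * MR)%type (MR * MR)%type setT sw.
  by apply: measurable_fun_pair; [exact: measurable_snd|exact: measurable_fst].
split => // A mA.
apply/esym; apply: (@product_measure_unique _ _ _ _ _ mu mu (pushforward L2 (fun z : MR * MR => (z.2, z.1) : MR * MR))) => //.
move=> B C mB mC; rewrite /pushforward.
transitivity (L2 (C `*` B)); first by congr (L2 _); apply/seteqP; split => z [].
by rewrite L2X// muleC.
Qed.

Lemma ae_sw (P : R * R -> Prop) : {ae L2, forall z, P z} -> {ae L2, forall z, P (sw z)}.
Proof.
move=> [A [mA A0 PA]]; exists (sw @^-1` A); split.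
- by rewrite -[X in measurable X]setTI; exact: (sw_pres.1).
- by rewrite -[RHS]A0; exact: (sw_pres.2).
- by move=> z; exact: (PA (sw z)).
Qed.

Lemma ae_lines (P : R * R -> Prop) : {ae L2, forall z, P z} ->
  {ae mu, forall x, {ae mu, forall y, P (x, y)}}.
Proof.
move=> [A [mA A0 PA]].
have mx := measurable_fun_xsection mu mA.
have : ae_eq mu setT (mu \o xsection A) (cst 0%E).
  apply/ae_eq_integral_abs => //; rewrite -[RHS]A0 /lebesgue2 /product_measure1.
  by apply: eq_integral => x _; rewrite gee0_abs.
apply: ae_imp => x /(_ Logic.I) /= Ax; exists (xsection A x); split => //.
  exact: measurable_xsection.
by move=> y Py; apply/xsectionP; apply: PA.
Qed.

Lemma fubini_Rintegral f : L2.-integrable setT (EFin \o f) ->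
  \int[L2]_z f z = \int[mu]_x (\int[mu]_y f (x, y)) /\
  mu.-integrable setT (EFin \o (fun x => \int[mu]_y f (x, y))).
Proof.
move=> fi; have ae1 := ae_integrable1 fi; have iF := integrable_fubini_F fi.
have mF : measurable_fun setT (fubini_F mu (EFin \o f)) by exact: measurable_int iF.
have E : ae_eq mu setT (fubini_F mu (EFin \o f)) (EFin \o (fun x => \int[mu]_y f (x, y))).
  apply: ae_imp ae1 => x ix _; rewrite /fubini_F /Rintegral /= fineK//.
  exact: (integrable_fin_num _ ix).
have mF' : measurable_fun setT (EFin \o (fun x => \int[mu]_y f (x, y))).
  by apply/measurable_EFinP; apply: (measurableT_comp (f := fine)) => //; exact: mF.
split.
  rewrite {1}/Rintegral -integral12_prod_meas1//; congr fine.
  exact: ae_eq_integral.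
apply/integrableP; split => //.
have [_] := integrableP _ _ _ iF; apply: le_lt_trans.
rewrite le_eqVlt; apply/orP; left; apply/eqP; apply: ae_eq_integral => //; try exact: measurableT_comp.
by apply: ae_imp E => x Ex h; congr abse; apply/esym; exact: Ex.
Qed.

(** Tonelli only looks at sections, so the equality may be known merely almost everywhere on almost
    every line, with no measurability of the exceptional set in the plane. *)
Lemma ge0_integral_ae_lines (F G : R * R -> \bar R) :
  @measurable_fun _ _ (MR * MR)%type _ setT F -> @measurable_fun _ _ (MR * MR)%type _ setT G ->
  (forall z, 0 <= F z)%E -> (forall z, 0 <= G z)%E ->
  {ae mu, forall x, {ae mu, forall y, F (x, y) = G (x, y)}} ->
  (\int[L2]_z F z = \int[L2]_z G z)%E.
Proof.
move=> mF mG F0 G0 H; rewrite /lebesgue2 !fubini_tonelli1//.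
apply: ae_eq_integral => //; try exact: measurable_fun_fubini_tonelli_F.
apply: ae_imp H => x Hx _; apply: ae_eq_integral => //.
- exact: measurable_fun_pair2.
- exact: measurable_fun_pair2.
- by apply: ae_imp Hx => y ->.
Qed.

Lemma ge0_le_integral_lines (F G : R * R -> \bar R) :
  @measurable_fun _ _ (MR * MR)%type _ setT F -> @measurable_fun _ _ (MR * MR)%type _ setT G ->
  (forall z, 0 <= F z)%E -> (forall z, 0 <= G z)%E ->
  {ae mu, forall x, \int[mu]_y F (x, y) <= \int[mu]_y G (x, y)}%E ->
  (\int[L2]_z F z <= \int[L2]_z G z)%E.
Proof.
move=> mF mG F0 G0 H; rewrite /lebesgue2 !fubini_tonelli1//.
apply: ae_ge0_le_integral => //.
- by move=> x _; exact: integral_ge0.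
- exact: measurable_fun_fubini_tonelli_F.
- by move=> x _; exact: integral_ge0.
- exact: measurable_fun_fubini_tonelli_F.
- by apply: ae_imp H => x ? _.
Qed.

End Plane.

(** * Local integrability on squares and absolute continuity on almost every line *)

Section Local.
Context {R : realType}.
Notation MR := (measurableTypeR R).
Notation mu := (@lebesgue_measure R).
Notation L2 := (@lebesgue2 R).
Implicit Types (f g h : R * R -> R).

(* [Llo] and [L2l] are the local Lebesgue spaces of exponents 1 and 2. *)
Definition box (n : nat) : set (R * R) := `[- n%:R, n%:R] `*` `[- n%:R, n%:R].
Definition Llo f := mf2 f /\ forall n, L2.-integrable (box n) (EFin \o f).
Definition L2l f := mf2 f /\ forall n, L2.-integrable (box n) (EFin \o (fun z => f z ^+ 2)).

Lemma boxE n z : box n z <-> (`|z.1| <= n%:R /\ `|z.2| <= n%:R).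
Proof. by rewrite /box /setX /= !in_itv/= !ler_norml; split=> -[]. Qed.

Lemma box_measurable n : @measurable _ (MR * MR)%type (box n).
Proof. by apply: measurableX; exact: measurable_itv. Qed.

Lemma box_compact n : compact (box n).
Proof. by apply: compact_setX; exact: segment_compact. Qed.

Lemma sub_box (n m : nat) : (n <= m)%N -> box n `<=` box m.
Proof. by rewrite -(ler_nat R) => nm z /boxE[? ?]; apply/boxE; split; lra. Qed.

Lemma in_box z : exists n, box n z.
Proof.
exists (Num.truncn (`|z.1| + `|z.2|)).+1; apply/boxE.
have := truncnS_gt (`|z.1| + `|z.2|); have := normr_ge0 z.1; have := normr_ge0 z.2.
by move=> ? ? ?; split; lra.
Qed.

Lemma cont_box_bound f n : continuous f -> exists2 M : R, 0 <= M & forall z, box n z -> `|f z| <= M.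
Proof.
move=> cf; have /compact_bounded[M [Mr HM]] : compact (f @` box n).
  by apply: continuous_compact; [exact: continuous_subspaceT|exact: box_compact].
have M1 : M < `|M| + 1 by have := ler_norm M; lra.
exists (`|M| + 1) => [|z zn]; first by have := normr_ge0 M; lra.
by apply: (HM _ M1); exists z.
Qed.

Lemma Llo_le f g : mf2 f -> (forall z, `|f z| <= `|g z|) -> Llo g -> Llo f.
Proof.
move=> mf fg [mg ig]; split => // n.
apply: (@le_integrable _ _ _ L2 _ (box_measurable n) (EFin \o f) (EFin \o g)) => //.
  by apply/measurable_EFinP; exact: measurable_funTS.
by move=> z _; rewrite /= lee_fin.
Qed.

Lemma mf2D f g : mf2 f -> mf2 g -> mf2 (fun z => f z + g z).
Proof. exact: measurable_funD. Qed.
Lemma mf2M f g : mf2 f -> mf2 g -> mf2 (fun z => f z * g z).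
Proof. exact: measurable_funM. Qed.
Lemma mf2N f : mf2 f -> mf2 (fun z => - f z).
Proof. by move=> mf; exact: (measurableT_comp _ mf). Qed.
Lemma mf2B f g : mf2 f -> mf2 g -> mf2 (fun z => f z - g z).
Proof. by move=> mf mg; apply: mf2D => //; exact: mf2N. Qed.
Lemma mf2X f n : mf2 f -> mf2 (fun z => f z ^+ n).
Proof. exact: measurable_funX. Qed.
Lemma mf2_norm f : mf2 f -> mf2 (fun z => `|f z|).
Proof. by move=> mf; apply: measurableT_comp. Qed.

Lemma LloD f g : Llo f -> Llo g -> Llo (fun z => f z + g z).
Proof.
move=> [mf lf] [mg lg]; split; first exact: mf2D.
by move=> n; exact: (integrableD (box_measurable n) (lf n) (lg n)).
Qed.

Lemma LloZ k f : Llo f -> Llo (fun z => k * f z).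
Proof.
move=> [mf lf]; split; first by apply: mf2M => //; exact: measurable_cst.
by move=> n; exact: (integrableZl (box_measurable n) k (lf n)).
Qed.

Lemma LloN f : Llo f -> Llo (fun z => - f z).
Proof. by move=> /(LloZ (-1)); congr Llo; apply/funext => z; rewrite mulN1r. Qed.

Lemma LloB f g : Llo f -> Llo g -> Llo (fun z => f z - g z).
Proof. by move=> lf lg; apply: LloD => //; exact: LloN. Qed.

Lemma Llo_contM f g : continuous f -> Llo g -> Llo (fun z => f z * g z).
Proof.
move=> cf [mg lg]; have mf := cont_mf2 cf; split; first exact: mf2M.
move=> n; apply: (@integrableMr _ _ _ L2 _ (box_measurable n) f (EFin \o g)) => //.
  exact: measurable_funTS.
have [M M0 HM] := cont_box_bound n cf.
by exists M; split; [exact: num_real|move=> y My x xb; apply: le_trans (HM _ xb) (ltW My)].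
Qed.

Lemma cst_Llo (k : R) : Llo (fun=> k).
Proof.
split; first exact: measurable_cst.
move=> n; apply: measurable_bounded_integrable; first exact: box_measurable.
- pose I := (`[- n%:R, n%:R]%classic : set R).
  have -> : L2 (box n) = (mu I * mu I)%E by apply: L2X; exact: measurable_itv.
  rewrite lebesgue_measure_itv/= lte_fin; case: ifP => _; last by rewrite mul0e ltry.
  by rewrite -EFinB -EFinM ltry.
- exact: measurable_cst.
- by exists `|k|; split; [exact: num_real|move=> y ky x _; exact: ltW].
Qed.

Lemma cont_Llo f : continuous f -> Llo f.
Proof.
move=> cf; have := Llo_contM cf (cst_Llo 1).
by congr Llo; apply/funext => z; rewrite mulr1.
Qed.

Lemma L2l_sqr f : L2l f -> Llo (fun z => f z ^+ 2).
Proof. by move=> [mf lf]; split => //; exact: mf2X. Qed.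

Lemma L2l_prod f g : L2l f -> L2l g -> Llo (fun z => f z * g z).
Proof.
move=> lf lg; have [mf _] := lf; have [mg _] := lg.
apply: (@Llo_le _ (fun z => f z ^+ 2 + g z ^+ 2)); first exact: mf2M.
  move=> z; rewrite normrM [leRHS]ger0_norm ?addr_ge0 ?sqr_ge0//.
  have := sqr_ge0 (`|f z| - `|g z|); have := normr_ge0 (f z); have := normr_ge0 (g z).
  by rewrite -(real_normK (num_real (f z))) -(real_normK (num_real (g z))); nra.
by apply: LloD; exact: L2l_sqr.
Qed.

Lemma L2l_le f g : mf2 f -> (forall z, f z ^+ 2 <= g z) -> Llo g -> L2l f.
Proof.
move=> mf fg lg; split => //; suff [] : Llo (fun z => f z ^+ 2) by [].
apply: Llo_le lg; first exact: mf2X.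
move=> z; rewrite !ger0_norm ?sqr_ge0 ?fg//.
by rewrite (le_trans _ (fg z))// sqr_ge0.
Qed.

Lemma L2lD f g : L2l f -> L2l g -> L2l (fun z => f z + g z).
Proof.
move=> lf lg; have [mf _] := lf; have [mg _] := lg.
apply: (@L2l_le _ (fun z => 2 * (f z ^+ 2 + g z ^+ 2))); first exact: mf2D.
  by move=> z; have := sqr_ge0 (f z - g z); nra.
by apply: LloZ; apply: LloD; exact: L2l_sqr.
Qed.

Lemma contX2 (f : R * R -> R) : continuous f -> continuous (fun z => f z ^+ 2).
Proof. by move=> cf z; apply: (@continuous_comp _ _ _ f (fun r : R => r ^+ 2)); [exact: cf|exact: exprn_continuous]. Qed.

Lemma L2l_contM f g : continuous f -> L2l g -> L2l (fun z => f z * g z).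
Proof.
move=> cf lg; have [mg _] := lg.
apply: (@L2l_le _ (fun z => f z ^+ 2 * (g z ^+ 2))); first by apply: mf2M => //; exact: cont_mf2.
  by move=> z; rewrite exprMn.
by apply: Llo_contM; [exact: contX2|exact: L2l_sqr].
Qed.

Lemma cont_L2l f : continuous f -> L2l f.
Proof.
move=> cf; apply: (@L2l_le _ (fun z => f z ^+ 2)) => //; first exact: cont_mf2.
by apply: cont_Llo; exact: contX2.
Qed.

Lemma L2l_Llo f : L2l f -> Llo f.
Proof.
move=> lf; have := L2l_prod lf (cont_L2l (fun z : R * R => @cst_continuous _ _ (1 : R) z)).
by congr Llo; apply/funext => z; rewrite mulr1.
Qed.

Lemma mf2_sw f : mf2 f -> mf2 (f \o sw).
Proof. by move=> mf; exact: (measurableT_comp mf sw_pres.1). Qed.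

Lemma integrable_box_mk f n : L2.-integrable (box n) (EFin \o f) <->
  L2.-integrable setT (EFin \o (f \_ (box n))).
Proof.
have -> : EFin \o (f \_ (box n)) = (EFin \o f) \_ (box n).
  by apply/funext => z; rewrite /= !patchE; case: ifP.
by apply: integrable_mkcond; exact: box_measurable.
Qed.

Lemma Llo_sw f : Llo f -> Llo (f \o sw).
Proof.
move=> [mf lf]; split; first exact: mf2_sw.
move=> n; apply/integrable_box_mk.
have /integrable_box_mk/(pres_integrable sw_pres) := lf n.
congr (_.-integrable _ (EFin \o _)); apply/funext => z; rewrite /= !patchE.
have -> // : (sw z \in box n) = (z \in box n).
by apply/idP/idP; rewrite !inE => /boxE[? ?]; apply/boxE.
Qed.

Definition csupp n f := forall z, ~ box n z -> f z = 0.

Lemma csupp_le n m (f : R * R -> R) : (n <= m)%N -> csupp n f -> csupp m f.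
Proof. by move=> nm sf z zm; apply: sf => zn; apply: zm; exact: (sub_box nm). Qed.

Lemma csupp_integrable n f : Llo f -> csupp n f -> L2.-integrable setT (EFin \o f).
Proof.
move=> [mf lf] sf; have /integrable_box_mk := lf n.
congr (_.-integrable _ (EFin \o _)); apply/funext => z; rewrite patchE.
by case: ifPn => // /negP zn; rewrite sf// => zb; apply: zn; rewrite inE.
Qed.

Lemma Llo_lint f : Llo f -> {ae mu, forall x, lint (fun y => f (x, y))}.
Proof.
move=> [mf lf].
have H n : {ae mu, forall x, mu.-integrable setT (fun y => ((f \_ (box n)) (x, y))%:E)}.
  by have /integrable_box_mk/ae_integrable1 := lf n.
have := ae_foralln H; apply: ae_imp => x Hx s t.
have [n /boxE[nx _]] := in_box (x, 0).
have [m /boxE[ms mt]] := in_box (s, t).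
have {}Hx := Hx (maxn n m).
have Hx' : mu.-integrable `[s, t] (fun y => ((f \_ (box (maxn n m))) (x, y))%:E).
  by apply: integrableS Hx => //; exact: measurable_itv.
apply: eq_integrable Hx'; first exact: measurable_itv.
move=> y; rewrite inE/= in_itv/= => /andP[sy yt].
rewrite patchE mem_set//; apply/boxE => /=.
have nm1 : n%:R <= (maxn n m)%:R :> R by rewrite ler_nat leq_maxl.
have nm2 : m%:R <= (maxn n m)%:R :> R by rewrite ler_nat leq_maxr.
split; first by move: nx => /=; lra.
by move: ms mt => /=; rewrite !ler_norml => /andP[? ?] /andP[? ?]; apply/andP; split; lra.
Qed.

Lemma ae_eq_Rint (f g : R -> R) : measurable_fun setT f -> measurable_fun setT g ->
  {ae mu, forall x, f x = g x} -> \int[mu]_x f x = \int[mu]_x g x.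
Proof.
move=> mf mg fg; congr fine; apply: ae_eq_integral => //; try exact/measurable_EFinP.
by apply: ae_imp fg => x -> _.
Qed.

(* [ac1] and [ac2] mean absolutely continuous on almost every line in the first
   and in the second variable, with density [g]. *)
Definition ac2 f g := {ae mu, forall x, AC (fun y => f (x, y)) (fun y => g (x, y))}.
Definition ac1 f g := ac2 (f \o sw) (g \o sw).

Lemma cont_line f x : continuous f -> continuous (fun y => f (x, y)).
Proof.
move=> cf y; apply: (@continuous_comp _ _ _ (fun y => (x, y)) f); last exact: cf.
exact: (@cvg_pair _ _ _ (nbhs y) (nbhs x) (nbhs y) _ _ _ (fun=>x) id (cvg_cst x) cvg_id).
Qed.

Lemma cont2_near f x y (e : R) : continuous f -> 0 < e -> exists2 d : R, 0 < d &
  forall s t, `|s - x| < d -> `|t - y| < d -> `|f (s, t) - f (x, y)| <= e.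
Proof.
move=> cf e0; have /cvgrPdist_le/(_ _ e0)[[A B] /= [[r1 r10 H1] [r2 r20 H2]] AB] := cf (x, y).
exists (Num.min r1 r2); first by rewrite lt_min r10.
move=> s t; rewrite !lt_min => /andP[s1 _] /andP[_ t2]; rewrite distrC; apply: (AB (s, t)).
by split; [apply: H1|apply: H2]; rewrite /ball_/= distrC.
Qed.

Lemma cont_sw f : continuous f -> continuous (f \o sw).
Proof.
move=> cf z; apply: continuous_comp; last exact: cf.
exact: (@cvg_pair _ _ _ (nbhs z) (nbhs z.2) (nbhs z.1) _ _ _ snd fst cvg_snd cvg_fst).
Qed.

Lemma cont_snd (c : R -> R) : continuous c -> continuous (fun z : R * R => c z.2).
Proof. by move=> cc z; apply: continuous_comp; [exact: cvg_snd|exact: cc]. Qed.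
Lemma cont_fst (c : R -> R) : continuous c -> continuous (fun z : R * R => c z.1).
Proof. by move=> cc z; apply: continuous_comp; [exact: cvg_fst|exact: cc]. Qed.

Lemma contM f g : continuous f -> continuous g -> continuous (fun z => f z * g z).
Proof. by move=> cf cg z; apply: cvgM; [exact: cf|exact: cg]. Qed.
Lemma contD f g : continuous f -> continuous g -> continuous (fun z => f z + g z).
Proof. by move=> cf cg z; apply: cvgD; [exact: cf|exact: cg]. Qed.

Lemma csm_bound (c : R -> R) : csm c -> exists N : nat, forall x, N%:R < `|x| -> c x = 0.
Proof.
move=> [_ [N HN]]; exists (Num.truncn `|N|).+1 => x xN; apply: HN.
have := truncnS_gt `|N|; have := ler_norm N => ? ?.
by apply/negP => /andP[? ?]; have : `|x| <= N; [rewrite ler_norml; apply/andP; split|lra].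
Qed.

Lemma dbumpE n s t : (bump n s t)^`()%classic = dbump n s t :> (R -> R).
Proof. by apply/funext => x; rewrite derive1E; case: (bump_deriv n s t x). Qed.

Lemma csm_derive1 (c : R -> R) : csm c -> csm c^`()%classic.
Proof.
move=> [sc [N HN]]; split; first exact: smooth_derive1.
exists (N + 1) => x xN.
have xN' : ~~ (- N <= x <= N).
  by apply: contra xN => /andP[? ?]; apply/andP; split; lra.
have Hd : exists2 d : R, 0 < d & forall y, `|y - x| < d -> ~~ (- N <= y <= N).
  have [N0|N0] := ltP N (- N).
    exists 1 => // y _; apply/negP => /andP[? ?]; lra.
  exists 1 => // y; rewrite ltr_norml => /andP[y1 y2]; apply/negP => /andP[z1 z2].
  by move/negP: xN; apply; apply/andP; split; lra.
have [d d0 {}Hd] := Hd.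
by apply: derive1_cst_near; exists d => // y /Hd yN; rewrite !HN.
Qed.

(** Separation of variables. For a fixed bump [c] in the second variable, the inner integral of
    [f c' + g c] is a locally integrable function of [x] that is orthogonal to every [b], hence zero
    almost everywhere. The bumps with rational ends are countable, so almost every line satisfies
    the hypotheses of [AC_weak]. *)
Lemma ac2_weak f g : continuous f -> Llo g ->
  (forall b c : R -> R, csm b -> csm c ->
    \int[L2]_z (f z * (b z.1 * c^`()%classic z.2)) = - \int[L2]_z (g z * (b z.1 * c z.2))) ->
  ac2 f g.
Proof.
move=> cf lg H.
have key (p : rat * rat * nat) : {ae mu, forall x, ratr p.1.1 < ratr p.1.2 :> R ->
    \int[mu]_y (f (x, y) * dbump p.2 (ratr p.1.1) (ratr p.1.2) y) =
    - \int[mu]_y (g (x, y) * bump p.2 (ratr p.1.1) (ratr p.1.2) y)}.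
  case: p => [[i j] n] /=; have [ij|] := ltP (ratr i : R) (ratr j); last by move=> _; apply: aeW.
  set b2 := bump n (ratr i) (ratr j); set c2 := dbump n (ratr i) (ratr j).
  have sb2 : csm b2 by apply: bump_csm; exact: ltW.
  have sc2 : csm c2 by rewrite /c2 -dbumpE; exact: csm_derive1.
  have cb2 : continuous b2 by apply: smooth_cont; case: sb2.
  have cc2 : continuous c2 by apply: smooth_cont; case: sc2.
  pose h1 z := f z * c2 z.2; pose h2 z := g z * b2 z.2.
  have l1 : Llo h1 by apply: cont_Llo; apply: contM => //; exact: cont_snd.
  have l2 : Llo h2.
    have -> : h2 = (fun z => b2 z.2 * g z) by apply/funext => z; rewrite /h2 mulrC.
    by apply: Llo_contM => //; exact: cont_snd.
  pose h z := h1 z + h2 z.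
  have lh : Llo h by exact: LloD.
  have [N1 HN1] := csm_bound sb2; have [N2 HN2] := csm_bound sc2.
  pose N := maxn N1 N2.
  have hN x y : N%:R < `|y| -> h (x, y) = 0 /\ (h1 (x, y) = 0 /\ h2 (x, y) = 0).
    move=> Ny; have nm1 : N1%:R <= N%:R :> R by rewrite ler_nat leq_maxl.
    have nm2 : N2%:R <= N%:R :> R by rewrite ler_nat leq_maxr.
    by rewrite /h /h1 /h2 /= HN1 ?HN2 ?mulr0 ?addr0//; exact: le_lt_trans Ny.
  pose Hh x := \int[mu]_y h (x, y).
  have outN y : ~~ (- N%:R <= y <= N%:R) -> (N%:R : R) < `|y|.
    by move=> yN; rewrite ltNge ler_norml.
  have ih : {ae mu, forall x, mu.-integrable setT (EFin \o (fun y => h (x, y)))}.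
    have := Llo_lint lh; apply: ae_imp => x lx.
    by apply: (@integrable_supp _ _ (- N%:R) N%:R) => // y /outN/(hN x)[].
  have lHh : lint Hh.
    move=> s t; have [m /boxE/= [ms mt]] := in_box (s, t).
    pose K := maxn m N.
    have mK : m%:R <= K%:R :> R by rewrite ler_nat leq_maxl.
    have NK : N%:R <= K%:R :> R by rewrite ler_nat leq_maxr.
    have /integrable_box_mk/fubini_Rintegral[_ I] := lh.2 K.
    have I' : mu.-integrable `[s, t] (EFin \o (fun x => \int[mu]_y (h \_ (box K)) (x, y))).
      by apply: integrableS I => //; exact: measurable_itv.
    apply: eq_integrable I'; first exact: measurable_itv.
    move=> x; rewrite inE/= in_itv/= => /andP[sx xt]; congr EFin.
    apply: eq_Rintegral => y _; rewrite patchE; case: ifPn => // /negP xyK.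
    rewrite (hN x y _).1// ltNge; apply/negP => yN; apply: xyK; rewrite inE; apply/boxE => /=.
    split; last by lra.
    by move: ms mt; rewrite !ler_norml => /andP[? ?] /andP[? ?]; apply/andP; split; lra.
  have H0 : {ae mu, forall x, Hh x = 0}.
    apply: fundamental_lemma => // b sb.
    have [N3 HN3] := csm_bound sb.
    have cb : continuous b by apply: smooth_cont; case: sb.
    pose K := maxn N3 N.
    have N3K : N3%:R <= K%:R :> R by rewrite ler_nat leq_maxl.
    have NK : N%:R <= K%:R :> R by rewrite ler_nat leq_maxr.
    have sK (k : R * R -> R) : (forall x y, N%:R < `|y| -> k (x, y) = 0) ->
        csupp K (fun z => b z.1 * k z).
      move=> kN [x y] xyK /=.
      have [xN3|xN3] := ltP (N3%:R : R) `|x|; first by rewrite HN3// mul0r.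
      rewrite kN ?mulr0// ltNge; apply/negP => yN; apply: xyK; apply/boxE => /=.
      by split; lra.
    have cb1 : continuous (fun z : R * R => b z.1) by exact: cont_fst.
    have i1 : L2.-integrable setT (EFin \o (fun z => b z.1 * h1 z)).
      apply: (@csupp_integrable K); first exact: Llo_contM.
      by apply: sK => x y /(hN x)[_ []].
    have i2 : L2.-integrable setT (EFin \o (fun z => b z.1 * h2 z)).
      apply: (@csupp_integrable K); first exact: Llo_contM.
      by apply: sK => x y /(hN x)[_ []].
    have i3 : L2.-integrable setT (EFin \o (fun z => b z.1 * h z)).
      apply: (@csupp_integrable K); first exact: Llo_contM.
      by apply: sK => x y /(hN x)[].
    have [E1 I1] := fubini_Rintegral i3.
    have E2 : \int[L2]_z (b z.1 * h z) = 0.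
      have -> : \int[L2]_z (b z.1 * h z) = \int[L2]_z (b z.1 * h1 z) + \int[L2]_z (b z.1 * h2 z).
        by rewrite -RintegralD//; apply: eq_Rintegral => z _; rewrite -mulrDr.
      have := H b b2 sb sb2; rewrite dbumpE -/c2 => Hb.
      have -> : \int[L2]_z (b z.1 * h1 z) = \int[L2]_z (f z * (b z.1 * c2 z.2)).
        by apply: eq_Rintegral => z _; rewrite /h1 mulrCA.
      have -> : \int[L2]_z (b z.1 * h2 z) = \int[L2]_z (g z * (b z.1 * b2 z.2)).
        by apply: eq_Rintegral => z _; rewrite /h2 mulrCA.
      by rewrite Hb addNr.
    rewrite -E2 E1; apply: ae_eq_Rint.
    - apply: measurable_funM; first exact: lint_measurable.
      exact: continuous_measurable_fun.
    - by apply/measurable_EFinP; case/integrableP : I1.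
    - apply: ae_imp ih => x ix; rewrite /Hh -RintegralZr//.
      by apply: eq_Rintegral => y _; rewrite mulrC.
  have ig1 := Llo_lint l1; have ig2 := Llo_lint l2.
  apply: ae_imp (ae_and H0 (ae_and ig1 ig2)) => x [Hx [lx1 lx2]] _.
  apply/eqP; rewrite -addr_eq0 -RintegralD//; first by apply/eqP; exact: Hx.
  - by apply: (@integrable_supp _ _ (- N%:R) N%:R) => // y /outN/(hN x)[_ []].
  - by apply: (@integrable_supp _ _ (- N%:R) N%:R) => // y /outN/(hN x)[_ []].
have := ae_and (Llo_lint lg) (ae_countable key); apply: ae_imp => x [lgx Hx].
apply: AC_weak => //; first exact: cont_line.
by move=> i j n ij; exact: (Hx (i, j, n)).
Qed.

Lemma ac2_int0 n f g : ac2 f g -> Llo g -> csupp n f -> csupp n g -> \int[L2]_z g z = 0.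
Proof.
move=> afg lg sf sg.
have ig := csupp_integrable lg sg.
have [-> I] := fubini_Rintegral ig.
have n1 : (n%:R : R) < n.+1%:R by rewrite ltr_nat.
rewrite (@ae_eq_Rint _ (fun=> 0)).
- by rewrite Rintegral_cst// mul0r.
- by apply/measurable_EFinP; case/integrableP : I.
- exact: measurable_cst.
apply: ae_imp afg => x [_ H].
(* The interval exceeds the box by one unit: [csupp n] forces [f] to vanish only strictly outside
   the box, hence at these end points. *)
rewrite (@int_supp _ _ (- n.+1%:R) n.+1%:R); last first.
  move=> y yn; apply: sg => /boxE[_ /=]; rewrite ler_norml => /andP[? ?].
  by move/negP : yn; apply; apply/andP; split; lra.
rewrite -H; last by rewrite -subr_ge0 opprK addr_ge0.
rewrite !sf ?subrr// => /boxE[_ /=]; rewrite ?normrN ger0_norm// => h; lra.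
Qed.

End Local.

(** * Sobolev calculus *)

Section LineFacts.
Context {R : realType}.
Notation mu := (@lebesgue_measure R).
Implicit Types (f g : R -> R).

(** Cauchy-Schwarz, obtained from the nonnegative integral of [(g - c)^2] with [c] the mean of
    [g]. *)
Lemma int_sqr_le g s t : lint g -> lint (fun x => g x ^+ 2) -> s < t ->
  (\int[mu]_(x in `[s, t]) g x) ^+ 2 <= (t - s) * \int[mu]_(x in `[s, t]) (g x ^+ 2).
Proof.
move=> lg lg2 st; set I := \int[mu]_(x in `[s, t]) g x; set J := \int[mu]_(x in `[s, t]) (g x ^+ 2).
have ts : 0 < t - s by lra.
pose c := I / (t - s).
have lc : lint (fun _ : R => c ^+ 2) by apply: lint_cont => x; exact: cst_continuous.
have : 0 <= \int[mu]_(x in `[s, t]) (g x ^+ 2 - (2 * c) * g x + c ^+ 2).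
  by apply: Rintegral_ge0 => x _; have := sqr_ge0 (g x - c); rewrite sqrrB; lra.
have l1 : lint (fun x => (2 * c) * g x) by exact: lintZ.
rewrite intD//; last exact: lintB.
rewrite intB// intZ// int_cst//; last exact: ltW.
rewrite -/I -/J /c => H.
have -> : I ^+ 2 = (t - s) * ((2 * (I / (t - s))) * I - (I / (t - s)) ^+ 2 * (t - s)).
  by field; rewrite gt_eqF.
by rewrite ler_pM2l//; lra.
Qed.

Definition avg (h : R) (k : R -> R) (x : R) : \bar R :=
  (\int[mu]_(y in `[x, (x + h)%R]) (h^-1 * k y)%:E)%E.

(** Exchange the integrals: a given [y] lies in [[x, x + h]] for a set of [x] of length exactly [h],
    which cancels the factor [1/h]. *)
Lemma avg_tonelli (k : R -> R) (h : R) : measurable_fun setT k -> (forall x, 0 <= k x) -> 0 < h ->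
  measurable_fun setT (avg h k) /\
  (\int[mu]_x avg h k x = \int[mu]_y (k y)%:E)%E.
Proof.
move=> mk k0 h0.
pose T : set (R * R) := [set z | z.1 <= z.2 <= z.1 + h].
have mT : @measurable _ (measurableTypeR R * measurableTypeR R)%type T.
  have -> : T = ~` ([set z | z.2 - z.1 < 0] `|` [set z | h < z.2 - z.1]).
    apply/seteqP; split => z /=.
      by move=> /andP[? ?]; case; lra.
    by move=> H; apply/andP; split; rewrite leNgt; apply/negP => ?; apply: H; [left|right]; lra.
  have cd : continuous (fun z : R * R => z.2 - z.1).
    by move=> z; apply: cvgB; [exact: cvg_snd|exact: cvg_fst].
  apply: measurableC; apply: measurableU; apply: open2_measurable.
    by apply: (@open_comp _ _ (fun z : R * R => z.2 - z.1) [set r | r < 0]) => [z _|]; [exact: cd|exact: open_lt].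
  by apply: (@open_comp _ _ (fun z : R * R => z.2 - z.1) [set r | h < r]) => [z _|]; [exact: cd|exact: open_gt].
pose K (z : R * R) := (h^-1 * (k z.2 * \1_T z))%:E.
have mK : @measurable_fun _ _ (measurableTypeR R * measurableTypeR R)%type _ setT K.
  apply/measurable_EFinP; apply: measurable_funM; first exact: measurable_cst.
  apply: measurable_funM; last by apply: measurable_indic.
  exact: (measurableT_comp mk (@measurable_snd _ _ (measurableTypeR R) (measurableTypeR R))).
have K0 z : (0 <= K z)%E.
  by rewrite /K lee_fin mulr_ge0 ?invr_ge0 ?(ltW h0)// mulr_ge0.
have E := @fubini_tonelli _ _ _ _ _ mu mu K mK K0.
have mF : measurable_fun setT (fubini_F mu K) by exact: measurable_fun_fubini_tonelli_F.
have F1 : avg h k = (fun x => \int[mu]_y K (x, y))%E.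
  apply/funext => x; rewrite /avg [LHS]integral_mkcond; apply: eq_integral => y _.
  rewrite /K/= patchE indicE.
  have -> : ((x, y) \in T) = (y \in (`[x, x + h]%classic : set R)).
    by apply/idP/idP; rewrite !inE /T /= ?in_itv.
  by case: ifP => _ /=; rewrite ?mulr1 ?mulr0.
split; first by rewrite F1; exact: mF.
rewrite F1 E.
apply: eq_integral => y _.
have -> : (fun x => K (x, y)) = (fun x => (h^-1 * k y)%:E * (\1_(`[(y - h)%R, y] : set R) x)%:E)%E.
  apply/funext => x; rewrite /K /= !indicE -EFinM mulrA.
  have -> // : ((x, y) \in T) = (x \in (`[y - h, y]%classic : set R)).
  by apply/idP/idP; rewrite !inE /T /= ?in_itv /= => /andP[? ?]; apply/andP; split; lra.
rewrite ge0_integralZl; last 4 first.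
- exact: measurableT.
- by apply/measurable_EFinP; apply: measurable_indic; exact: measurable_itv.
- by move=> x _; rewrite lee_fin.
- by rewrite lee_fin mulr_ge0 ?invr_ge0 ?(ltW h0) ?k0.
rewrite integral_indic; last 2 first.
- exact: measurableT.
- exact: measurable_itv.
rewrite [X in (_ * X)%E](_ : _ = h%:E); last first.
  transitivity (lebesgue_measure (`[y - h, y]%classic : set R)).
    by congr (lebesgue_measure _); apply/seteqP; split => z; [case|].
  rewrite lebesgue_measure_itv/= lte_fin ifT; last by lra.
  by rewrite -EFinB; congr EFin; ring.
by rewrite -EFinM; congr EFin; field; rewrite gt_eqF.
Qed.

(** The difference quotient is the mean of [g] over [[y, y + h]]; its square is at most the mean of
    [g^2], and averaging preserves the integral. *)
Lemma diff_quot_le f g (h : R) : continuous f -> AC f g -> lint (fun x => g x ^+ 2) -> 0 < h ->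
  (\int[mu]_y (((f (y + h) - f y) / h) ^+ 2)%:E <= \int[mu]_y (g y ^+ 2)%:E)%E.
Proof.
move=> cf [lg Hf] lg2 h0.
have mg := lint_measurable lg.
have [mA <-] := @avg_tonelli (fun x => g x ^+ 2) h (measurable_funX 2 mg) (fun x => sqr_ge0 (g x)) h0.
apply: ge0_le_integral.
- exact: measurableT.
- by move=> x _; rewrite lee_fin sqr_ge0.
- apply/measurable_EFinP; apply: measurable_funX; apply: measurable_funM; last exact: measurable_cst.
  apply: measurable_funB; apply: continuous_measurable_fun; last exact: cf.
  move=> x; apply: (@continuous_comp _ _ _ (fun x => x + h) f); last exact: cf.
  by apply: cvgD; [exact: cvg_id|exact: cvg_cst].
- exact: mA.
move=> x _.
have xh : x < x + h by lra.
have -> : avg h (fun x => g x ^+ 2) x = (h^-1 * \int[mu]_(y in `[x, x + h]) (g y ^+ 2))%:E.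
  rewrite -intZ; last exact: lg2.
  rewrite /avg /Rintegral fineK; first by [].
  apply: integrable_fin_num; first exact: measurable_itv.
  exact: (lintZ h^-1 lg2 x (x + h)).
rewrite lee_fin expr_div_n ler_pdivrMr ?exprn_gt0//.
rewrite Hf; last exact: ltW.
apply: (le_trans (int_sqr_le lg lg2 xh)).
have -> : x + h - x = h by ring.
by rewrite le_eqVlt; apply/orP; left; apply/eqP; field; rewrite gt_eqF.
Qed.

End LineFacts.

(** * The class [H1] and its chain rule *)

Section Sobolev.
Context {R : realType}.
Implicit Types (f g h : R * R -> R).

(** Continuous functions of the local Sobolev space of order 1 and exponent 2, in the Beppo Levi
    description by absolute continuity on lines. The partial derivatives are parameters because they
    are determined only almost everywhere. *)
Definition H1 f f1 f2 := [/\ continuous f, L2l f1, L2l f2, ac1 f f1 & ac2 f f2].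

Lemma sd_continuous (G : R -> R -> R) a b v1 v2 : sd G a b v1 v2 -> forall e : R, 0 < e ->
  exists2 d : R, 0 < d & forall a1 b1, `|a1 - a| < d -> `|b1 - b| < d -> `|G a1 b1 - G a b| <= e.
Proof.
move=> sG e e0; have [d d0 Hd] := sG 1 ltr01.
pose K := 1 + `|v1| + `|v2|; have K0 : 0 < K by rewrite /K; have := normr_ge0 v1; have := normr_ge0 v2; lra.
have e'0 : 0 < e / (2 * K) by rewrite divr_gt0// mulr_gt0.
exists (Num.min d (e / (2 * K))); first by rewrite lt_min d0.
move=> a1 b1; rewrite !lt_min => /andP[a1d a1e] /andP[b1d b1e].
have := Hd a1 b1 a b a1d b1d; rewrite !subrr !normr0 => /(_ d0 d0) H.
have H2 : `|G a1 b1 - G a b| <= `|v1 * (a1 - a) + v2 * (b1 - b)| + 1 * (`|a1 - a| + `|b1 - b|).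
  have -> : G a1 b1 - G a b = (v1 * (a1 - a) + v2 * (b1 - b)) + (G a1 b1 - G a b - (v1 * (a1 - a) + v2 * (b1 - b))) by ring.
  by apply: (le_trans (ler_normD _ _)); rewrite lerD2l.
apply: (le_trans H2).
have H3 : `|v1 * (a1 - a) + v2 * (b1 - b)| <= `|v1| * `|a1 - a| + `|v2| * `|b1 - b|.
  by apply: (le_trans (ler_normD _ _)); rewrite !normrM.
have -> : e = (K * (e / (2 * K))) + (K * (e / (2 * K))) by field; rewrite gt_eqF.
apply: (le_trans (lerD H3 (lexx _))).
move: (e / (2 * K)) a1e b1e => r a1e b1e.
have := normr_ge0 v1; have := normr_ge0 v2; have := normr_ge0 (a1 - a); have := normr_ge0 (b1 - b).
rewrite /K; nra.
Qed.

(** Strict derivatives that exist near a point are automatically continuous there: the same small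
    increment of [G] is read once with the derivative at [(a, b)] and once with the derivative at
    [(a1, b1)]. This spares [H1_sd] a separate continuity hypothesis. *)
Lemma sd_deriv_cont1 (G v1 v2 : R -> R -> R) a b :
  (exists2 d : R, 0 < d & forall a1 b1, `|a1 - a| < d -> `|b1 - b| < d -> sd G a1 b1 (v1 a1 b1) (v2 a1 b1)) ->
  forall e : R, 0 < e -> exists2 d : R, 0 < d & forall a1 b1, `|a1 - a| < d -> `|b1 - b| < d ->
    `|v1 a1 b1 - v1 a b| <= e.
Proof.
move=> [d d0 Hd] e e0.
have e20 : 0 < e / 2 by rewrite divr_gt0.
have := Hd a b; rewrite !subrr normr0 => /(_ d0 d0) sab.
have [r r0 Hr] := sab _ e20.
exists (Num.min d (r / 2)); first by rewrite lt_min d0 divr_gt0.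
move=> a1 b1; rewrite !lt_min => /andP[a1d a1r] /andP[b1d b1r].
have [q q0 Hq] := Hd _ _ a1d b1d _ e20.
(* The increment [s] must stay in the neighbourhood of radius [q] of [(a1, b1)] and, since
   [(a1, b1)] is within [r / 2] of [(a, b)], in that of radius [r] of [(a, b)]. *)
have [s [s0 sq sr]] : exists s : R, [/\ 0 < s, s < q & s < r / 2].
  exists (Num.min (q / 2) (r / 4)); split.
  - by rewrite lt_min; apply/andP; split; rewrite divr_gt0.
  - by rewrite gt_min; apply/orP; left; rewrite ltr_pdivrMr// ltr_pMr// ltr1n.
  - by rewrite gt_min; apply/orP; right; move: r0; clear; lra.
move: a1r b1r; rewrite !ltr_norml => /andP[a1r1 a1r2] /andP[b1r1 b1r2].
have ns : `|s| = s by rewrite gtr0_norm.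
have X1 := Hr (a1 + s) b1 a1 b1; have X2 := Hq (a1 + s) b1 a1 b1.
have {}X1 : `|G (a1 + s) b1 - G a1 b1 - v1 a b * s| <= e / 2 * s.
  have e1 : a1 + s - a1 = s by ring.
  move: X1; rewrite e1 subrr mulr0 normr0 !addr0 ns; apply; rewrite ltr_norml; apply/andP; split; move: s0 sr a1r1 a1r2 b1r1 b1r2; clear; lra.
have {}X2 : `|G (a1 + s) b1 - G a1 b1 - v1 a1 b1 * s| <= e / 2 * s.
  have e1 : a1 + s - a1 = s by ring.
  by move: X2; rewrite e1 !subrr mulr0 normr0 !addr0 ns; apply.
have : `|v1 a1 b1 - v1 a b| * s <= e * s.
  rewrite -[X in _ * X <= _]ns -normrM.
  have -> : (v1 a1 b1 - v1 a b) * s = (G (a1 + s) b1 - G a1 b1 - v1 a b * s) - (G (a1 + s) b1 - G a1 b1 - v1 a1 b1 * s) by ring.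
  by apply: (le_trans (ler_normB _ _)); lra.
by rewrite ler_pM2r.
Qed.

Lemma sd_swap (G : R -> R -> R) a b v1 v2 : sd G a b v1 v2 -> sd (fun x y => G y x) b a v2 v1.
Proof.
move=> sG e e0; have [d d0 Hd] := sG e e0; exists d => // a1 b1 a2 b2 h1 h2 h3 h4.
by rewrite (addrC (v2 * _)) (addrC `|a1 - a2|); exact: Hd.
Qed.

Lemma sd_deriv_cont (G v1 v2 : R -> R -> R) a b :
  (exists2 d : R, 0 < d & forall a1 b1, `|a1 - a| < d -> `|b1 - b| < d -> sd G a1 b1 (v1 a1 b1) (v2 a1 b1)) ->
  forall e : R, 0 < e -> exists2 d : R, 0 < d & forall a1 b1, `|a1 - a| < d -> `|b1 - b| < d ->
    `|v1 a1 b1 - v1 a b| <= e /\ `|v2 a1 b1 - v2 a b| <= e.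
Proof.
move=> HG e e0; have [r r0 Hr] := sd_deriv_cont1 HG e0.
have [d d0 Hd] := HG.
have [|s s0 Hs] := @sd_deriv_cont1 (fun x y => G y x) (fun x y => v2 y x) (fun x y => v1 y x) b a _ e e0.
  by exists d => // b1 a1 h1 h2; apply: sd_swap; exact: Hd.
exists (Num.min r s); first by rewrite lt_min r0.
by move=> a1 b1; rewrite !lt_min => /andP[h1 h2] /andP[h3 h4]; split; [exact: Hr|exact: Hs].
Qed.

Lemma sd_mul a b : sd (fun x y : R => x * y) a b b a.
Proof.
move=> e e0; exists e => // a1 b1 a2 b2 h1 h2 h3 h4.
have -> : a1 * b1 - a2 * b2 - (b * (a1 - a2) + a * (b1 - b2)) = (b1 - b) * (a1 - a2) + (a2 - a) * (b1 - b2) by ring.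
apply: (le_trans (ler_normD _ _)); rewrite !normrM mulrDr; apply: lerD; apply: ler_wpM2r => //; exact: ltW.
Qed.

Lemma sd_lin p q a b : sd (fun x y : R => p * x + q * y) a b p q.
Proof.
move=> e e0; exists 1 => // a1 b1 a2 b2 _ _ _ _.
have -> : p * a1 + q * b1 - (p * a2 + q * b2) - (p * (a1 - a2) + q * (b1 - b2)) = 0 by ring.
by rewrite normr0 mulr_ge0 ?addr_ge0// ltW.
Qed.

Lemma cont_comp2 (k : R -> R -> R) f g : continuous f -> continuous g ->
  (forall z e, 0 < e -> exists2 d : R, 0 < d & forall a b, `|a - f z| < d -> `|b - g z| < d -> `|k a b - k (f z) (g z)| <= e) ->
  continuous (fun z => k (f z) (g z)).
Proof.
move=> cf cg H z; apply/cvgrPdist_le => e e0.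
have [d d0 Hd] := H z _ e0.
have /cvgrPdist_lt/(_ _ d0) h1 := cf z; have /cvgrPdist_lt/(_ _ d0) h2 := cg z.
apply: filterS2 h1 h2 => w w1 w2.
by rewrite distrC; apply: Hd; rewrite distrC.
Qed.

Lemma ac2_sd (G v1 v2 : R -> R -> R) f f2 g g2 :
  continuous f -> continuous g -> ac2 f f2 -> ac2 g g2 ->
  (forall z, sd G (f z) (g z) (v1 (f z) (g z)) (v2 (f z) (g z))) ->
  continuous (fun z => v1 (f z) (g z)) -> continuous (fun z => v2 (f z) (g z)) ->
  ac2 (fun z => G (f z) (g z)) (fun z => v1 (f z) (g z) * f2 z + v2 (f z) (g z) * g2 z).
Proof.
move=> cf cg af ag sG c1 c2.
apply: ae_imp (ae_and af ag) => x [hf hg].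
apply: (@AC_sd _ G v1 v2 (fun y => f (x, y)) (fun y => f2 (x, y)) (fun y => g (x, y)) (fun y => g2 (x, y))) => //.
- exact: cont_line.
- exact: cont_line.
- exact: (cont_line c1).
- exact: (cont_line c2).
Qed.

(** The chain rule of [AC_sd] on almost every line. Strict differentiability is asked in a
    neighbourhood of each value because the coefficients are then continuous, hence locally bounded,
    which keeps the new derivatives in [L2l]. *)
Lemma H1_sd (G v1 v2 : R -> R -> R) f f1 f2 g g1 g2 :
  H1 f f1 f2 -> H1 g g1 g2 ->
  (forall z, exists2 d : R, 0 < d & forall a b, `|a - f z| < d -> `|b - g z| < d -> sd G a b (v1 a b) (v2 a b)) ->
  H1 (fun z => G (f z) (g z)) (fun z => v1 (f z) (g z) * f1 z + v2 (f z) (g z) * g1 z)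
     (fun z => v1 (f z) (g z) * f2 z + v2 (f z) (g z) * g2 z).
Proof.
move=> [cf lf1 lf2 a1f a2f] [cg lg1 lg2 a1g a2g] HG.
have sG z : sd G (f z) (g z) (v1 (f z) (g z)) (v2 (f z) (g z)).
  by have [d d0 H] := HG z; apply: H; rewrite subrr normr0.
have cv1 : continuous (fun z => v1 (f z) (g z)).
  apply: cont_comp2 => // z e e0; have [d d0 Hd] := sd_deriv_cont (HG z) e0.
  by exists d => // a b ha hb; have [] := Hd _ _ ha hb.
have cv2 : continuous (fun z => v2 (f z) (g z)).
  apply: cont_comp2 => // z e e0; have [d d0 Hd] := sd_deriv_cont (HG z) e0.
  by exists d => // a b ha hb; have [] := Hd _ _ ha hb.
split.
- apply: cont_comp2 => // z e e0; have [d d0 Hd] := sd_continuous (sG z) e0.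
  by exists d => // a b ha hb; exact: Hd.
- by apply: L2lD; exact: L2l_contM.
- by apply: L2lD; exact: L2l_contM.
- apply: (@ac2_sd G v1 v2 (f \o sw) (f1 \o sw) (g \o sw) (g1 \o sw)) => //; try exact: cont_sw.
  + by move=> z; exact: sG.
  + exact: (cont_sw cv1).
  + exact: (cont_sw cv2).
- exact: ac2_sd.
Qed.

Lemma H1_M f f1 f2 g g1 g2 : H1 f f1 f2 -> H1 g g1 g2 ->
  H1 (fun z => f z * g z) (fun z => g z * f1 z + f z * g1 z) (fun z => g z * f2 z + f z * g2 z).
Proof.
move=> hf hg; apply: (H1_sd (v1 := fun a b => b) (v2 := fun a b => a) hf hg) => z.
by exists 1 => // a b _ _; exact: sd_mul.
Qed.

Lemma H1_lin p q f f1 f2 g g1 g2 : H1 f f1 f2 -> H1 g g1 g2 ->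
  H1 (fun z => p * f z + q * g z) (fun z => p * f1 z + q * g1 z) (fun z => p * f2 z + q * g2 z).
Proof.
move=> hf hg; apply: (H1_sd (G := fun a b => p * a + q * b) (v1 := fun a b => p) (v2 := fun a b => q) hf hg) => z.
by exists 1 => // a b _ _; exact: sd_lin.
Qed.

End Sobolev.

(** * The null Lagrangian *)

Section NullLagrangian.
Context {R : realType}.
Notation MR := (measurableTypeR R).
Notation mu := (@lebesgue_measure R).
Notation L2 := (@lebesgue2 R).
Implicit Types (f g : R * R -> R) (h : R).

Lemma ae_shift1 h (Q : R -> Prop) : {ae mu, forall x, Q x} -> {ae mu, forall x, Q (x + h)}.
Proof.
move=> [A [mA A0 QA]]; exists ((fun x : MR => x + h : MR) @^-1` A); split.
- have ms : measurable_fun setT (fun x : MR => x + h : MR).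
    by apply: continuous_measurable_fun => x; apply: cvgD; [exact: cvg_id|exact: cvg_cst].
  by rewrite -[X in measurable X]setTI; exact: ms.
- by rewrite -[RHS]A0; exact: shift1_pres.
- by move=> x; exact: (QA (x + h)).
Qed.

Lemma ac1_vshift h f g : ac1 f g -> ac1 (f \o vshift h) (g \o vshift h).
Proof. by move=> /(ae_shift1 h); apply: ae_imp. Qed.

Lemma integrable_Llo f : mf2 f -> L2.-integrable setT (EFin \o f) -> Llo f.
Proof.
move=> mf fi; split => // n; apply: integrableS fi => //; first exact: box_measurable.
Qed.

Lemma cont_vshift h f : continuous f -> continuous (f \o vshift h).
Proof.
move=> cf z; apply: (@continuous_comp _ _ _ (vshift h) f); last exact: cf.
apply: (@cvg_pair _ _ _ (nbhs z) (nbhs z.1) (nbhs (z.2 + h)) _ _ _ fst (fun z => z.2 + h) cvg_fst).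
by apply: cvgD; [exact: cvg_snd|exact: cvg_cst].
Qed.

Lemma mf2_vshift h f : mf2 f -> mf2 (f \o vshift h).
Proof. by move=> mf; exact: (measurableT_comp mf (vshift_pres h).1). Qed.

Lemma Llo_vshift h n f : Llo f -> csupp n f -> Llo (f \o vshift h).
Proof.
move=> lf sf; apply: integrable_Llo; first by apply: mf2_vshift; case: lf.
by apply: pres_integrable; [exact: vshift_pres|exact: csupp_integrable sf].
Qed.

Lemma ac1_int0 n f g : ac1 f g -> Llo g -> csupp n f -> csupp n g -> \int[L2]_z g z = 0.
Proof.
move=> afg lg sf sg; rewrite -(pres_Rintegral sw_pres); last by case: lg.
have sz z : ~ box n z -> ~ box n (sw z).
  by move=> zn zs; apply: zn; move/boxE : zs => [? ?]; apply/boxE.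
by apply: (ac2_int0 (n := n) afg); [exact: Llo_sw|move=> z /sz/sf|move=> z /sz/sg].
Qed.

(** Forward and backward difference quotients in the second variable. They are adjoint to each other
    up to sign. The form [p * x + q * y] is that of [sd_lin]. *)
Definition dq h f z := h^-1 * f (vshift h z) + (- h^-1) * f z.
Definition dqm h f z := h^-1 * f z + (- h^-1) * f (vshift (- h) z).

Lemma cont_dq h f : continuous f -> continuous (dq h f).
Proof.
move=> cf; apply: contD; apply: contM => //; try by move=> z; exact: cst_continuous.
exact: (cont_vshift (h := h) cf).
Qed.

Lemma cont_dqm h f : continuous f -> continuous (dqm h f).
Proof.
move=> cf; apply: contD; apply: contM => //; try by move=> z; exact: cst_continuous.
exact: (cont_vshift (h := - h) cf).
Qed.

Lemma vshiftK h z : vshift (- h) (vshift h z) = z.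
Proof. by case: z => x y; rewrite /vshift/= addrK. Qed.

Lemma dqm_vshift h f z : dqm h f (vshift h z) = dq h f z.
Proof. by rewrite /dqm vshiftK. Qed.

(** The exact discrete null Lagrangian. Integration by parts in the first variable moves that
    derivative from [g] to [dq h f]; it commutes with the shift, and translation invariance then
    moves the difference quotient onto [g]. *)
Lemma diff_pairing n h f f1 g g1 : continuous f -> continuous g -> Llo f1 -> Llo g1 ->
  ac1 f f1 -> ac1 g g1 -> csupp n f1 -> csupp n g -> csupp n g1 ->
  \int[L2]_z (dq h f z * g1 z - f1 z * dqm h g z) = 0.
Proof.
move=> cf cg lf1 lg1 af ag sf1 sg sg1.
have ldf : Llo (dq h f1).
  by apply: LloD; apply: LloZ => //; exact: (@Llo_vshift h n f1).
have cdf := cont_dq (h := h) cf.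
have adf : ac1 (dq h f) (dq h f1).
  apply: (@ac2_sd _ (fun a b => h^-1 * a + (- h^-1) * b) (fun _ _ => h^-1) (fun _ _ => - h^-1)
    (f \o vshift h \o sw) (f1 \o vshift h \o sw) (f \o sw) (f1 \o sw)) => //.
  - exact: (cont_sw (cont_vshift (h := h) cf)).
  - exact: cont_sw.
  - exact: ac1_vshift.
  - by move=> z; exact: sd_lin.
  - by move=> z; exact: cst_continuous.
  - by move=> z; exact: cst_continuous.
have am : ac1 (fun z => dq h f z * g z) (fun z => g z * dq h f1 z + dq h f z * g1 z).
  apply: (@ac2_sd _ (fun a b => a * b) (fun a b => b) (fun a b => a)
    (dq h f \o sw) (dq h f1 \o sw) (g \o sw) (g1 \o sw)) => //.
  - exact: cont_sw.
  - exact: cont_sw.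
  - by move=> z; exact: sd_mul.
  - exact: cont_sw.
  - exact: cont_sw.
have l1 : Llo (fun z => g z * dq h f1 z) by exact: Llo_contM.
have l2 : Llo (fun z => dq h f z * g1 z) by exact: Llo_contM.
have s1 : csupp n (fun z => g z * dq h f1 z) by move=> z zn; rewrite sg// mul0r.
have s2 : csupp n (fun z => dq h f z * g1 z) by move=> z zn; rewrite sg1// mulr0.
have i1 := csupp_integrable l1 s1; have i2 := csupp_integrable l2 s2.
have := @ac1_int0 n _ _ am (LloD l1 l2) _ _.
rewrite RintegralD// => E.
have {}E : \int[L2]_z (g z * dq h f1 z) + \int[L2]_z (dq h f z * g1 z) = 0.
  apply: E; first by move=> z zn; rewrite sg// mulr0.
  by move=> z zn; rewrite s1// s2// addr0.
have l3 : Llo (fun z => g z * f1 z) by exact: Llo_contM.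
have i3 : L2.-integrable setT (EFin \o (fun z => g z * f1 z)).
  by apply: (@csupp_integrable _ n) => // z zn; rewrite sg// mul0r.
have l4 : Llo (fun z => g (vshift (- h) z) * f1 z) by apply: Llo_contM => //; exact: (cont_vshift (h := - h) cg).
have i4 : L2.-integrable setT (EFin \o (fun z => g (vshift (- h) z) * f1 z)).
  by apply: (@csupp_integrable _ n) => // z zn; rewrite sf1// mulr0.
have i5 : L2.-integrable setT (EFin \o (fun z => g z * f1 (vshift h z))).
  have := pres_integrable (vshift_pres h) i4.
  by congr (_.-integrable _ (EFin \o _)); apply/funext => z; rewrite /= vshiftK.
have E5 : \int[L2]_z (g z * f1 (vshift h z)) = \int[L2]_z (g (vshift (- h) z) * f1 z).
  rewrite -[RHS](pres_Rintegral (vshift_pres h)); last by case: l4.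
  by apply: eq_Rintegral => z _; rewrite vshiftK.
have iZ k (F : R * R -> R) : L2.-integrable setT (EFin \o F) -> L2.-integrable setT (EFin \o (fun z => k * F z)).
  by move=> iF; exact: (integrableZl _ k iF).
have E6 : \int[L2]_z (g z * dq h f1 z) = h^-1 * \int[L2]_z (g z * f1 (vshift h z)) + (- h^-1) * \int[L2]_z (g z * f1 z).
  rewrite -!RintegralZl// -RintegralD//; [|exact: iZ|exact: iZ].
  by apply: eq_Rintegral => z _; rewrite /dq; ring.
have i7 : L2.-integrable setT (EFin \o (fun z => f1 z * dqm h g z)).
  have -> : (fun z => f1 z * dqm h g z) = (fun z => h^-1 * (g z * f1 z) + (- h^-1) * (g (vshift (- h) z) * f1 z)).
    by apply/funext => z; rewrite /dqm; ring.
  by apply: (integrableD _ (iZ _ _ i3) (iZ _ _ i4)).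
have E7 : \int[L2]_z (f1 z * dqm h g z) = h^-1 * \int[L2]_z (g z * f1 z) + (- h^-1) * \int[L2]_z (g (vshift (- h) z) * f1 z).
  rewrite -!RintegralZl// -RintegralD//; [|exact: iZ|exact: iZ].
  by apply: eq_Rintegral => z _; rewrite /dqm; ring.
rewrite RintegralB// E7.
move: E; rewrite E6 E5 => E; rewrite -[RHS]E; ring.
Qed.

Lemma dq_energy h f f2 : continuous f -> L2l f2 -> ac2 f f2 -> 0 < h ->
  (\int[L2]_z (dq h f z ^+ 2)%:E <= \int[L2]_z (f2 z ^+ 2)%:E)%E.
Proof.
move=> cf lf af h0.
have lf2 := L2l_sqr lf.
apply: ge0_le_integral_lines.
- by apply/measurable_EFinP; apply: mf2X; apply: cont_mf2; exact: cont_dq.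
- by apply/measurable_EFinP; case: lf2.
- by move=> z; rewrite lee_fin sqr_ge0.
- by move=> z; rewrite lee_fin sqr_ge0.
apply: ae_imp (ae_and af (Llo_lint lf2)) => x [ax lx].
have := @diff_quot_le _ (fun y => f (x, y)) (fun y => f2 (x, y)) h (cont_line (x := x) cf) ax lx h0.
apply: le_trans; rewrite le_eqVlt; apply/orP; left; apply/eqP; apply: eq_integral => y _.
by congr (_ ^+ 2)%:E; rewrite /dq /vshift /=; field; rewrite gt_eqF.
Qed.

Lemma dqm_energy h f f2 : continuous f -> L2l f2 -> ac2 f f2 -> 0 < h ->
  (\int[L2]_z (dqm h f z ^+ 2)%:E <= \int[L2]_z (f2 z ^+ 2)%:E)%E.
Proof.
move=> cf lf af h0; have := dq_energy cf lf af h0.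
apply: le_trans; rewrite le_eqVlt; apply/orP; left; apply/eqP.
rewrite -(@pres_integral _ _ (fun z => (dqm h f z ^+ 2)%:E) (vshift_pres h)).
  by apply: eq_integral => z _; rewrite dqm_vshift.
by apply/measurable_EFinP; apply: mf2X; apply: cont_mf2; exact: cont_dqm.
Qed.

Lemma dq_lim (f : R * R -> R) x y l : is_derive (y : R) 1 (fun y => f (x, y)) l ->
  (fun k => dq k.+1%:R^-1 f (x, y)) @ \oo --> l /\ (fun k => dqm k.+1%:R^-1 f (x, y)) @ \oo --> l.
Proof.
move=> /is_derive_eps H; split; apply/cvgrPdist_le => e e0; have [d d0 Hd] := H e e0.
- have := near_infty_natSinv_lt (PosNum d0); apply: filterS => k /= kd.
  have k0 : 0 < k.+1%:R^-1 :> R by rewrite invr_gt0 ltr0n.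
  move: (k.+1%:R^-1) kd k0 => i kd i0.
  have := Hd (y + i); rewrite (_ : y + i - y = i); last by ring.
  rewrite gtr0_norm// => /(_ kd) H1.
  rewrite distrC; have -> : dq i f (x, y) - l = i^-1 * (f (x, y + i) - f (x, y) - l * i).
    by rewrite /dq /vshift/=; field; rewrite gt_eqF.
  by rewrite normrM gtr0_norm ?invr_gt0// ler_pdivrMl// (le_trans H1)// mulrC.
- have := near_infty_natSinv_lt (PosNum d0); apply: filterS => k /= kd.
  have k0 : 0 < k.+1%:R^-1 :> R by rewrite invr_gt0 ltr0n.
  move: (k.+1%:R^-1) kd k0 => i kd i0.
  have := Hd (y - i); rewrite (_ : y - i - y = - i); last by ring.
  rewrite normrN gtr0_norm// => /(_ kd) H1.
  rewrite distrC; have -> : dqm i f (x, y) - l = - (i^-1 * (f (x, y - i) - f (x, y) - l * - i)).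
    by rewrite /dqm /vshift/=; field; rewrite gt_eqF.
  by rewrite normrN normrM gtr0_norm ?invr_gt0// ler_pdivrMl// (le_trans H1)// mulrC.
Qed.

Lemma sqr_integrable n f : L2l f -> csupp n f -> L2.-integrable setT (EFin \o (fun z => f z ^+ 2)).
Proof.
move=> lf sf; apply: (@csupp_integrable _ n); first exact: L2l_sqr.
by move=> z zn; rewrite sf// expr0n.
Qed.

(* For smooth functions the integral is 0.  With the difference quotient [dq] in
   place of the second partial derivative it is 0 by [diff_pairing], and Fatou
   applied to the sum of squares [A] keeps one inequality in the limit. *)
Lemma null_lagrangian n f f1 f2 g g1 g2 : H1 f f1 f2 -> H1 g g1 g2 ->
  csupp n f -> csupp n f1 -> csupp n f2 -> csupp n g -> csupp n g1 -> csupp n g2 ->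
  \int[L2]_z (f2 z * g1 z - f1 z * g2 z) <= 0.
Proof.
move=> [cf lf1 lf2 a1f a2f] [cg lg1 lg2 a1g a2g] sf sf1 sf2 sg sg1 sg2.
pose hk k : R := k.+1%:R^-1.
have hk0 k : 0 < hk k by rewrite invr_gt0 ltr0n.
(* The signs are chosen so that the cross terms of these squares are exactly the integrand of the
   pairing, discrete in [A] and exact in [B]. The remaining terms are half the sum of the four
   squares. *)
pose A k z := 2^-1 * (dq (hk k) f z + g1 z) ^+ 2 + 2^-1 * (f1 z - dqm (hk k) g z) ^+ 2.
pose B z := 2^-1 * (f2 z + g1 z) ^+ 2 + 2^-1 * (f1 z - g2 z) ^+ 2.
have h2 : 0 <= 2^-1 :> R by rewrite invr_ge0.
have A0 k z : 0 <= A k z by rewrite addr_ge0// mulr_ge0// sqr_ge0.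
have B0 z : 0 <= B z by rewrite addr_ge0// mulr_ge0// sqr_ge0.
have m1 := lf1.1; have m2 := lf2.1; have n1 := lg1.1; have n2 := lg2.1.
have mc (c : R) : mf2 (fun=> c) by exact: measurable_cst.
have mA k : mf2 (A k).
  have md : mf2 (dq (hk k) f) by apply: cont_mf2; exact: cont_dq.
  have mdm : mf2 (dqm (hk k) g) by apply: cont_mf2; exact: cont_dqm.
  apply: mf2D; apply: mf2M => //; apply: mf2X; first exact: mf2D.
  exact: mf2B.
have mB : mf2 B.
  by apply: mf2D; apply: mf2M => //; apply: mf2X; [exact: mf2D|exact: mf2B].
have if1 := sqr_integrable lf1 sf1; have if2 := sqr_integrable lf2 sf2.
have ig1 := sqr_integrable lg1 sg1; have ig2 := sqr_integrable lg2 sg2.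
pose S := 2^-1 * (\int[L2]_z (f1 z ^+ 2) + \int[L2]_z (f2 z ^+ 2) + (\int[L2]_z (g1 z ^+ 2) + \int[L2]_z (g2 z ^+ 2))).
have iZ c (F : R * R -> R) : L2.-integrable setT (EFin \o F) -> L2.-integrable setT (EFin \o (fun z => c * F z)).
  by move=> iF; exact: (integrableZl _ c iF).
have iD (F G : R * R -> R) : L2.-integrable setT (EFin \o F) -> L2.-integrable setT (EFin \o G) -> L2.-integrable setT (EFin \o (fun z => F z + G z)).
  by move=> iF iG; exact: (integrableD _ iF iG).
have iP (F G : R * R -> R) : L2l F -> L2l G -> csupp n F -> L2.-integrable setT (EFin \o (fun z => F z * G z)).
  move=> lF lG sF; apply: (@csupp_integrable _ n); first exact: L2l_prod.
  by move=> z zn; rewrite sF// mul0r.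
have expand (F F1 G G1 : R * R -> R) : L2l F1 -> L2l G1 -> csupp n F1 -> csupp n G1 -> L2l F -> L2l G ->
    L2.-integrable setT (EFin \o (fun z => F z ^+ 2)) -> L2.-integrable setT (EFin \o (fun z => G z ^+ 2)) ->
    (\int[L2]_z (2^-1 * (F z + G1 z) ^+ 2 + 2^-1 * (F1 z - G z) ^+ 2)%:E =
     (\int[L2]_z (F z * G1 z - F1 z * G z) + 2^-1 * (\int[L2]_z (F1 z ^+ 2) + \int[L2]_z (F z ^+ 2) + (\int[L2]_z (G1 z ^+ 2) + \int[L2]_z (G z ^+ 2))))%:E)%E.
  move=> lF1 lG1 sF1 sG1 lF lG iF iG.
  have iF1 := sqr_integrable lF1 sF1; have iG1 := sqr_integrable lG1 sG1.
  have i1 : L2.-integrable setT (EFin \o (fun z => F z * G1 z)).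
    have := iP _ _ lG1 lF sG1.
    by congr (_.-integrable _ (EFin \o _)); apply/funext => z; rewrite mulrC.
  have i2 := iP _ _ lF1 lG sF1.
  have iJ : L2.-integrable setT (EFin \o (fun z => F z * G1 z - F1 z * G z)).
    by exact: (integrableB _ i1 i2).
  have iQ := iD _ _ (iD _ _ iF1 iF) (iD _ _ iG1 iG).
  have -> : (\int[L2]_z (2^-1 * (F z + G1 z) ^+ 2 + 2^-1 * (F1 z - G z) ^+ 2)%:E)%E =
     (\int[L2]_z ((F z * G1 z - F1 z * G z) + 2^-1 * (F1 z ^+ 2 + F z ^+ 2 + (G1 z ^+ 2 + G z ^+ 2)))%:E)%E.
    by apply: eq_integral => z _; congr EFin; field.
  rewrite -[LHS]fineK; last exact: (integrable_fin_num _ (iD _ _ iJ (iZ 2^-1 _ iQ))).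
  congr EFin; rewrite -[LHS]/(Rintegral L2 setT _) RintegralD//; last exact: iZ.
  have e1 : \int[L2]_z (F1 z ^+ 2 + F z ^+ 2) = \int[L2]_z (F1 z ^+ 2) + \int[L2]_z (F z ^+ 2) by exact: RintegralD.
  have e2 : \int[L2]_z (G1 z ^+ 2 + G z ^+ 2) = \int[L2]_z (G1 z ^+ 2) + \int[L2]_z (G z ^+ 2) by exact: RintegralD.
  rewrite RintegralZl// -e1 -e2; congr (_ + _ * _); apply: RintegralD => //; exact: iD.
(* The pairing in [A k] has integral 0, and difference quotients have no more energy than
   derivatives. As the integral of [B] is that of the pairing plus [S], Fatou gives the sign. *)
have intA k : (\int[L2]_z (A k z)%:E <= S%:E)%E.
  have lF : L2l (dq (hk k) f) by apply: cont_L2l; exact: cont_dq.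
  have lG : L2l (dqm (hk k) g) by apply: cont_L2l; exact: cont_dqm.
  have en1 := dq_energy cf lf2 a2f (hk0 k); have en2 := dqm_energy cg lg2 a2g (hk0 k).
  have sqi (F G : R * R -> R) : mf2 F -> L2.-integrable setT (EFin \o (fun z => G z ^+ 2)) ->
      (\int[L2]_z (F z ^+ 2)%:E <= \int[L2]_z (G z ^+ 2)%:E)%E ->
      L2.-integrable setT (EFin \o (fun z => F z ^+ 2)) /\ \int[L2]_z (F z ^+ 2) <= \int[L2]_z (G z ^+ 2).
    move=> mF iG FG; have fG := integrable_fin_num measurableT iG.
    have iF : L2.-integrable setT (EFin \o (fun z => F z ^+ 2)).
      apply/integrableP; split; first by apply/measurable_EFinP; exact: mf2X.
      have -> : (\int[L2]_z `|(EFin \o (fun z => (F z ^+ 2)%R)) z| = \int[L2]_z (F z ^+ 2)%:E)%E.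
        by apply: eq_integral => z _; rewrite /= ger0_norm// sqr_ge0.
      by apply: (le_lt_trans FG); rewrite ltey_eq fG.
    split => //; rewrite -lee_fin /Rintegral !fineK//.
    exact: (integrable_fin_num measurableT iF).
  have [iF en1'] := sqi _ _ lF.1 if2 en1; have [iG en2'] := sqi _ _ lG.1 ig2 en2.
  have := expand (dq (hk k) f) f1 (dqm (hk k) g) g1 lf1 lg1 sf1 sg1 lF lG iF iG.
  rewrite -/(A k _) => ->.
  rewrite (@diff_pairing n (hk k) f f1 g g1)//; [|exact: L2l_Llo|exact: L2l_Llo].
  by rewrite add0r lee_fin /S ler_wpM2l// !lerD.
have Fa : (\int[L2]_z (B z)%:E <= S%:E)%E.
  (* On almost every vertical line [f2] and [g2] are classical derivatives almost everywhere, so the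
     quotients converge there. *)
  have -> : (\int[L2]_z (B z)%:E = \int[L2]_z limn_einf (fun k => (A k z)%:E))%E.
    apply: ge0_integral_ae_lines.
    - exact/measurable_EFinP.
    - rewrite (_ : (fun z => _) = (fun z => - limn_esup (-%E \o (fun k => (A k z)%:E)))%E); last first.
        by apply/funext => z; rewrite limn_esupN oppeK.
      apply: (measurableT_comp (f := -%E)) => //.
      apply: measurable_fun_limn_esup => k.
      have /measurable_EFinP := mf2N (mA k); exact.
    - by move=> z; rewrite lee_fin.
    - move=> z; rewrite limn_einf_lim; apply: lime_ge; first exact: is_cvg_einfs.
      by apply: nearW => k; apply: le_ereal_inf_tmp => _ [j /= kj <-]; rewrite lee_fin.
    apply: ae_imp (ae_and a2f a2g) => x [afx agx].
    apply: ae_imp (ae_and (AC_ae_derive afx) (AC_ae_derive agx)) => y [dfy dgy].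
    have [l1 _] := dq_lim dfy; have [_ l2] := dq_lim dgy.
    have cA : (A k (x, y))%:E @[k --> \oo] --> (B (x, y))%:E.
      apply: cvg_EFin; first exact: nearW.
      have -> : B (x, y) = 2^-1 * ((f2 (x, y) + g1 (x, y)) * (f2 (x, y) + g1 (x, y))) +
         2^-1 * ((f1 (x, y) - g2 (x, y)) * (f1 (x, y) - g2 (x, y))) by rewrite /B !expr2.
      rewrite (_ : _ \o _ = (fun k => 2^-1 * ((dq (hk k) f (x, y) + g1 (x, y)) * (dq (hk k) f (x, y) + g1 (x, y))) +
         2^-1 * ((f1 (x, y) - dqm (hk k) g (x, y)) * (f1 (x, y) - dqm (hk k) g (x, y))))); last first.
        by apply/funext => k; rewrite /= /A !expr2.
      have cp : (fun k => dq (hk k) f (x, y) + g1 (x, y)) @ \oo --> f2 (x, y) + g1 (x, y).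
        by apply: cvgD; [exact: l1|exact: cvg_cst].
      have cm : (fun k => f1 (x, y) - dqm (hk k) g (x, y)) @ \oo --> f1 (x, y) - g2 (x, y).
        by apply: cvgB; [exact: cvg_cst|exact: l2].
      by apply: cvgD; apply: cvgM; [exact: cvg_cst|exact: cvgM|exact: cvg_cst|exact: cvgM].
    by rewrite (cvg_limn_einf_sup cA).1.
  apply: (le_trans (@fatou _ _ _ L2 setT measurableT (fun k z => (A k z)%:E) _ _)).
  - by move=> k; have /measurable_EFinP := mA k; exact.
  - by move=> k z _; rewrite lee_fin.
  rewrite limn_einf_lim; apply: lime_le; first exact: is_cvg_einfs.
  apply: nearW => k; apply: (le_trans _ (intA k)).
  by apply: ereal_inf_lbound; exists k => /=.
have := expand f2 f1 g2 g1 lf1 lg1 sf1 sg1 lf2 lg2 if2 ig2.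
move=> E; move: Fa.
have {}E : (\int[L2]_z (B z)%:E = (\int[L2]_z (f2 z * g1 z - f1 z * g2 z) + S)%:E)%E := E.
by rewrite E lee_fin gerDr.
Qed.

End NullLagrangian.

(** * Partial derivatives of the solution as Sobolev functions *)

Section Interface.
Context {R : realType}.
Notation MR := (measurableTypeR R).
Notation mu := (@lebesgue_measure R).
Notation L2 := (@lebesgue2 R).
Implicit Types (f g u : R * R -> R).

Lemma restrict_box_mf2 f : (forall n, mf2 (f \_ (box n))) -> mf2 f.
Proof.
move=> H; rewrite /mf2.
have -> : [set: MR * MR] = \bigcup_(n : nat) (box n : set (MR * MR)).
  by apply/esym; rewrite -subTset => z _; have [n zn] := in_box z; exists n.
apply/measurable_fun_bigcup => [n|n]; first exact: box_measurable.
by apply/(measurable_restrictT f); [exact: box_measurable|exact: H].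
Qed.

Lemma Lloc1_Llo f : Lloc 1%E f -> Llo f.
Proof.
move=> H; split.
  apply: restrict_box_mf2 => n.
  by have /Lfun1_integrable/integrableP[/measurable_EFinP] := H _ (@box_compact R n).
by move=> n; apply/integrable_box_mk/Lfun1_integrable/H; exact: box_compact.
Qed.

Lemma Lloc2_L2l f : Lloc 2%:E f -> L2l f.
Proof.
move=> H.
have mf : mf2 f.
  apply: restrict_box_mf2 => n.
  by have /andP[+ _] := H _ (@box_compact R n); rewrite inE.
split => // n.
have := Lfun2_integrable_sqr (H _ (@box_compact R n)) => I.
apply/integrable_box_mk; move: I; congr (_.-integrable _ (EFin \o _)).
by apply/funext => z; rewrite !patchE; case: ifP => // _; rewrite expr0n.
Qed.

Lemma slope0 f (x : R * R) : (fun h : R => h^-1 *: ((f \o shift x) (h *: basis_vec 0) - f x)) =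
  (fun h : R => h^-1 *: (((fun t => f (t, x.2)) \o shift x.1) (h *: (1 : R)) - f (x.1, x.2))).
Proof.
apply/funext => h; case: x => x y /=; rewrite /basis_vec eqxx /=.
have -> // : h *: ((1, 0) : R * R) + (x, y) = (h *: (1 : R) + x, y).
by rewrite -[LHS]/(h * 1 + x, h * 0 + y) mulr0 add0r.
Qed.

Lemma slope1 f (x : R * R) : (fun h : R => h^-1 *: ((f \o shift x) (h *: basis_vec 1) - f x)) =
  (fun h : R => h^-1 *: (((fun t => f (x.1, t)) \o shift x.2) (h *: (1 : R)) - f (x.1, x.2))).
Proof.
apply/funext => h; case: x => x y /=; rewrite /basis_vec /=.
have -> // : h *: ((0, 1) : R * R) + (x, y) = (x, h *: (1 : R) + y).
by rewrite -[LHS]/(h * 0 + x, h * 1 + y) mulr0 add0r.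
Qed.

Lemma is_derive_basis0 f (x : R * R) l :
  is_derive x (basis_vec 0) f l <-> is_derive x.1 1 (fun t => f (t, x.2)) l.
Proof.
split => -[d1 d2]; apply: DeriveDef.
- by move: d1; rewrite /derivable slope0.
- by move: d2; rewrite /derive slope0.
- by rewrite /derivable slope0.
- by rewrite /derive slope0.
Qed.

Lemma is_derive_basis1 f (x : R * R) l :
  is_derive x (basis_vec 1) f l <-> is_derive x.2 1 (fun t => f (x.1, t)) l.
Proof.
split => -[d1 d2]; apply: DeriveDef.
- by move: d1; rewrite /derivable slope1.
- by move: d2; rewrite /derive slope1.
- by rewrite /derivable slope1.
- by rewrite /derive slope1.
Qed.

Lemma I2P (i : 'I_2) : i = 0 \/ i = 1.
Proof. by case: i => -[|[|//]] p; [left|right]; apply/val_inj. Qed.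

Lemma tensor_derive0 (b c : R -> R) (z : R * R) : smooth b ->
  is_derive z (basis_vec 0) (fun z => b z.1 * c z.2) (b^`()%classic z.1 * c z.2).
Proof.
move=> sb; apply/is_derive_basis0 => /=.
have db := smooth_derive sb z.1.
have := is_deriveM db (is_derive_cst (c z.2) (z.1 : R) 1).
move=> /is_derive_eq; apply.
by rewrite /cst /GRing.scale/= mulr0 add0r mulrC.
Qed.

Lemma tensor_derive1 (b c : R -> R) (z : R * R) : smooth c ->
  is_derive z (basis_vec 1) (fun z => b z.1 * c z.2) (b z.1 * c^`()%classic z.2).
Proof.
move=> sc; apply/is_derive_basis1 => /=.
have dc := smooth_derive sc z.2.
have := is_deriveM (is_derive_cst (b z.1) (z.2 : R) 1) dc.
move=> /is_derive_eq; apply.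
by rewrite /cst /GRing.scale/= mulr0 addr0.
Qed.

Lemma tensor_partial0 (b c : R -> R) : smooth b ->
  partial [:: 0] (fun z : R * R => b z.1 * c z.2) = (fun z => b^`()%classic z.1 * c z.2).
Proof. by move=> sb; apply/funext => z; have [_ <-] := tensor_derive0 c z sb. Qed.

Lemma tensor_partial1 (b c : R -> R) : smooth c ->
  partial [:: 1] (fun z : R * R => b z.1 * c z.2) = (fun z => b z.1 * c^`()%classic z.2).
Proof. by move=> sc; apply/funext => z; have [_ <-] := tensor_derive1 b z sc. Qed.

Lemma partial_cons2 i j f : partial [:: i; j] f = partial [:: i] (partial [:: j] f).
Proof. by []. Qed.

Lemma tensor_partial (b c : R -> R) s : smooth b -> smooth c ->
  exists b' c' : R -> R, [/\ smooth b', smooth c' & partial s (fun z => b z.1 * c z.2) = (fun z => b' z.1 * c' z.2)].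
Proof.
move=> sb sc; elim: s => [|i s [b' [c' [sb' sc' E]]]]; first by exists b, c.
have [->|->] := I2P i.
- exists b'^`()%classic, c'; split => //; first exact: smooth_derive1.
  by rewrite /= E -tensor_partial0.
- exists b', c'^`()%classic; split => //; first exact: smooth_derive1.
  by rewrite /= E -tensor_partial1.
Qed.

Lemma tensor_cont (b c : R -> R) : smooth b -> smooth c -> continuous (fun z : R * R => b z.1 * c z.2).
Proof. by move=> sb sc; apply: contM; [apply: cont_fst|apply: cont_snd]; exact: smooth_cont. Qed.

Lemma tensor_csupp (b c : R -> R) : csm b -> csm c -> exists n, csupp n (fun z : R * R => b z.1 * c z.2).
Proof.
move=> cb cc; have [N1 H1] := csm_bound cb; have [N2 H2] := csm_bound cc.
exists (maxn N1 N2) => z zN.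
have [z1|z1] := ltP (N1%:R : R) `|z.1|; first by rewrite H1 ?mul0r.
have [z2|z2] := ltP (N2%:R : R) `|z.2|; first by rewrite H2 ?mulr0.
exfalso; apply: zN; apply/boxE; split; [apply: (le_trans z1)|apply: (le_trans z2)].
  by rewrite ler_nat leq_maxl.
by rewrite ler_nat leq_maxr.
Qed.

(** Products of one-variable functions are the only test functions fed to the weak derivatives; they
    suffice for [ac2_weak]. *)
Lemma tensor_test (b c : R -> R) : csm b -> csm c -> test_function (fun z : R * R => b z.1 * c z.2).
Proof.
move=> cb cc; have [sb _] := cb; have [sc _] := cc; split.
  move=> k s _; have [b' [c' [sb' sc' ->]]] := tensor_partial s sb sc.
  split; first exact: tensor_cont.
  move=> _ i z; have [->|->] := I2P i.
    by have [] := tensor_derive0 c' z sb'.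
  by have [] := tensor_derive1 b' z sc'.
have [N bcN] := tensor_csupp cb cc.
apply: (@subclosed_compact _ _ (box N)); [exact: closed_closure|exact: box_compact|].
have cN : closed (box N : set (R * R)).
  have -> : (box N : set (R * R)) = fst @^-1` `[- N%:R, N%:R] `&` snd @^-1` `[- N%:R, N%:R] by [].
  apply: closedI; apply: preimage_closed; try exact: interval_closed.
    by move=> z _; exact: cvg_fst.
  by move=> z _; exact: cvg_snd.
suff H : [set z : R * R | b z.1 * c z.2 != 0] `<=` box N.
  by apply: (subset_trans (closureS H)); rewrite -((closure_id _).1 cN).
by move=> z /= z0; apply: contrapT => /bcN zN; rewrite zN eqxx in z0.
Qed.

Lemma weak1_ac2 f g : continuous f -> weak_partial [:: 1] f g -> ac2 f g.
Proof.
move=> cf [_ lg H]; apply: ac2_weak => //; first exact: Lloc1_Llo.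
move=> b c cb cc; have := H _ (tensor_test cb cc).
by rewrite tensor_partial1 ?expr1 ?mulN1r//; case: cc.
Qed.

Lemma Rint_sw_tensor f (b c : R -> R) : mf2 f -> continuous b -> continuous c ->
  \int[L2]_z ((f \o sw) z * (b z.1 * c z.2)) = \int[L2]_z (f z * (c z.1 * b z.2)).
Proof.
move=> mf cb cc; rewrite -[RHS](pres_Rintegral sw_pres).
  by apply: eq_Rintegral => z _ /=; rewrite (mulrC (c _)).
apply: mf2M => //; apply: cont_mf2; apply: contM; [exact: cont_fst|exact: cont_snd].
Qed.

Lemma csm_cont (b : R -> R) : csm b -> continuous b.
Proof. by case=> sb _; exact: smooth_cont. Qed.

Lemma weak0_ac1 f g : continuous f -> weak_partial [:: 0] f g -> ac1 f g.
Proof.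
move=> cf [_ /Lloc1_Llo lg H]; apply: ac2_weak; [exact: cont_sw|exact: Llo_sw|].
move=> b c cb cc; have := H _ (tensor_test cc cb).
rewrite tensor_partial0 ?expr1 ?mulN1r; last by case: cc.
move=> E; rewrite !Rint_sw_tensor//.
- by case: lg.
- exact: csm_cont.
- exact: csm_cont.
- exact: cont_mf2.
- exact: csm_cont.
- by apply: csm_cont; exact: csm_derive1.
Qed.

Lemma tensor_ac2 (b c : R -> R) : smooth c ->
  ac2 (fun z : R * R => b z.1 * c z.2) (fun z => b z.1 * c^`()%classic z.2).
Proof.
move=> sc; apply: aeW => x /=; apply: C1_AC.
  move=> y; have dc := smooth_derive sc y.
  have := is_deriveM (is_derive_cst (b x) (y : R) 1) dc.
  move=> /is_derive_eq; apply.
  by rewrite /cst /GRing.scale/= mulr0 addr0.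
move=> y; apply: cvgM; first exact: cvg_cst.
exact: (smooth_cont (smooth_derive1 sc)).
Qed.

Lemma ac2_tensor_int f f2 (b c : R -> R) : continuous f -> continuous f2 -> ac2 f f2 ->
  csm b -> csm c ->
  \int[L2]_z (f2 z * (b z.1 * c z.2)) = - \int[L2]_z (f z * (b z.1 * c^`()%classic z.2)).
Proof.
move=> cf cf2 af cb cc; have [sb _] := cb; have [sc _] := cc.
have cc' := csm_derive1 cc; have [sc' _] := cc'.
have [n1 t1] := tensor_csupp cb cc; have [n2 t2] := tensor_csupp cb cc'.
have s1 := csupp_le (leq_maxl n1 n2) t1; have s2 := csupp_le (leq_maxr n1 n2) t2.
set n := maxn n1 n2 in s1 s2.
have ct := tensor_cont sb sc; have ct' := tensor_cont sb sc'.
have A : ac2 (fun z => f z * (b z.1 * c z.2))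
    (fun z => (b z.1 * c z.2) * f2 z + f z * (b z.1 * c^`()%classic z.2)).
  apply: (@ac2_sd _ (fun a b => a * b) (fun a b => b) (fun a b => a)) => //.
  - exact: tensor_ac2.
  - by move=> z; exact: sd_mul.
have l1 : Llo (fun z => (b z.1 * c z.2) * f2 z) by apply: cont_Llo; exact: contM.
have l2 : Llo (fun z => f z * (b z.1 * c^`()%classic z.2)) by apply: cont_Llo; exact: contM.
have z1 : csupp n (fun z => (b z.1 * c z.2) * f2 z) by move=> z zn; rewrite (s1 z zn) mul0r.
have z2 : csupp n (fun z => f z * (b z.1 * c^`()%classic z.2)) by move=> z zn; rewrite (s2 z zn) mulr0.
have := ac2_int0 (n := n) A (LloD l1 l2).
rewrite RintegralD; [|exact: measurableT|exact: csupp_integrable z1|exact: csupp_integrable z2].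
move=> E; apply/eqP; rewrite -addr_eq0; apply/eqP.
rewrite -[RHS]E.
- by congr (_ + _); apply: eq_Rintegral => z _; rewrite mulrC.
- by move=> z zn; rewrite (s1 z zn) mulr0.
- by move=> z zn; rewrite (z1 z zn) (z2 z zn) addr0.
Qed.

Lemma ac1_tensor_int f f1 (b c : R -> R) : continuous f -> continuous f1 -> ac1 f f1 ->
  csm b -> csm c ->
  \int[L2]_z (f1 z * (b z.1 * c z.2)) = - \int[L2]_z (f z * (b^`()%classic z.1 * c z.2)).
Proof.
move=> cf cf1 af cb cc.
have := ac2_tensor_int (cont_sw cf) (cont_sw cf1) af cc cb.
rewrite !Rint_sw_tensor//; try exact: cont_mf2; try exact: csm_cont.
by apply: csm_cont; exact: csm_derive1.
Qed.

(** One derivative is moved back from the test function to the C1 function [u], so a weak second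
    derivative of [u] becomes a weak first derivative of [b]. *)
Lemma second_22 u b g : continuous u -> continuous b -> ac2 u b -> Llo g ->
  (forall B C : R -> R, csm B -> csm C ->
    \int[L2]_z (u z * (B z.1 * (C^`()^`())%classic z.2)) = \int[L2]_z (g z * (B z.1 * C z.2))) ->
  ac2 b g.
Proof.
move=> cu cb au lg H; apply: ac2_weak => // B C cB cC.
by rewrite (ac2_tensor_int cu cb au)// ?H//; exact: csm_derive1.
Qed.

Lemma second_12 u a g : continuous u -> continuous a -> ac1 u a -> Llo g ->
  (forall B C : R -> R, csm B -> csm C ->
    \int[L2]_z (u z * (B^`()%classic z.1 * C^`()%classic z.2)) = \int[L2]_z (g z * (B z.1 * C z.2))) ->
  ac2 a g.
Proof.
move=> cu ca au lg H; apply: ac2_weak => // B C cB cC.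
by rewrite (ac1_tensor_int cu ca au)// ?H//; exact: csm_derive1.
Qed.

Section ClassC1.
Variables (u : R * R -> R) (uC1 : class_C 1 u).

Lemma C1_cont : continuous u. Proof. by have [] := uC1 (s := [::]) isT. Qed.
Lemma C1_cont_partial i : continuous ('D_(basis_vec i) u).
Proof. by have [] := uC1 (s := [:: i]) isT. Qed.
Lemma C1_is_derive i z : is_derive z (basis_vec i) u ('D_(basis_vec i) u z).
Proof. by have [_ H] := uC1 (s := [::]) isT; apply: DeriveDef => //; exact: (H isT). Qed.

Lemma C1_ac2 : ac2 u ('D_(basis_vec 1) u).
Proof.
apply: aeW => x; apply: C1_AC; last exact: (cont_line (@C1_cont_partial 1)).
by move=> y; exact: (is_derive_basis1 _ (x, y) _).1 (C1_is_derive 1 (x, y)).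
Qed.

Lemma C1_ac1 : ac1 u ('D_(basis_vec 0) u).
Proof.
apply: aeW => y; apply: C1_AC; last exact: (cont_line (cont_sw (@C1_cont_partial 0))).
by move=> x; exact: (is_derive_basis0 _ (x, y) _).1 (C1_is_derive 0 (x, y)).
Qed.

Lemma weak_second g i j : weak_partial [:: i; j] u g ->
  Llo g /\ forall B C : R -> R, csm B -> csm C ->
    \int[L2]_z (u z * partial [:: i; j] (fun z => B z.1 * C z.2) z) = \int[L2]_z (g z * (B z.1 * C z.2)).
Proof.
move=> [_ /Lloc1_Llo lg H]; split => // B C cB cC.
by rewrite H ?expr2 ?mulN1r ?opprK ?mul1r//; exact: tensor_test.
Qed.

Lemma weak11 g : weak_partial [:: 1; 1] u g -> ac2 ('D_(basis_vec 1) u) g.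
Proof.
move=> /weak_second[lg H]; apply: (second_22 C1_cont (@C1_cont_partial 1) C1_ac2) => // B C cB cC.
rewrite -H//; apply: eq_Rintegral => z _; congr (_ * _).
have [sC _] := cC.
by rewrite partial_cons2 tensor_partial1// tensor_partial1//; exact: smooth_derive1.
Qed.

Lemma weak00 g : weak_partial [:: 0; 0] u g -> ac1 ('D_(basis_vec 0) u) g.
Proof.
move=> /weak_second[lg H].
apply: (second_22 (cont_sw C1_cont) (cont_sw (@C1_cont_partial 0)) C1_ac1); first exact: Llo_sw.
move=> B C cB cC; have [sC _] := cC.
have sC' := smooth_derive1 sC.
rewrite !Rint_sw_tensor//; try exact: csm_cont; try by case: lg.
- rewrite -H//; apply: eq_Rintegral => z _; congr (_ * _).
  by rewrite partial_cons2 tensor_partial0// tensor_partial0.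
- exact: (cont_mf2 C1_cont).
- by apply: smooth_cont; exact: smooth_derive1.
Qed.

(** Symmetry of the second derivatives: the mixed derivative of a product test function is [B' C'],
    from which either factor may be integrated by parts. *)
Lemma weak01 g : weak_partial [:: 0; 1] u g ->
  ac2 ('D_(basis_vec 0) u) g /\ ac1 ('D_(basis_vec 1) u) g.
Proof.
move=> /weak_second[lg H]; split.
  apply: (second_12 C1_cont (@C1_cont_partial 0) C1_ac1) => // B C cB cC.
  rewrite -H//; apply: eq_Rintegral => z _; congr (_ * _).
  have [sB _] := cB; have [sC _] := cC.
  by rewrite partial_cons2 tensor_partial1// tensor_partial0.
apply: (second_12 (cont_sw C1_cont) (cont_sw (@C1_cont_partial 1)) C1_ac2); first exact: Llo_sw.
move=> B C cB cC.
rewrite !Rint_sw_tensor//; try exact: csm_cont; try (apply: csm_cont; exact: csm_derive1); try by case: lg.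
- rewrite -H//; apply: eq_Rintegral => z _; congr (_ * _).
  have [sB _] := cB; have [sC _] := cC.
  by rewrite partial_cons2 tensor_partial1// tensor_partial0.
- exact: (cont_mf2 C1_cont).
Qed.

End ClassC1.

Lemma AC_ae (f g g' : R -> R) : AC f g -> measurable_fun setT g' -> {ae mu, forall x, g x = g' x} -> AC f g'.
Proof.
move=> [lg H] mg' gg'; have mg := lint_measurable lg.
have D (s t : R) : ae_eq mu (`[s, t]%classic : set R) (EFin \o g) (EFin \o g').
  by apply: ae_imp gg' => x E _ /=; rewrite E.
split => [s t|s t st].
  apply/integrableP; split; first by apply/measurable_EFinP; exact: measurable_funTS.
  have /integrableP[_] := lg s t; apply: le_lt_trans; rewrite le_eqVlt; apply/orP; left; apply/eqP.
  apply: ae_eq_integral; [exact: measurable_itv| | |].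
  - by apply/measurable_EFinP; apply: measurableT_comp => //; exact: measurable_funTS.
  - by apply/measurable_EFinP; apply: measurableT_comp => //; exact: measurable_funTS.
  - by apply: ae_imp gg' => x E _ /=; rewrite E.
rewrite H//; congr fine; apply: ae_eq_integral; [exact: measurable_itv| | |exact: D].
- by apply/measurable_EFinP; exact: measurable_funTS.
- by apply/measurable_EFinP; exact: measurable_funTS.
Qed.

Lemma ac2_ae f g g' : ac2 f g -> mf2 g' -> {ae L2, forall z, g z = g' z} -> ac2 f g'.
Proof.
move=> af mg' /ae_lines gg'; apply: ae_imp (ae_and af gg') => x [afx gx].
by apply: AC_ae afx _ gx; exact: (measurable_fun_pair2 x mg').
Qed.

Lemma ac1_ae f g g' : ac1 f g -> mf2 g' -> {ae L2, forall z, g z = g' z} -> ac1 f g'.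
Proof.
move=> af mg' gg'; apply: (ac2_ae af); first exact: mf2_sw.
exact: (ae_sw gg').
Qed.

Lemma AC_unique (f g g' : R -> R) : AC f g -> AC f g' -> {ae mu, forall x, g x = g' x}.
Proof.
move=> [lg H] [lg' H'].
have : {ae mu, forall x, g x - g' x = 0}.
  apply: lint_ae0; first exact: lintB.
  by move=> s t st; rewrite intB// -H ?ltW// -H' ?ltW// subrr.
by apply: ae_imp => x /eqP; rewrite subr_eq0 => /eqP.
Qed.

(** Two densities agree almost everywhere on each good line, and the integral of [|g - g'|] over the
    plane is computed line by line. This identifies weak derivatives that come from different
    hypotheses. *)
Lemma ac2_unique f g g' : ac2 f g -> ac2 f g' -> mf2 g -> mf2 g' -> {ae L2, forall z, g z = g' z}.
Proof.
move=> af af' mg mg'.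
have md : mf2 (fun z => g z - g' z) by exact: mf2B.
have : (\int[L2]_z `|(g z - g' z)%:E| = 0)%E.
  rewrite (@ge0_integral_ae_lines _ _ (fun=> 0%E)).
  - by rewrite integral_cst// mul0e.
  - by apply/measurable_EFinP; exact: mf2_norm.
  - exact: measurable_cst.
  - by [].
  - by [].
  - apply: ae_imp (ae_and af af') => x [h h'].
    by apply: ae_imp (AC_unique h h') => y /= ->; rewrite subrr normr0.
have mdE : @measurable_fun _ _ (MR * MR)%type _ setT (EFin \o (fun z => g z - g' z)) by apply/measurable_EFinP.
move=> /(ae_eq_integral_abs L2 measurableT mdE).
by apply: ae_imp => z /(_ I) [] /eqP; rewrite subr_eq0 => /eqP.
Qed.

Lemma ac1_unique f g g' : ac1 f g -> ac1 f g' -> mf2 g -> mf2 g' -> {ae L2, forall z, g z = g' z}.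
Proof.
move=> af af' mg mg'; have := ac2_unique af af' (mf2_sw mg) (mf2_sw mg').
by move=> /ae_sw; apply: ae_imp => -[x y].
Qed.

Lemma loclip_cont (F : R -> R) : locally_lipschitz F -> continuous F.
Proof.
move=> H t; have [U Ut lU] := H t.
apply/cvgrPdist_le => e e0.
have [M [M0 HM]] : exists M : R, 0 < M /\ forall s, U s -> `|F t - F s| <= M * `|t - s|.
  have [M [Mr HM]] := lU; exists (`|M| + 1); split; first by have := normr_ge0 M; lra.
  have M1 : M < `|M| + 1 by have := ler_norm M; lra.
  by move=> s Us; apply: (HM _ M1 (t, s)); split => //; exact: nbhs_singleton.
have eM : 0 < e / M by rewrite divr_gt0.
have /cvgrPdist_le/(_ _ eM) := @cvg_id _ (nbhs t).
apply: filterS2 Ut => s Us ts; apply: (le_trans (HM _ Us)).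
by rewrite mulrC -ler_pdivlMr.
Qed.

(** Translates the hypotheses on [u] and the equation into absolute continuity on lines. The
    derivatives of [F \o u] become square integrable because the equation rewrites them as the
    Laplacian times a continuous gradient. *)
Lemma semilinear_H1 (F : R -> R) u : locally_lipschitz F -> Wloc 2 2%:E u -> class_C 1 u ->
  solves_semilinear F u ->
  exists g00 g01 g11 : R * R -> R,
    [/\ H1 ('D_(basis_vec 0) u) g00 g01, H1 ('D_(basis_vec 1) u) g01 g11 &
     H1 (F \o u) (fun z => (g00 z + g11 z) * 'D_(basis_vec 0) u z)
                 (fun z => (g00 z + g11 z) * 'D_(basis_vec 1) u z)].
Proof.
move=> lF uW uC [h0 [h1 [k0 [k1 [[W00 W11] [Wk0 Wk1] Hae]]]]].
have [g00 wg00 /Lloc2_L2l l00] := uW [:: 0; 0] isT.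
have [g01 wg01 /Lloc2_L2l l01] := uW [:: 0; 1] isT.
have [g11 wg11 /Lloc2_L2l l11] := uW [:: 1; 1] isT.
set a := 'D_(basis_vec 0) u; set b := 'D_(basis_vec 1) u.
have ca : continuous a by exact: C1_cont_partial.
have cb : continuous b by exact: C1_cont_partial.
have [a2a a1b] := weak01 uC wg01.
have a1a := weak00 uC wg00; have a2b := weak11 uC wg11.
exists g00, g01, g11; split; [exact: (And5 ca l00 l01 a1a a2a)|exact: (And5 cb l01 l11 a1b a2b)|].
have cFu : continuous (F \o u).
  by move=> z; apply: continuous_comp; [exact: (C1_cont uC)|exact: loclip_cont].
have mh0 : mf2 h0 by have [_ /Lloc1_Llo[]] := W00.
have mh1 : mf2 h1 by have [_ /Lloc1_Llo[]] := W11.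
(* The second derivatives [h0], [h1] of the equation are a priori only locally integrable; they
   agree almost everywhere with the square integrable ones. *)
have e0 := ac1_unique (weak00 uC W00) a1a mh0 l00.1.
have e1 := ac2_unique (weak11 uC W11) a2b mh1 l11.1.
have lG (c : R * R -> R) : continuous c -> L2l (fun z => (g00 z + g11 z) * c z).
  move=> cc; have -> : (fun z => (g00 z + g11 z) * c z) = (fun z => c z * (g00 z + g11 z)).
    by apply/funext => z; rewrite mulrC.
  by apply: L2l_contM => //; exact: L2lD.
apply: (And5 cFu (lG _ ca) (lG _ cb)).
- apply: (ac1_ae (weak0_ac1 cFu Wk0)); first by have [] := lG _ ca.
  apply: ae_imp (ae_and Hae (ae_and e0 e1)) => z [H [E0 E1]].
  by have := congr1 fst H; rewrite /= E0 E1 => <-.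
- apply: (ac2_ae (weak1_ac2 cFu Wk1)); first by have [] := lG _ cb.
  apply: ae_imp (ae_and Hae (ae_and e0 e1)) => z [H [E0 E1]].
  by have := congr1 snd H; rewrite /= E0 E1 => <-.
Qed.

End Interface.

(** * The angle and its truncation *)

Section StrictDiff.
Context {R : realType}.
Implicit Types (G H K : R -> R -> R) (a b : R).

Lemma sd_lipschitz G a b v1 v2 : sd G a b v1 v2 -> forall e : R, 0 < e -> exists2 d : R, 0 < d &
  forall a1 b1 a2 b2, `|a1 - a| < d -> `|b1 - b| < d -> `|a2 - a| < d -> `|b2 - b| < d ->
   `|G a1 b1 - G a2 b2| <= (`|v1| + `|v2| + e) * (`|a1 - a2| + `|b1 - b2|).
Proof.
move=> sG e e0; have [d d0 Hd] := sG e e0; exists d => // a1 b1 a2 b2 h1 h2 h3 h4.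
have := Hd _ _ _ _ h1 h2 h3 h4.
set x := a1 - a2; set y := b1 - b2; set D := G a1 b1 - G a2 b2 => H.
have -> : D = (v1 * x + v2 * y) + (D - (v1 * x + v2 * y)) by ring.
apply: (le_trans (ler_normD _ _)).
have H3 : `|v1 * x + v2 * y| <= `|v1| * `|x| + `|v2| * `|y|.
  by apply: (le_trans (ler_normD _ _)); rewrite !normrM.
have : `|v1 * x + v2 * y| + `|D - (v1 * x + v2 * y)| <= (`|v1| * `|x| + `|v2| * `|y|) + e * (`|x| + `|y|) by exact: lerD.
move/le_trans; apply.
have := mulr_ge0 (normr_ge0 v1) (normr_ge0 y); have := mulr_ge0 (normr_ge0 v2) (normr_ge0 x).
by move: (`|v1|) (`|v2|) (`|x|) (`|y|) => p q r s; clear; lra.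
Qed.

Lemma sd_comp2 K G H a b k1 k2 v1 v2 w1 w2 :
  sd K (G a b) (H a b) k1 k2 -> sd G a b v1 v2 -> sd H a b w1 w2 ->
  sd (fun x y => K (G x y) (H x y)) a b (k1 * v1 + k2 * w1) (k1 * v2 + k2 * w2).
Proof.
move=> sK sG sH e e0.
(* [V] and [W] are Lipschitz constants of [G] and [H] near the point, and [k] bounds the derivatives
   of [K]. Half of [e] pays for the error of [K], half for those of [G] and [H]. *)
pose V := `|v1| + `|v2| + 1; pose W := `|w1| + `|w2| + 1; pose k := `|k1| + `|k2| + 1.
have V0 : 0 < V by rewrite /V; have := normr_ge0 v1; have := normr_ge0 v2; lra.
have W0 : 0 < W by rewrite /W; have := normr_ge0 w1; have := normr_ge0 w2; lra.
have k0 : 0 < k by rewrite /k; have := normr_ge0 k1; have := normr_ge0 k2; lra.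
have e10 : 0 < e / (2 * (V + W)) by rewrite divr_gt0// mulr_gt0// addr_gt0.
have e20 : 0 < e / (2 * k) by rewrite divr_gt0// mulr_gt0.
have [dK dK0 HK] := sK _ e10.
have dK20 : 0 < dK / 2 by rewrite divr_gt0.
have [c1 c10 C1] := sd_continuous sG dK20; have [c2 c20 C2] := sd_continuous sH dK20.
have [l1 l10 L1] := sd_lipschitz sG ltr01; have [l2 l20 L2] := sd_lipschitz sH ltr01.
have [m1 m10 M1] := sG _ e20; have [m2 m20 M2] := sH _ e20.
exists (Num.min (Num.min c1 c2) (Num.min (Num.min l1 l2) (Num.min m1 m2))).
  by rewrite !lt_min c10 c20 l10 l20 m10 m20.
move=> a1 b1 a2 b2; rewrite !lt_min.
move=> /andP[/andP[x1 x2] /andP[/andP[x3 x4] /andP[x5 x6]]].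
move=> /andP[/andP[y1 y2] /andP[/andP[y3 y4] /andP[y5 y6]]].
move=> /andP[/andP[z1 z2] /andP[/andP[z3 z4] /andP[z5 z6]]].
move=> /andP[/andP[t1 t2] /andP[/andP[t3 t4] /andP[t5 t6]]].
have lt2 : dK / 2 < dK by rewrite ltr_pdivrMr// ltr_pMr// ltr1n.
have g1 := le_lt_trans (C1 _ _ x1 y1) lt2; have g2 := le_lt_trans (C1 _ _ z1 t1) lt2.
have h1 := le_lt_trans (C2 _ _ x2 y2) lt2; have h2 := le_lt_trans (C2 _ _ z2 t2) lt2.
have Q1 := HK _ _ _ _ g1 h1 g2 h2.
have Q2 := L1 _ _ _ _ x3 y3 z3 t3; have Q3 := L2 _ _ _ _ x4 y4 z4 t4.
have Q4 := M1 _ _ _ _ x5 y5 z5 t5; have Q5 := M2 _ _ _ _ x6 y6 z6 t6.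
move: Q1 Q2 Q3 Q4 Q5; rewrite -/V -/W.
set x := a1 - a2; set y := b1 - b2; set DG := G a1 b1 - G a2 b2; set DH := H a1 b1 - H a2 b2.
set DK := K _ _ - K _ _; set n := `|x| + `|y| => Q1 Q2 Q3 Q4 Q5.
have -> : DK - ((k1 * v1 + k2 * w1) * x + (k1 * v2 + k2 * w2) * y) =
  (DK - (k1 * DG + k2 * DH)) + (k1 * (DG - (v1 * x + v2 * y)) + k2 * (DH - (w1 * x + w2 * y))) by ring.
apply: (le_trans (ler_normD _ _)).
have n0 : 0 <= n by rewrite addr_ge0.
have B1 : `|DK - (k1 * DG + k2 * DH)| <= e / 2 * n.
  apply: (le_trans Q1).
  have -> : e / 2 * n = e / (2 * (V + W)) * (V * n + W * n) by field; rewrite gt_eqF// addr_gt0.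
  by rewrite ler_pM2l//; exact: lerD.
have B2 : `|k1 * (DG - (v1 * x + v2 * y)) + k2 * (DH - (w1 * x + w2 * y))| <= e / 2 * n.
  apply: (le_trans (ler_normD _ _)); rewrite !normrM.
  have B3 := ler_wpM2l (normr_ge0 k1) Q4; have B4 := ler_wpM2l (normr_ge0 k2) Q5.
  apply: (le_trans (lerD B3 B4)).
  have -> : e / 2 * n = k * (e / (2 * k) * n) by field; rewrite gt_eqF.
  rewrite -mulrDl ler_wpM2r//; first by rewrite mulr_ge0// ltW.
  by rewrite /k lerDl.
apply: (le_trans (lerD B1 B2)); rewrite -mulrDl; apply: ler_wpM2r => //; clear; lra.
Qed.

Lemma mvt_affine (K K' : R -> R) c e x y : x <= y ->
  (forall t : R, x <= t <= y -> is_derive (t : R) 1 K (K' t)) ->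
  (forall t, x <= t <= y -> `|K' t - c| <= e) -> `|K y - K x - c * (y - x)| <= e * `|y - x|.
Proof.
rewrite le_eqVlt => /orP[/eqP -> _ _|xy dK H].
  by rewrite !subrr mulr0 subr0 normr0 mulr0.
have [||t] := @MVT _ K K' x y xy.
- by move=> t; rewrite in_itv/= => /andP[/ltW t1 /ltW t2]; apply: dK; rewrite t1.
- by apply: derivable_within_continuous => t; rewrite in_itv/= => /dK[].
rewrite in_itv/= => /andP[/ltW t1 /ltW t2] ->.
by rewrite -mulrBl normrM ler_wpM2r// H// t1.
Qed.

Lemma mvt_affine_sym (K K' : R -> R) c e x y :
  (forall t : R, Num.min x y <= t <= Num.max x y -> is_derive (t : R) 1 K (K' t)) ->
  (forall t, Num.min x y <= t <= Num.max x y -> `|K' t - c| <= e) -> `|K y - K x - c * (y - x)| <= e * `|y - x|.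
Proof.
move=> dK H; have [xy|/ltW yx] := leP x y.
  by apply: mvt_affine => // t; rewrite -{1}(min_idPl xy) -{2}(max_idPr xy); [exact: dK|exact: H].
rewrite -[X in _ <= _ * X]normrN opprB.
have -> : K y - K x - c * (y - x) = - (K x - K y - c * (x - y)) by ring.
by rewrite normrN; apply: mvt_affine => // t; rewrite -{1}(min_idPr yx) -{2}(max_idPl yx); [exact: dK|exact: H].
Qed.

Lemma between_ball (p q t c d : R) : `|p - c| < d -> `|q - c| < d ->
  Num.min p q <= t <= Num.max p q -> `|t - c| < d.
Proof.
by rewrite !ltr_norml ge_min le_max => /andP[? ?] /andP[? ?] /andP[/orP[?|?] /orP[?|?]]; apply/andP; split; lra.
Qed.

Lemma sd_C1 (K K' : R -> R) (r : R) :
  (exists2 d : R, 0 < d & forall x : R, `|x - r| < d -> is_derive (x : R) 1 K (K' x)) ->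
  {for r, continuous K'} -> forall b, sd (fun x _ => K x) r b (K' r) 0.
Proof.
move=> [d d0 Hd] cK b e e0.
have /cvgrPdist_le/(_ _ e0)[d' /= d'0 Hd'] := cK.
exists (Num.min d d'); first by rewrite lt_min d0.
move=> x b1 y b2; rewrite !lt_min => /andP[xd xd'] _ /andP[yd yd'] _.
rewrite mul0r addr0; apply: (@le_trans _ _ (e * `|x - y|)); last by rewrite ler_wpM2l ?lerDl// ltW.
apply: (@mvt_affine_sym K K') => t ht; first by apply: Hd; exact: between_ball ht.
by rewrite distrC; apply: Hd' => /=; rewrite distrC; exact: between_ball ht.
Qed.

Lemma sd_comp1 (K K' : R -> R) G a b v1 v2 :
  (exists2 d : R, 0 < d & forall x : R, `|x - G a b| < d -> is_derive (x : R) 1 K (K' x)) ->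
  {for G a b, continuous K'} -> sd G a b v1 v2 ->
  sd (fun x y => K (G x y)) a b (K' (G a b) * v1) (K' (G a b) * v2).
Proof.
move=> HK cK sG; have := sd_comp2 (sd_C1 HK cK (G a b)) sG sG.
by rewrite !mul0r !addr0.
Qed.

Lemma sd_eq G a b v1 v2 w1 w2 : sd G a b v1 v2 -> v1 = w1 -> v2 = w2 -> sd G a b w1 w2.
Proof. by move=> + <- <-. Qed.

Lemma sd_fst a b : sd (fun x _ : R => x) a b 1 0.
Proof.
move=> e e0; exists 1 => // a1 b1 a2 b2 _ _ _ _.
by rewrite mul0r addr0 mul1r subrr normr0 mulr_ge0 ?addr_ge0// ltW.
Qed.

Lemma sd_snd a b : sd (fun _ y : R => y) a b 0 1.
Proof.
move=> e e0; exists 1 => // a1 b1 a2 b2 _ _ _ _.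
by rewrite mul0r add0r mul1r subrr normr0 mulr_ge0 ?addr_ge0// ltW.
Qed.

Lemma sd_sqn a b : sd (fun x y : R => x ^+ 2 + y ^+ 2) a b (2 * a) (2 * b).
Proof.
have s1 : sd (fun x _ : R => x * x) a b (2 * a) 0.
  by apply: (sd_eq (sd_comp2 (sd_mul a a) (sd_fst a b) (sd_fst a b))); ring.
have s2 : sd (fun _ y : R => y * y) a b 0 (2 * b).
  by apply: (sd_eq (sd_comp2 (sd_mul b b) (sd_snd a b) (sd_snd a b))); ring.
have := @sd_comp2 (fun x y => 1 * x + 1 * y) (fun x _ => x * x) (fun _ y => y * y) a b _ _ _ _ _ _
    (sd_lin 1 1 (a * a) (b * b)) s1 s2.
have -> : (fun x y : R => 1 * (x * x) + 1 * (y * y)) = (fun x y => x ^+ 2 + y ^+ 2).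
  by apply/funext => x; apply/funext => y; ring.
by move=> /sd_eq; apply; ring.
Qed.

Lemma sd_near G H a b v1 v2 : (exists2 d : R, 0 < d & forall x y, `|x - a| < d -> `|y - b| < d -> G x y = H x y) ->
  sd G a b v1 v2 -> sd H a b v1 v2.
Proof.
move=> [d d0 E] sG e e0; have [d' d'0 Hd'] := sG e e0.
exists (Num.min d d'); first by rewrite lt_min d0.
move=> a1 b1 a2 b2; rewrite !lt_min => /andP[? ?] /andP[? ?] /andP[? ?] /andP[? ?].
by rewrite -!E//; exact: Hd'.
Qed.

Variables (d1 d2 : R) (d_unit : d1 ^+ 2 + d2 ^+ 2 = 1).

(* Tangent half-angle formula: [Theta a b] is half the angle of [(a, b)] measured
   from [- (d1, d2)], up to orientation; the denominator vanishes only in the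
   direction [(d1, d2)]. *)
Definition ang_den a b := Num.sqrt (a ^+ 2 + b ^+ 2) + (- d1 * a + - d2 * b).
Definition Theta a b := atan ((d2 * a + - d1 * b) * (ang_den a b)^-1).

(** The derivative is half that of the polar angle, so along the gradient field
    [grad (Theta (a, b)) = V / (2 * q)]. *)
Lemma Theta_sd a b : 0 < a ^+ 2 + b ^+ 2 -> 0 < ang_den a b ->
  sd Theta a b (- b / (2 * (a ^+ 2 + b ^+ 2))) (a / (2 * (a ^+ 2 + b ^+ 2))).
Proof.
move=> q0 D0.
have s1 : sd (fun x y => Num.sqrt (x ^+ 2 + y ^+ 2)) a b
    ((2 * Num.sqrt (a ^+ 2 + b ^+ 2))^-1 * (2 * a)) ((2 * Num.sqrt (a ^+ 2 + b ^+ 2))^-1 * (2 * b)).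
  apply: (@sd_comp1 Num.sqrt (fun r => (2 * Num.sqrt r)^-1) _ a b _ _ _ _ (sd_sqn a b)).
    exists (a ^+ 2 + b ^+ 2) => // x; rewrite ltr_norml => /andP[x1 _].
    by apply: is_derive1_sqrt; lra.
  apply: cvgV; first by rewrite mulf_neq0// gt_eqF// sqrtr_gt0.
  by apply: cvgM; [exact: cvg_cst|exact: sqrt_continuous].
have s2 := @sd_comp2 (fun x y => 1 * x + 1 * y) (fun x y => Num.sqrt (x ^+ 2 + y ^+ 2))
    (fun x y => - d1 * x + - d2 * y) a b _ _ _ _ _ _ (sd_lin 1 1 (Num.sqrt (a ^+ 2 + b ^+ 2)) (- d1 * a + - d2 * b)) s1 (sd_lin (- d1) (- d2) a b).
have s3 : sd ang_den a b ((2 * Num.sqrt (a ^+ 2 + b ^+ 2))^-1 * (2 * a) - d1) ((2 * Num.sqrt (a ^+ 2 + b ^+ 2))^-1 * (2 * b) - d2).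
  apply: (@sd_near (fun x y => 1 * Num.sqrt (x ^+ 2 + y ^+ 2) + 1 * (- d1 * x + - d2 * y))).
    by exists 1 => // x y _ _; rewrite /ang_den !mul1r.
  by apply: (sd_eq s2); ring.
have s4 : sd (fun x y => (ang_den x y)^-1) a b
   (- (ang_den a b) ^- 2 * ((2 * Num.sqrt (a ^+ 2 + b ^+ 2))^-1 * (2 * a) - d1))
   (- (ang_den a b) ^- 2 * ((2 * Num.sqrt (a ^+ 2 + b ^+ 2))^-1 * (2 * b) - d2)).
  apply: (@sd_comp1 (fun r : R => r^-1) (fun r : R => - r ^- 2) _ a b _ _ _ _ s3).
    exists (ang_den a b) => // x; rewrite ltr_norml => /andP[x1 _].
    have xn0 : x != 0 by rewrite gt_eqF//; lra.
    apply: DeriveDef; first by apply: derivableV => //; exact: derivable_id.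
    by rewrite deriveV// derive_id /GRing.scale/= mulr1.
  apply: cvgN; apply: cvgV; first by rewrite expf_neq0// gt_eqF.
  by rewrite expr2; apply: cvgM; exact: cvg_id.
have s5 := @sd_comp2 (fun x y => x * y) (fun x y => d2 * x + - d1 * y) (fun x y => (ang_den x y)^-1) a b _ _ _ _ _ _
    (sd_mul (d2 * a + - d1 * b) (ang_den a b)^-1) (sd_lin d2 (- d1) a b) s4.
have atanD : exists2 d : R, 0 < d & forall x : R, `|x - (d2 * a + - d1 * b) * (ang_den a b)^-1| < d ->
    is_derive (x : R) 1 (@atan R) (1 + x ^+ 2)^-1.
  by exists 1 => // x _; exact: is_derive1_atan.
have atanC : {for (d2 * a + - d1 * b) * (ang_den a b)^-1, continuous (fun r : R => (1 + r ^+ 2)^-1)}.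
  apply: cvgV; first by rewrite gt_eqF// ltr_wpDr// sqr_ge0.
  by apply: cvgD; [exact: cvg_cst|exact: exprn_continuous].
have s6 := @sd_comp1 (@atan R) (fun r : R => (1 + r ^+ 2)^-1)
  (fun x y => (d2 * x + - d1 * y) * (ang_den x y)^-1) a b _ _ atanD atanC s5.
set r := Num.sqrt (a ^+ 2 + b ^+ 2) in s5 s6.
have r0 : 0 < r by rewrite sqrtr_gt0.
have rq : a ^+ 2 + b ^+ 2 = r ^+ 2 by rewrite sqr_sqrtr// ltW.
set D := ang_den a b in D0 s5 s6; set N := d2 * a + - d1 * b in s5 s6.
have DE : D = r - (d1 * a + d2 * b) by rewrite /D /ang_den -/r; ring.
(* With [c] the component along [(d1, d2)], [D = r - c] and [c^2 + N^2 = r^2]. This identity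
   simplifies the derivative of the arctangent of [N / D]. *)
have DN : D ^+ 2 + N ^+ 2 = 2 * r * D.
  have E : (d1 * a + d2 * b) ^+ 2 + N ^+ 2 = r ^+ 2.
    by rewrite -rq -[RHS]mul1r -d_unit /N; ring.
  rewrite DE.
  have -> : (r - (d1 * a + d2 * b)) ^+ 2 + N ^+ 2 = r ^+ 2 - 2 * r * (d1 * a + d2 * b) + ((d1 * a + d2 * b) ^+ 2 + N ^+ 2) by ring.
  by rewrite E; ring.
have T : (1 + (N * D^-1) ^+ 2)^-1 = D / (2 * r).
  have -> : 1 + (N * D^-1) ^+ 2 = (D ^+ 2 + N ^+ 2) / D ^+ 2 by field; rewrite gt_eqF.
  by rewrite DN; field; rewrite !gt_eqF.
have b2 : b ^+ 2 = r ^+ 2 - a ^+ 2 by rewrite -rq; ring.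
have dd : d1 ^+ 2 = 1 - d2 ^+ 2 by rewrite -d_unit; ring.
have P1 : d2 * D * r - N * (a - d1 * r) = - b * D.
  have : d2 * D * r - N * (a - d1 * r) + b * D =
     d2 * (r ^+ 2 - (a ^+ 2 + b ^+ 2)) + b * r * (1 - (d1 ^+ 2 + d2 ^+ 2)) by rewrite DE /N; ring.
  by rewrite rq d_unit !subrr !mulr0 addr0 => H; rewrite -[RHS]add0r -H; ring.
have P2 : - d1 * D * r - N * (b - d2 * r) = a * D.
  have : - d1 * D * r - N * (b - d2 * r) - a * D =
     - d1 * (r ^+ 2 - (a ^+ 2 + b ^+ 2)) - a * r * (1 - (d1 ^+ 2 + d2 ^+ 2)) by rewrite DE /N; ring.
  by rewrite rq d_unit !subrr !mulr0 subr0 => H; rewrite -[RHS]add0r -H; ring.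
apply: (sd_eq s6); rewrite T rq.
- have -> : D / (2 * r) * (D^-1 * d2 + N * (- D ^- 2 * ((2 * r)^-1 * (2 * a) - d1))) =
    (d2 * D * r - N * (a - d1 * r)) / (2 * r ^+ 2 * D) by field; rewrite !gt_eqF.
  by rewrite P1; field; rewrite !gt_eqF.
- have -> : D / (2 * r) * (D^-1 * - d1 + N * (- D ^- 2 * ((2 * r)^-1 * (2 * b) - d2))) =
    (- d1 * D * r - N * (b - d2 * r)) / (2 * r ^+ 2 * D) by field; rewrite !gt_eqF.
  by rewrite P2; field; rewrite !gt_eqF.
Qed.

Lemma Theta_le2 a b : `|Theta a b| <= 2.
Proof.
rewrite ler_norml /Theta; set t := (X in atan X).
have := atan_ltpi2 t; have := atan_gtNpi2 t; have H := @pihalf_lt2 R.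
by move: H; move: (atan t) (pi : R) => x p ? ? ?; apply/andP; split; lra.
Qed.

(** Equal to 0 where [q <= e] and to 1 where [q >= 2 * e]. [Chi'] is only the outer factor of the
    derivative; [Chi_sd] supplies the inner ones [2 * a / e] and [2 * b / e]. *)
Definition Chi (e a b : R) := step ((a ^+ 2 + b ^+ 2) / e - 1).
Definition Chi' (e a b : R) := step' ((a ^+ 2 + b ^+ 2) / e - 1).

Lemma Chi_sd e a b : 0 < e -> sd (Chi e) a b (Chi' e a b * (2 * a / e)) (Chi' e a b * (2 * b / e)).
Proof.
move=> e0.
have s1 : sd (fun x y => (x ^+ 2 + y ^+ 2) / e - 1) a b (2 * a / e) (2 * b / e).
  have := sd_comp1 (K := fun r => r / e - 1) (K' := fun=> e^-1) _ _ (sd_sqn a b).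
  move=> H; apply: (sd_eq (H _ _)); try by rewrite mulrC.
    exists 1 => // x _; apply/is_derive_eps => e' e'0; exists 1 => // y _.
    have -> : y / e - 1 - (x / e - 1) - e^-1 * (y - x) = 0 by ring.
    by rewrite normr0 mulr_ge0// ltW.
  exact: cvg_cst.
apply: (@sd_comp1 step step' _ a b _ _ _ _ s1).
  by exists 1 => [|x _]; [exact: ltr01|exact: (smooth_derive step_smooth)].
exact: (smooth_cont (smooth_derive1 step_smooth)).
Qed.

(** The truncated half-angle and its two partial derivatives. Where the gradient vanishes the junk
    values of [Theta] and of the quotients are multiplied by [Chi = Chi' = 0], so the formulas hold
    there too. *)
Definition TT e a b := Chi e a b * Theta a b.
Definition TT1 e a b := Theta a b * (Chi' e a b * (2 * a / e)) + Chi e a b * (- b / (2 * (a ^+ 2 + b ^+ 2))).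
Definition TT2 e a b := Theta a b * (Chi' e a b * (2 * b / e)) + Chi e a b * (a / (2 * (a ^+ 2 + b ^+ 2))).

Lemma Chi_small e a b : 0 < e -> a ^+ 2 + b ^+ 2 <= e -> Chi e a b = 0 /\ Chi' e a b = 0.
Proof.
move=> e0 qe; have h : (a ^+ 2 + b ^+ 2) / e - 1 <= 0 by rewrite subr_le0 ler_pdivrMr// mul1r.
by split; [exact: step_le0|apply: step'_out; rewrite negb_and -leNgt h].
Qed.

Lemma Chi_large e a b : 0 < e -> 2 * e <= a ^+ 2 + b ^+ 2 -> Chi e a b = 1 /\ Chi' e a b = 0.
Proof.
move=> e0 qe; have h : 1 <= (a ^+ 2 + b ^+ 2) / e - 1 by rewrite lerBrDr ler_pdivlMr// -[1 + 1]/(2).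
by split; [exact: step_ge1|apply: step'_out; rewrite negb_and -!leNgt h orbT].
Qed.

Lemma sqn_near a b e : 0 < e -> exists2 d : R, 0 < d & forall x y, `|x - a| < d -> `|y - b| < d ->
  `|(x ^+ 2 + y ^+ 2) - (a ^+ 2 + b ^+ 2)| <= e.
Proof. exact: (sd_continuous (sd_sqn a b)). Qed.

(** [TT] vanishes identically nearby. This covers the zeros of the gradient, where [Theta] itself
    has no derivative. *)
Lemma TT_sd_small e a b : 0 < e -> a ^+ 2 + b ^+ 2 < e -> sd (TT e) a b (TT1 e a b) (TT2 e a b).
Proof.
move=> e0 qe.
have [c1 c2] := Chi_small e0 (ltW qe).
have ez : 0 < (e - (a ^+ 2 + b ^+ 2)) / 2 by rewrite divr_gt0// subr_gt0.
have [d d0 Hd] := sqn_near a b ez.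
apply: (@sd_near (fun _ _ => 0)).
  exists d => // x y xd yd; rewrite /TT.
  have qxy : x ^+ 2 + y ^+ 2 <= e.
    by have := Hd x y xd yd; rewrite ler_norml => /andP[_ h]; move: h qe; clear; lra.
  by have [-> _] := Chi_small e0 qxy; rewrite mul0r.
apply: (@sd_eq _ _ _ 0 0); try by rewrite /TT1 /TT2 c1 c2 !mul0r mulr0 addr0.
by move=> e' e'0; exists 1 => // *; rewrite !mul0r addr0 !subrr normr0 mulr_ge0 ?addr_ge0// ltW.
Qed.

Lemma TT_sd e a b : 0 < e -> (0 < a ^+ 2 + b ^+ 2 -> 0 < ang_den a b) ->
  sd (TT e) a b (TT1 e a b) (TT2 e a b).
Proof.
move=> e0 HD; have [qe|qe] := ltP (a ^+ 2 + b ^+ 2) e; first exact: TT_sd_small.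
have q0 : 0 < a ^+ 2 + b ^+ 2 by exact: lt_le_trans qe.
exact: (@sd_comp2 (fun x y => x * y) (Chi e) Theta a b _ _ _ _ _ _ (sd_mul (Chi e a b) (Theta a b)) (Chi_sd a b e0) (Theta_sd q0 (HD q0))).
Qed.

Lemma ang_den_near a b : 0 < a ^+ 2 + b ^+ 2 -> 0 < ang_den a b ->
  exists2 d : R, 0 < d & forall x y, `|x - a| < d -> `|y - b| < d -> 0 < x ^+ 2 + y ^+ 2 /\ 0 < ang_den x y.
Proof.
move=> q0 D0.
have q20 : 0 < (a ^+ 2 + b ^+ 2) / 2 by rewrite divr_gt0.
have [d d0 Hd] := sqn_near a b q20.
have cs : continuous (fun z : R * R => ang_den z.1 z.2).
  move=> z; apply: cvgD.
    apply: (@continuous_comp _ _ _ (fun z : R * R => z.1 ^+ 2 + z.2 ^+ 2) Num.sqrt); last exact: sqrt_continuous.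
    by apply: cvgD; apply: (@continuous_comp _ _ _ _ (fun r : R => r ^+ 2)); first [exact: cvg_fst|exact: cvg_snd|exact: exprn_continuous].
  by apply: cvgD; apply: cvgM; first [exact: cvg_cst|exact: cvg_fst|exact: cvg_snd].
have D20 : 0 < ang_den a b / 2 by rewrite divr_gt0.
have [r r0 Hr] := @cont2_near _ _ a b _ cs D20.
exists (Num.min d r); first by rewrite lt_min d0.
move=> x y; rewrite !lt_min => /andP[xd xr] /andP[yd yr]; split.
  by have := Hd x y xd yd; rewrite ler_norml => /andP[h _]; move: h q0; lra.
by have := Hr x y xr yr; rewrite /= ler_norml => /andP[h _]; move: h D0; lra.
Qed.

End StrictDiff.

(** * Caccioppoli inequality *)

Section Plateau.
Context {R : realType}.

(** A plateau: 1 on [[-L, L]], 0 outside [[-2L, 2L]], with slope of order [1/L]. *)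
Definition pl (L x : R) : R := step (- L^-1 * x + 2) * step (L^-1 * x + 2).
Definition pl' L := (pl L)^`()%classic.

Lemma pl_smooth L : smooth (pl L).
Proof. by move=> k; apply: smM; apply: sm_affine; exact: step_smooth. Qed.

Lemma pl'E L x : pl' L x = (- L^-1 * step' (- L^-1 * x + 2)) * step (L^-1 * x + 2) +
  step (- L^-1 * x + 2) * (L^-1 * step' (L^-1 * x + 2)).
Proof.
have aff (p : R) : is_derive (x : R) 1 (fun x => step (p * x + 2)) (p * step' (p * x + 2)).
  have dp : is_derive (x : R) 1 (fun x : R => p * x + 2) p.
    apply/is_derive_eps => e e0; exists 1 => // y _.
    have -> : p * y + 2 - (p * x + 2) - p * (y - x) = 0 by ring.
    by rewrite normr0 mulr_ge0// ltW.
  have := @is_derive1_comp _ step (fun x : R => p * x + 2) x _ _ (smooth_derive step_smooth (p * x + 2)) dp.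
  by move=> /is_derive_eq; apply; rewrite mulrC.
rewrite /pl' derive1E; have [_ ->] := is_deriveM (aff (- L^-1)) (aff L^-1).
by rewrite /GRing.scale/= addrC; congr (_ + _); rewrite mulrC.
Qed.

Lemma pl_in L x : 0 < L -> `|x| <= L -> pl L x = 1 /\ pl' L x = 0.
Proof.
move=> L0; rewrite ler_norml => /andP[x1 x2].
have h1 : 1 <= - L^-1 * x + 2.
  have : L^-1 * x <= 1 by rewrite ler_pdivrMl// mulr1.
  by rewrite mulNr; move: (L^-1 * x) => t; lra.
have h2 : 1 <= L^-1 * x + 2.
  have : - 1 <= L^-1 * x by rewrite ler_pdivlMl// mulrN1.
  by move: (L^-1 * x) => t; lra.
rewrite pl'E /pl !step_ge1// !step'_out; last 2 first.
- by rewrite negb_and -!leNgt h2 orbT.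
- by rewrite negb_and -!leNgt h1 orbT.
by rewrite !(mulr0, mul0r, mulr1, addr0).
Qed.

Lemma pl_out L x : 0 < L -> 2 * L <= `|x| -> pl L x = 0 /\ pl' L x = 0.
Proof.
move=> L0; rewrite pl'E /pl ler_normr => /orP[x1|x1].
  have h1 : - L^-1 * x + 2 <= 0.
    have : 2 <= L^-1 * x by rewrite ler_pdivlMl// mulrC.
    by rewrite mulNr; move: (L^-1 * x) => t; lra.
  rewrite step_le0// (@step'_out _ (- L^-1 * x + 2)); last by rewrite negb_and -!leNgt h1.
  by rewrite !(mulr0, mul0r, addr0).
have h1 : L^-1 * x + 2 <= 0.
  have : 2 <= L^-1 * - x by rewrite ler_pdivlMl// mulrC.
  by rewrite mulrN; move: (L^-1 * x) => t; lra.
rewrite [step (L^-1 * x + 2)]step_le0// (@step'_out _ (L^-1 * x + 2)); last by rewrite negb_and -!leNgt h1.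
by rewrite !(mulr0, mul0r, addr0).
Qed.

Lemma pl_ge0 L x : 0 <= pl L x. Proof. by rewrite mulr_ge0 ?step_ge0. Qed.
Lemma pl_le1 L x : pl L x <= 1. Proof. by rewrite mulr_ile1 ?step_ge0 ?step_le1. Qed.

Lemma pl'_bound M L x : 0 < L -> (forall y : R, `|step' y| <= M) -> `|pl' L x| <= 2 * M / L.
Proof.
move=> L0 HM; rewrite pl'E; apply: (le_trans (ler_normD _ _)).
have M0 : 0 <= M by exact: le_trans (HM 0).
have L'0 : 0 <= L^-1 by rewrite invr_ge0 ltW.
have s1 (y : R) : `|step y| <= 1 by rewrite ger0_norm ?step_ge0 ?step_le1.
have -> : 2 * M / L = (L^-1 * M) * 1 + 1 * (L^-1 * M) by ring.
apply: lerD; rewrite normrM; apply: ler_pM => //; rewrite normrM ?normrN (ger0_norm L'0);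
  exact: ler_wpM2l.
Qed.

Lemma tensor_H1 (b c : R -> R) : smooth b -> smooth c ->
  [/\ H1 (fun z : R * R => b z.1 * c z.2) (fun z => b^`()%classic z.1 * c z.2) (fun z => b z.1 * c^`()%classic z.2),
   continuous (fun z : R * R => b z.1 * c z.2),
   continuous (fun z : R * R => b^`()%classic z.1 * c z.2) & continuous (fun z : R * R => b z.1 * c^`()%classic z.2)].
Proof.
move=> sb sc.
have c0 := tensor_cont sb sc; have c1 := tensor_cont (smooth_derive1 sb) sc.
have c2 := tensor_cont sb (smooth_derive1 sc).
split => //; split => //; [exact: cont_L2l|exact: cont_L2l| |exact: tensor_ac2].
have := tensor_ac2 c sb; rewrite /ac1.
have -> : (fun z : R * R => b z.1 * c z.2) \o sw = (fun z : R * R => c z.1 * b z.2).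
  by apply/funext => z /=; rewrite mulrC.
by have -> : (fun z : R * R => b^`()%classic z.1 * c z.2) \o sw = (fun z : R * R => c z.1 * b^`()%classic z.2);
  first by apply/funext => z /=; rewrite mulrC.
Qed.

End Plateau.

(** * Testing with the truncated angle *)

Section Caccioppoli.
Context {R : realType}.
Notation L2 := (@lebesgue2 R).
Variables (d1 d2 : R) (d_unit : d1 ^+ 2 + d2 ^+ 2 = 1).

(** Young's inequality with the weight that spends half of the coercive term [y^2 |p|^2 / (2 * q)];
    the bound 2 on the angle then gives the constant 16. Multiplied by [4 * q], the difference of
    the two sides is two completed squares plus a term with factor [4 - T^2]. *)
Lemma caccio_cross (q T E w y y1 y2 p1 p2 : R) : 0 < q -> `|T| <= 2 ->
  - (2 * T * y * (p2 * y1 - p1 * y2)) <= y ^+ 2 * (p1 ^+ 2 + p2 ^+ 2) / (4 * q) + 16 * q * (y1 ^+ 2 + y2 ^+ 2).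
Proof.
move=> q0 T2.
have T4 : T ^+ 2 <= 4.
  have -> : 4 = 2 ^+ 2 :> R by ring.
  by rewrite -real_normK ?num_real// lerXn2r// ?nnegrE.
have q40 : 0 < 4 * q by rewrite mulr_gt0.
rewrite -subr_ge0 -(pmulr_rge0 _ q40).
have -> : (4 * q) * (y ^+ 2 * (p1 ^+ 2 + p2 ^+ 2) / (4 * q) + 16 * q * (y1 ^+ 2 + y2 ^+ 2) - - (2 * T * y * (p2 * y1 - p1 * y2)))
  = (y * p2 + 4 * q * T * y1) ^+ 2 + (y * p1 - 4 * q * T * y2) ^+ 2 + 16 * q ^+ 2 * (4 - T ^+ 2) * (y1 ^+ 2 + y2 ^+ 2).
  by field; rewrite gt_eqF.
by rewrite !addr_ge0 ?sqr_ge0// mulr_ge0 ?addr_ge0 ?sqr_ge0// mulr_ge0 ?subr_ge0// mulr_ge0 ?sqr_ge0.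
Qed.

(* The integrand of the null Lagrangian of [P] and [eta^2 * TT e (a, b)]. *)
Definition caccio_J e (a b h0 m h1 y y1 y2 : R) :=
  (a * m - h0 * b) * (TT d1 d2 e a b * (y * y1 + y * y1) + y * y * (TT1 d1 d2 e a b * h0 + TT2 d1 d2 e a b * m))
  - (b * m - h1 * a) * (TT d1 d2 e a b * (y * y2 + y * y2) + y * y * (TT1 d1 d2 e a b * m + TT2 d1 d2 e a b * h1)).

(** The integrand [caccio_J] splits into a coercive term with factor [1 / (2 * q)], a cross term
    with the gradient of the cutoff [y], and a term with [Chi']. The last one lives on
    [e < q < 2 * e] and is bounded there independently of [e]. *)
Lemma caccio_pt (e M a b h0 m h1 y y1 y2 : R) : 0 < e -> (forall x : R, `|step' x| <= M) ->
  y ^+ 2 * (Chi e a b * ((b * m - h1 * a) ^+ 2 + (a * m - h0 * b) ^+ 2)) / (4 * (a ^+ 2 + b ^+ 2)) <=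
  caccio_J e a b h0 m h1 y y1 y2 + 16 * (a ^+ 2 + b ^+ 2) * (y1 ^+ 2 + y2 ^+ 2) +
  4 * M * (y ^+ 2 * (h0 ^+ 2 + 2 * m ^+ 2 + h1 ^+ 2)) * ((e < a ^+ 2 + b ^+ 2) && (a ^+ 2 + b ^+ 2 < 2 * e))%:R.
Proof.
move=> e0 HM.
have M0 : 0 <= M by exact: le_trans (HM 0).
set p1 := b * m - h1 * a; set p2 := a * m - h0 * b; set q := a ^+ 2 + b ^+ 2.
set D2 := h0 ^+ 2 + 2 * m ^+ 2 + h1 ^+ 2; set G := y1 ^+ 2 + y2 ^+ 2.
have D20 : 0 <= D2 by apply: addr_ge0; [apply: addr_ge0; [|apply: mulr_ge0 => //]|]; exact: sqr_ge0.
have G0 : 0 <= G by rewrite addr_ge0 ?sqr_ge0.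
have q0 : 0 <= q by rewrite addr_ge0 ?sqr_ge0.
have yD0 : 0 <= y ^+ 2 * D2 by rewrite mulr_ge0 ?sqr_ge0.
have R1 : 0 <= 16 * q * G by rewrite !mulr_ge0.
have R2 (i : bool) : 0 <= 4 * M * (y ^+ 2 * D2) * i%:R.
  by apply: mulr_ge0; [apply: mulr_ge0 => //; exact: mulr_ge0|exact: ler0n].
have [qe|qe] := leP q e.
  have [c1 c2] := Chi_small e0 qe.
  rewrite /caccio_J /TT /TT1 /TT2 c1 c2 !(mul0r, mulr0, addr0) subr0 add0r.
  exact: R1.
have {}q0 : 0 < q by exact: lt_trans qe.
set T := Theta d1 d2 a b; have T2 : `|T| <= 2 by exact: Theta_le2.
set X := Chi e a b; set X' := Chi' e a b.
(* The factor multiplying [Chi']: the pairing of [(p1, p2)] with the derivatives of [q]. *)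
set S := 2 * (p2 * (a * h0 + b * m) - p1 * (a * m + b * h1)).
have JE : caccio_J e a b h0 m h1 y y1 y2 =
   y ^+ 2 * (T * X' * S / e) + (y ^+ 2 * X * (p1 ^+ 2 + p2 ^+ 2) / (2 * q) + X * (2 * T * y * (p2 * y1 - p1 * y2))).
  by rewrite /caccio_J /TT /TT1 /TT2 -/T -/X -/X' -/q /S /p1 /p2; field; rewrite !gt_eqF.
have X01 : 0 <= X <= 1 by rewrite step_ge0 step_le1.
have /andP[X0 X1] := X01.
have C1 := @caccio_cross q T 0 0 y y1 y2 p1 p2 q0 T2.
have C2 : - (X * (2 * T * y * (p2 * y1 - p1 * y2))) <= X * (y ^+ 2 * (p1 ^+ 2 + p2 ^+ 2) / (4 * q)) + 16 * q * G.
  rewrite -mulrN; apply: (le_trans (ler_wpM2l X0 C1)); rewrite mulrDr lerD2l.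
  by rewrite -[leRHS]mul1r ler_wpM2r.
have S1 : `|S| <= q * D2.
  have e1 : q * D2 - S = (p2 - (a * h0 + b * m)) ^+ 2 + (p1 + (a * m + b * h1)) ^+ 2.
    by rewrite /q /D2 /S /p1 /p2; ring.
  have e2 : q * D2 + S = (p2 + (a * h0 + b * m)) ^+ 2 + (p1 - (a * m + b * h1)) ^+ 2.
    by rewrite /q /D2 /S /p1 /p2; ring.
  rewrite ler_norml -subr_ge0 opprK addrC e2 addr_ge0 ?sqr_ge0//=.
  by rewrite -subr_ge0 e1 addr_ge0 ?sqr_ge0.
(* On the transition set [|T| <= 2], [|X'| <= M] and [|S| <= q * D2 <= 2 * e * D2], so the
   denominator [e] cancels and leaves [4 * M]. *)
have C3 : - (y ^+ 2 * (T * X' * S / e)) <= 4 * M * (y ^+ 2 * D2) * ((e < q) && (q < 2 * e))%:R.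
  rewrite qe/=; have [q2|q2] := ltP q (2 * e); last first.
    by have [_ c2] := Chi_large e0 q2; rewrite /X' c2 !(mulr0, mul0r) oppr0.
  rewrite mulr1; apply: (le_trans (ler_norm _)); rewrite normrN normrM (ger0_norm (sqr_ge0 y)).
  have -> : 4 * M * (y ^+ 2 * D2) = y ^+ 2 * (4 * M * D2) by ring.
  apply: ler_wpM2l; first exact: sqr_ge0.
  rewrite normrM normrM normrM normfV (gtr0_norm e0) ler_pdivrMr//.
  have B1 : `|T| * `|X'| * `|S| <= 2 * M * (q * D2).
    have B0 : `|T| * `|X'| <= 2 * M := ler_pM (normr_ge0 T) (normr_ge0 X') T2 (HM _).
    exact: (ler_pM (mulr_ge0 (normr_ge0 T) (normr_ge0 X')) (normr_ge0 S) B0 S1).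
  apply: (le_trans B1).
  have -> : 4 * M * D2 * e = 2 * M * (2 * e * D2) by ring.
  by apply: ler_wpM2l; [exact: mulr_ge0|apply: ler_wpM2r => //; exact: ltW].
rewrite JE.
have -> : y ^+ 2 * (X * (p1 ^+ 2 + p2 ^+ 2)) / (4 * q) =
  y ^+ 2 * X * (p1 ^+ 2 + p2 ^+ 2) / (2 * q) - X * (y ^+ 2 * (p1 ^+ 2 + p2 ^+ 2) / (4 * q)).
  by field; rewrite gt_eqF.
move: C2 C3; rewrite qe; clear; move: (X * (2 * T * y * _)) (y ^+ 2 * (T * _ * _ / _)) (X * (y ^+ 2 * _ / _)) (y ^+ 2 * X * _ / _) (16 * q * G) (4 * M * _ * _) => u v w x r s.
by lra.
Qed.

Variables (a b P g00 g01 g11 : R * R -> R).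
Hypotheses (Ha : H1 a g00 g01) (Hb : H1 b g01 g11)
  (HP : H1 P (fun z => b z * g01 z - g11 z * a z) (fun z => a z * g01 z - g00 z * b z))
  (Hang : forall z, 0 < a z ^+ 2 + b z ^+ 2 -> 0 < ang_den d1 d2 (a z) (b z)).

Let TT_near e : 0 < e -> forall z, exists2 d : R, 0 < d &
  forall x y, `|x - a z| < d -> `|y - b z| < d -> sd (TT d1 d2 e) x y (TT1 d1 d2 e x y) (TT2 d1 d2 e x y).
Proof.
move=> e0 z; have [qe|qe] := ltP (a z ^+ 2 + b z ^+ 2) e.
  have ez : 0 < (e - (a z ^+ 2 + b z ^+ 2)) / 2 by rewrite divr_gt0// subr_gt0.
  have [d d0 Hd] := sqn_near (a z) (b z) ez.
  exists d => // x y xd yd; apply: TT_sd_small => //.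
  by have := Hd x y xd yd; rewrite ler_norml => /andP[_ h]; move: h qe; set A := x ^+ 2 + y ^+ 2; set B := a z ^+ 2 + _; move: A B => A B; lra.
have q0 := lt_le_trans e0 qe.
have [d d0 Hd] := ang_den_near q0 (Hang q0).
by exists d => // x y xd yd; apply: TT_sd => // _; have [] := Hd _ _ xd yd.
Qed.

Lemma TT_H1 e : 0 < e -> H1 (fun z => TT d1 d2 e (a z) (b z))
  (fun z => TT1 d1 d2 e (a z) (b z) * g00 z + TT2 d1 d2 e (a z) (b z) * g01 z)
  (fun z => TT1 d1 d2 e (a z) (b z) * g01 z + TT2 d1 d2 e (a z) (b z) * g11 z).
Proof. by move=> e0; exact: (H1_sd Ha Hb (TT_near e0)). Qed.

Let q z := a z ^+ 2 + b z ^+ 2.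
(** This is [|grad P|^2], and also [|V|^2], as [V] is the gradient of [P] turned by a right
    angle. *)
Let E z := (b z * g01 z - g11 z * a z) ^+ 2 + (a z * g01 z - g00 z * b z) ^+ 2.

Lemma ChiE_integrable m e0 (k : R) :
  L2.-integrable setT (EFin \o (fun z => k * (\1_(box m) z * (Chi e0 (a z) (b z) * E z)))).
Proof.
have [ca _ _ _ _] := Ha; have [cb _ _ _ _] := Hb; have [_ lp1 lp2 _ _] := HP.
have lE : Llo E by apply: LloD; exact: L2l_sqr.
have cChi : continuous (fun z => Chi e0 (a z) (b z)).
  move=> z; apply: (@continuous_comp _ _ _ (fun z => q z / e0 - 1) step); last exact: (smooth_cont step_smooth).
  have cq : continuous q by apply: contD; exact: contX2.
  by apply: cvgB; [apply: cvgM; [exact: cq|exact: cvg_cst]|exact: cvg_cst].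
have mChi : mf2 (fun z => \1_(box m) z * (Chi e0 (a z) (b z) * E z)).
  apply: mf2M; first by apply: measurable_indic; exact: box_measurable.
  by apply: mf2M; [exact: cont_mf2|case: lE].
apply: (@csupp_integrable _ m); last first.
  by move=> z zm; rewrite indicE memNset// mul0r mulr0.
apply: LloZ; apply: (Llo_le mChi) lE => z.
have c01 : 0 <= Chi e0 (a z) (b z) <= 1 by rewrite step_ge0 step_le1.
have i01 : 0 <= (\1_(box m) z : R) <= 1 by rewrite indicE ler0n lern1 leq_b1.
move: (Chi e0 (a z) (b z)) (\1_(box m) z) c01 i01 => c i /andP[c0 c1] /andP[i0 i1].
rewrite normrM normrM mulrA -[leRHS]mul1r; apply: ler_wpM2r => //.
by rewrite (ger0_norm c0) (ger0_norm i0) mulr_ile1.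
Qed.

(** The null Lagrangian is applied to [P] and [eta^2] times the angle truncated at level [ek k]. The
    level [e0] on the left stays fixed while [ek k] tends to 0, so the error of the truncation
    disappears from the estimate. *)
Lemma caccioppoli n m (eta eta1 eta2 : R * R -> R) Q e0 :
  H1 eta eta1 eta2 -> continuous eta1 -> continuous eta2 ->
  csupp n eta -> csupp n eta1 -> csupp n eta2 ->
  (forall z, box m z -> eta z = 1) -> (forall z, box m z -> q z <= Q) -> 0 < Q -> 0 < e0 ->
  \int[L2]_z ((4 * Q)^-1 * (\1_(box m) z * (Chi e0 (a z) (b z) * E z))) <=
  \int[L2]_z (16 * q z * (eta1 z ^+ 2 + eta2 z ^+ 2)).
Proof.
move=> Heta ce1 ce2 se se1 se2 eta1m qQ Q0 e00.
have [ceta _ _ _ _] := Heta; have [ca la1 la2 _ _] := Ha; have [cb lb1 lb2 _ _] := Hb.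
have [cP lp1 lp2 _ _] := HP.
have [M M0 HM] := @step'_bound R.
(* Since [2 * ek k <= e0], the cutoff [Chi (ek k)] is 1 wherever [Chi e0] is not 0. *)
pose ek k : R := e0 / 2 * k.+1%:R^-1.
have ek0 k : 0 < ek k by rewrite mulr_gt0 ?divr_gt0 ?invr_gt0 ?ltr0n.
pose D2 z := g00 z ^+ 2 + 2 * g01 z ^+ 2 + g11 z ^+ 2.
pose J k z := caccio_J (ek k) (a z) (b z) (g00 z) (g01 z) (g11 z) (eta z) (eta1 z) (eta2 z).
pose B z := 4 * M * (eta z ^+ 2 * D2 z).
pose ind k z : R := ((ek k < q z) && (q z < 2 * ek k))%:R.
have cq : continuous q by apply: contD; exact: contX2.
have lD2 : Llo D2.
  by apply: LloD; [apply: LloD; [exact: L2l_sqr|apply: LloZ; exact: L2l_sqr]|exact: L2l_sqr].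
have lE : Llo E by apply: LloD; exact: L2l_sqr.
have lB : Llo B by apply: LloZ; apply: Llo_contM => //; exact: contX2.
have sB : csupp n B by move=> z zn; rewrite /B se// expr0n/= mul0r mulr0.
have iB := csupp_integrable lB sB.
have iG : L2.-integrable setT (EFin \o (fun z => 16 * q z * (eta1 z ^+ 2 + eta2 z ^+ 2))).
  apply: (@csupp_integrable _ n).
    apply: cont_Llo; apply: contM; first by apply: contM => //; exact: cst_continuous.
    by apply: contD; exact: contX2.
  by move=> z zn; rewrite se1// se2// expr0n/= addr0 mulr0.
have mind k : mf2 (ind k).
  have -> : ind k = \1_(q @^-1` `]ek k, 2 * ek k[).
    apply/funext => z; rewrite /ind indicE; congr (nat_of_bool _)%:R.
    by apply/idP/idP; rewrite inE/= in_itv.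
  apply: measurable_indic; rewrite -[X in measurable X]setTI.
  by apply: (cont_mf2 cq) => //; exact: measurable_itv.
have ind1 k z : `|ind k z| <= 1.
  by rewrite ger0_norm ?ler0n// lern1 leq_b1.
have iI := ChiE_integrable m e0 (4 * Q)^-1.
have iErr k : L2.-integrable setT (EFin \o (fun z => B z * ind k z)).
  apply: (@csupp_integrable _ n); last by move=> z zn; rewrite sB// mul0r.
  apply: (Llo_le _ _ lB); first by apply: mf2M => //; case: lB.
  by move=> z; rewrite normrM -[leRHS]mulr1; apply: ler_wpM2l.
have Hphi k := H1_M (H1_M Heta Heta) (TT_H1 (ek0 k)).
have iJ k : L2.-integrable setT (EFin \o J k).
  have [_ l1 l2 _ _] := Hphi k.
  apply: (@csupp_integrable _ n).
    exact: LloB (L2l_prod lp2 l1) (L2l_prod lp1 l2).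
  by move=> z zn; rewrite /J /caccio_J se// se1// se2// !(mul0r, mulr0, addr0, subr0).
have J_le0 k : \int[L2]_z J k z <= 0.
  have n0 : (0 : R) < n.+1%:R by rewrite ltr0n.
  pose N := (2 * n.+1)%N.
  have nN : (n <= N)%N by rewrite /N mul2n -addnn; apply: (leq_trans (leqnSn n)); exact: leq_addr.
  (* [P] has no compact support, so it is multiplied by a plateau equal to 1 on the support of
     [eta]. The scale [n + 1] is positive even for [n = 0]. *)
  have [HZ _ _ _] := tensor_H1 (pl_smooth (n.+1%:R : R)) (pl_smooth (n.+1%:R : R)).
  have outN (z : R * R) : ~ box N z -> (2 * n.+1%:R <= `|z.1|) \/ (2 * n.+1%:R <= `|z.2|).
    move=> zN; have [|z1] := leP (2 * n.+1%:R) `|z.1|; first by left.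
    have [|z2] := leP (2 * n.+1%:R) `|z.2|; first by right.
    by case: zN; apply/boxE; rewrite /N natrM; split; exact: ltW.
  have sphi (z : R * R) : ~ box n z -> [/\ eta z = 0, eta1 z = 0 & eta2 z = 0] by move=> zn; rewrite se// se1// se2.
  apply: (le_trans _ (null_lagrangian (n := N) (H1_M HZ HP) (Hphi k) _ _ _ _ _ _)).
  - rewrite le_eqVlt; apply/orP; left; apply/eqP; apply: eq_Rintegral => z _.
    have [/boxE[z1 z2]|/sphi[s1 s2 s3]] := pselect (box n z); last first.
      by rewrite /J /caccio_J s1 s2 s3 !(mul0r, mulr0, addr0, subr0).
    have nn1 : n%:R <= n.+1%:R :> R by rewrite ler_nat.
    have [Z1 Z2] := pl_in n0 (le_trans z1 nn1); have [Z3 Z4] := pl_in n0 (le_trans z2 nn1).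
    by rewrite -/(pl' _) Z1 Z2 Z3 Z4 !(mul0r, mulr0, mul1r, add0r).
  - by move=> z /outN[|] h; have [-> _] := pl_out n0 h; rewrite !(mul0r, mulr0).
  - by move=> z /outN[|] h; have [e1 e2] := pl_out n0 h; rewrite -/(pl' _) e1 ?e2 !(mul0r, mulr0, addr0).
  - by move=> z /outN[|] h; have [e1 e2] := pl_out n0 h; rewrite -/(pl' _) e1 ?e2 !(mul0r, mulr0, addr0).
  - by apply: (csupp_le nN) => z /sphi[-> _ _]; rewrite !mul0r.
  - by apply: (csupp_le nN) => z /sphi[-> -> _]; rewrite !(mul0r, mulr0, addr0).
  - by apply: (csupp_le nN) => z /sphi[-> _ ->]; rewrite !(mul0r, mulr0, addr0).
(* Each point leaves the set [ek k < q < 2 * ek k] for large [k], or never enters it when [q = 0];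
   the integrable majorant is [|B|]. *)
have err0 : (fun k => \int[L2]_z (B z * ind k z)) @ \oo --> (0 : R).
  have <- : \int[L2]_z (0 : R) = 0 by rewrite Rintegral_cst// mul0r.
  apply: (@Rdominated_cvg _ _ _ L2 setT measurableT _ _ (fun z => `|B z|)).
  - by move=> k; apply: mf2M => //; case: lB.
  - exact: measurable_cst.
  - apply: aeW => z _; apply: cvg_near_cst.
    have [q0|q0] := ltP 0 (q z); last first.
      by near=> k; rewrite /ind (_ : (ek k < q z) = false) ?mulr0//; apply/negbTE; rewrite -leNgt (le_trans q0)// ltW.
    have qe0 : 0 < q z / e0 by rewrite divr_gt0.
    near=> k; rewrite /ind [X in _ && X](_ : _ = false) ?andbF ?mulr0//; apply/negbTE; rewrite -leNgt.
    have : k.+1%:R^-1 < q z / e0 by near: k; exact: (near_infty_natSinv_lt (PosNum qe0)).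
    rewrite ltr_pdivlMr// => /ltW; apply: le_trans.
    by rewrite /ek; move: (k.+1%:R^-1) => t; rewrite le_eqVlt; apply/orP; left; apply/eqP; field.
  - by apply: integrable_norm iB.
  - by move=> k z _; rewrite normrM -[leRHS]mulr1; apply: ler_wpM2l.
apply/ler_addgt0Pr => e e_0.
have /cvgrPdist_lt/(_ _ e_0)[k _ /(_ k (leqnn k))] := err0.
rewrite /= sub0r normrN => Hk.
have iJG : L2.-integrable setT (EFin \o (fun z => J k z + 16 * q z * (eta1 z ^+ 2 + eta2 z ^+ 2))).
  exact: (integrableD measurableT (iJ k) iG).
have L : \int[L2]_z ((4 * Q)^-1 * (\1_(box m) z * (Chi e0 (a z) (b z) * E z))) <=
  \int[L2]_z ((J k z + 16 * q z * (eta1 z ^+ 2 + eta2 z ^+ 2)) + B z * ind k z).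
  apply: le_Rintegral => //.
    exact: (integrableD measurableT iJG (iErr k)).
  move=> z _; have := caccio_pt (a z) (b z) (g00 z) (g01 z) (g11 z) (eta z) (eta1 z) (eta2 z) (ek0 k) HM.
  apply: le_trans; rewrite -/(q z) -/(E z).
  have E0 : 0 <= E z by rewrite addr_ge0 ?sqr_ge0.
  have q0 : 0 <= q z by rewrite addr_ge0 ?sqr_ge0.
  have [zm|zm] := pselect (box m z); last first.
    rewrite indicE memNset// mul0r mulr0; apply: divr_ge0; last exact: mulr_ge0.
    by apply: mulr_ge0; [exact: sqr_ge0|apply: mulr_ge0 => //; exact: step_ge0].
  rewrite indicE mem_set// eta1m// expr1n !mul1r.
  have [qe|qe] := leP (q z) e0.
    have [-> _] := Chi_small e00 qe; rewrite mul0r mulr0.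
    by apply: divr_ge0; [apply: mulr_ge0 => //; exact: step_ge0|exact: mulr_ge0].
  have {}q0 := lt_trans e00 qe.
  have qek : 2 * ek k <= q z.
    apply: (le_trans _ (ltW qe)); rewrite /ek.
    have -> : 2 * (e0 / 2 / k.+1%:R) = e0 / k.+1%:R by field.
    by rewrite ler_pdivrMr ?ltr0n// ler_peMr ?ler1n// ltW.
  have [-> _] := Chi_large (ek0 k) qek; rewrite mul1r [leRHS]mulrC.
  apply: ler_pM; first by rewrite invr_ge0 mulr_ge0// ltW.
  - by apply: mulr_ge0 => //; exact: step_ge0.
  - by rewrite lef_pV2 ?posrE ?mulr_gt0// ler_pM2l// qQ.
  - by rewrite -[leRHS]mul1r; apply: ler_wpM2r => //; exact: step_le1.
apply: (le_trans L); rewrite RintegralD// RintegralD//.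
have h2 := le_lt_trans (ler_norm _) Hk.
by apply: (le_trans (lerD (lerD (J_le0 k) (lexx _)) (ltW h2))); rewrite add0r.
Unshelve. all: by end_near.
Qed.

End Caccioppoli.

(** * Logarithmic cutoff *)

Section Cutoff.
Context {R : realType}.
Notation mu := (@lebesgue_measure R).
Notation L2 := (@lebesgue2 R).
Implicit Types (q : R * R -> R).

(** Oresme's grouping: the [m + N + 2] terms that follow index [N] are each at least
    [1 / (2 * (m + N + 2))], so together they add one half. *)
Lemma harmonic_unbounded (m : nat) (B : R) : exists N : nat, B <= \sum_(0 <= i < N) (m + i).+2%:R^-1.
Proof.
suff H (j : nat) : exists N : nat, j%:R / 2 <= \sum_(0 <= i < N) (m + i).+2%:R^-1 :> R.
  have [N HN] := H (Num.truncn `|2 * B|).+1; exists N; apply: le_trans HN.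
  rewrite ler_pdivlMr// mulrC; apply: (le_trans (ler_norm _)); apply: ltW.
  by apply: truncnS_gt.
elim: j => [|j [N HN]]; first by exists 0%N; rewrite mul0r big_geq.
exists (N + (m + N).+2)%N; rewrite (big_cat_nat (n := N)) ?leq_addr//=.
have -> : j.+1%:R / 2 = j%:R / 2 + 2^-1 :> R by rewrite -natr1 mulrDl div1r.
apply: lerD => //.
apply: (@le_trans _ _ (\sum_(N <= i < N + (m + N).+2) (2 * (m + N).+2%:R)^-1 : R)).
  rewrite sumr_const_nat addKn -[X in _ <= X]mulr_natr le_eqVlt; apply/orP; left; apply/eqP; field.
  by rewrite -natr1 -natr1 gt_eqF// !addr_gt0// ltr_wpDl ?addr_ge0.
apply: ler_sum_nat => i /andP[iN iN']; rewrite lef_pV2 ?posrE ?mulr_gt0 ?ltr0n//.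
by rewrite -natrM ler_nat mul2n -addnn; move: iN'; rewrite !addnS !addSn !ltnS; lia.
Qed.

Lemma box_measure n : L2 (box n) = ((2 * n%:R) ^+ 2)%:E.
Proof.
have H : mu (`[- n%:R, n%:R]%classic : set R) = (2 * n%:R)%:E.
  rewrite lebesgue_measure_itv/= lte_fin; case: ifPn => [_|].
    by rewrite -EFinB; congr EFin; ring.
  rewrite -leNgt => h; congr EFin; apply/eqP; rewrite eq_sym mulf_eq0; apply/orP; right.
  by rewrite eq_le ler0n andbT; move: h; lra.
rewrite /box L2X ?measurable_itv// H -EFinM; congr EFin; ring.
Qed.

Lemma Rintegral_indic_box n (k : R) : \int[L2]_z (k * \1_(box n) z) = k * (2 * n%:R) ^+ 2.
Proof.
have -> : (fun z : R * R => k * \1_(box n) z) = (fun=> k) \_ (box n).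
  apply/funext => z; rewrite patchE indicE; case: ifPn => _; first by rewrite mulr1.
  by rewrite mulr0.
rewrite -Rintegral_mkcond Rintegral_cst; last exact: box_measurable.
by congr (_ * _); rewrite box_measure.
Qed.

Lemma indic_box_integrable n (k : R) : L2.-integrable setT (EFin \o (fun z => k * \1_(box n) z)).
Proof.
apply: (@csupp_integrable _ n); last by move=> z zm; rewrite indicE memNset// mulr0.
apply: LloZ; apply: (Llo_le _ _ (cst_Llo 1)); first by apply: measurable_indic; exact: box_measurable.
by move=> z; rewrite !ger0_norm ?indicE ?ler0n// lern1 leq_b1.
Qed.

Lemma Rintegral_sum_ord (f : nat -> R * R -> R) N : (forall i, L2.-integrable setT (EFin \o f i)) ->
  L2.-integrable setT (EFin \o (fun z => \sum_(i < N) f i z)) /\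
  \int[L2]_z (\sum_(i < N) f i z) = \sum_(i < N) \int[L2]_z f i z.
Proof.
move=> If; elim: N => [|N [IH1 IH2]].
  have -> : (fun z : R * R => \sum_(i < 0) f i z) = (fun=> 0) by apply/funext => z; rewrite big_ord0.
  by split; [exact: integrable0|rewrite big_ord0 Rintegral_cst// mul0r].
have -> : (fun z : R * R => \sum_(i < N.+1) f i z) = (fun z => \sum_(i < N) f i z + f N z).
  by apply/funext => z; rewrite big_ord_recr.
split; first exact: (integrableD measurableT IH1 (If N)).
by rewrite RintegralD// big_ord_recr/= IH2.
Qed.

Lemma H1_sum (f f1 f2 : nat -> R * R -> R) (c : nat -> R) N : (forall i, H1 (f i) (f1 i) (f2 i)) ->
  H1 (fun z => \sum_(i < N) c i * f i z) (fun z => \sum_(i < N) c i * f1 i z) (fun z => \sum_(i < N) c i * f2 i z).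
Proof.
move=> Hf; elim: N => [|N IH].
  have := H1_lin 0 0 (Hf 0%N) (Hf 0%N).
  by congr H1; apply/funext => z; rewrite big_ord0 !mul0r addr0.
have := H1_lin 1 (c N) IH (Hf N).
by congr H1; apply/funext => z; rewrite big_ord_recr/= mul1r.
Qed.

Lemma cont_sum (f : nat -> R * R -> R) (c : nat -> R) N : (forall i, continuous (f i)) ->
  continuous (fun z => \sum_(i < N) c i * f i z).
Proof.
move=> cf; elim: N => [|N IH].
  by rewrite (_ : (fun _ => _) = (fun=> 0)); [exact: cst_continuous|apply/funext => z; rewrite big_ord0].
rewrite (_ : (fun z => _) = (fun z => \sum_(i < N) c i * f i z + c N * f N z)).
  by apply: contD => //; apply: contM => //; exact: cst_continuous.
by apply/funext => z; rewrite big_ord_recr.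
Qed.

(* [eta] averages the dyadic plateaus with harmonic weights.  Their gradients have
   disjoint supports and each carries energy at most [K * (k + 2)], so the total
   is [K] divided by the divergent sum of the weights. *)
Lemma log_cutoff q (A : R) m (e : R) : continuous q -> (forall z, 0 <= q z) ->
  (forall k (z : R * R), `|z.1| <= 2 ^+ k.+1 -> `|z.2| <= 2 ^+ k.+1 -> q z <= A * k.+2%:R) -> 0 < e ->
  exists n (eta eta1 eta2 : R * R -> R),
   [/\ H1 eta eta1 eta2, continuous eta1 /\ continuous eta2,
     [/\ csupp n eta, csupp n eta1 & csupp n eta2], forall z, box m z -> eta z = 1 &
     \int[L2]_z (16 * q z * (eta1 z ^+ 2 + eta2 z ^+ 2)) <= e].
Proof.
move=> cq q0 qA e0.
have [M M0 HM] := @step'_bound R.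
have A0 : 0 <= A.
  have := qA 0%N (0, 0); rewrite /= normr0 => H.
  have := le_trans (q0 (0, 0)) (H _ _); rewrite pmulr_lge0// ; apply; exact: exprn_ge0.
(* The squared gradient of the plateau of scale [L] is at most [2 * (2 * M / L)^2], and it is
   supported in a square of area [16 * L^2], so the powers of [L] cancel. *)
pose K := 16 * A * (2 * (2 * M) ^+ 2) * 16.
have K0 : 0 <= K by apply: mulr_ge0 => //; apply: mulr_ge0; [exact: mulr_ge0|apply: mulr_ge0 => //; exact: sqr_ge0].
(* The final energy is [K / W], hence the target [K / e]; the [+ 1] keeps [W] positive when
   [K = 0]. *)
have [N HN] := harmonic_unbounded m (K / e + 1).
rewrite big_mkord in HN; set W := \sum_(i < N) _ in HN.
have W0 : 0 < W by apply: lt_le_trans HN; rewrite ltr_wpDl// divr_ge0// ltW.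
pose L i : R := 2 ^+ (m + i).
have L0 i : 0 < L i by rewrite exprn_gt0.
pose c i : R := (m + i).+2%:R^-1 / W.
pose Z i (z : R * R) := pl (L i) z.1 * pl (L i) z.2.
pose Z1 i (z : R * R) := pl' (L i) z.1 * pl (L i) z.2.
pose Z2 i (z : R * R) := pl (L i) z.1 * pl' (L i) z.2.
have HZ i : [/\ H1 (Z i) (Z1 i) (Z2 i), continuous (Z i), continuous (Z1 i) & continuous (Z2 i)].
  exact: tensor_H1 (pl_smooth (L i)) (pl_smooth (L i)).
have Zin i z : `|z.1| <= L i -> `|z.2| <= L i -> [/\ Z i z = 1, Z1 i z = 0 & Z2 i z = 0].
  move=> z1 z2; have [a1 a2] := pl_in (L0 i) z1; have [b1 b2] := pl_in (L0 i) z2.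
  by rewrite /Z /Z1 /Z2 a1 a2 b1 b2 mulr1 mulr0 mul0r.
have Zout i z : 2 * L i <= `|z.1| \/ 2 * L i <= `|z.2| -> [/\ Z i z = 0, Z1 i z = 0 & Z2 i z = 0].
  by move=> [] h; have [a1 a2] := pl_out (L0 i) h; rewrite /Z /Z1 /Z2 a1 a2 !(mul0r, mulr0).
have Ldbl i j : (i < j)%N -> 2 * L i <= L j.
  move=> ij; rewrite /L -exprS; apply: ler_weXn2l; first by rewrite ler1n.
  by rewrite -addnS leq_add2l.
have ZB i z : Z1 i z ^+ 2 + Z2 i z ^+ 2 <= 2 * (2 * M / L i) ^+ 2.
  have p1 x : `|pl (L i) x| <= 1 by rewrite ger0_norm ?pl_ge0 ?pl_le1.
  have sq (t : R) : `|t| <= 2 * M / L i -> t ^+ 2 <= (2 * M / L i) ^+ 2.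
    by move=> h; rewrite -real_normK ?num_real// lerXn2r ?nnegrE// (le_trans _ h).
  have -> : 2 * (2 * M / L i) ^+ 2 = (2 * M / L i) ^+ 2 + (2 * M / L i) ^+ 2 by ring.
  apply: lerD; apply: sq; rewrite /Z1 /Z2 normrM.
    by rewrite -[leRHS]mulr1; apply: ler_pM => //; exact: pl'_bound.
  by rewrite -[leRHS]mul1r; apply: ler_pM => //; exact: pl'_bound.
pose eta z := \sum_(i < N) c i * Z i z.
pose eta1 z := \sum_(i < N) c i * Z1 i z.
pose eta2 z := \sum_(i < N) c i * Z2 i z.
have Heta : H1 eta eta1 eta2 by apply: H1_sum => i; have [] := HZ i.
have ce1 : continuous eta1 by apply: cont_sum => i; have [] := HZ i.
have ce2 : continuous eta2 by apply: cont_sum => i; have [] := HZ i.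
pose n := (2 ^ (m + N))%N.
have Zn i (z : R * R) : (i < N)%N -> ~ box n z -> [/\ Z i z = 0, Z1 i z = 0 & Z2 i z = 0].
  move=> iN zn; apply: Zout.
  have LN : 2 * L i <= n%:R by rewrite /n natrX; exact: Ldbl.
  have [|z1] := leP (2 * L i) `|z.1|; first by left.
  have [|z2] := leP (2 * L i) `|z.2|; first by right.
  by case: zn; apply/boxE; split; apply: ltW; [exact: lt_le_trans z1 _|exact: lt_le_trans z2 _].
have iG : L2.-integrable setT (EFin \o (fun z => 16 * q z * (eta1 z ^+ 2 + eta2 z ^+ 2))).
  apply: (@csupp_integrable _ n).
    apply: cont_Llo; apply: contM; first by apply: contM => //; exact: cst_continuous.
    by apply: contD; exact: contX2.
  move=> z zn; rewrite /eta1 /eta2 !big1 ?expr0n/= ?addr0 ?mulr0// => i _;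
    by have [_ h1 h2] := Zn i z (ltn_ord i) zn; rewrite ?h1 ?h2 mulr0.
exists n, eta, eta1, eta2; split => //.
- by split => z zn; apply: big1 => i _; have [h0 h1 h2] := Zn i z (ltn_ord i) zn;
    rewrite ?h0 ?h1 ?h2 mulr0.
- move=> z /boxE[z1 z2].
  (* The integer [m] is at once the radius of the inner box and the first dyadic exponent, by
     [m <= 2^m]. *)
  have mL i : m%:R <= L i.
    apply: (@le_trans _ _ (2 ^ m)%:R); first by rewrite ler_nat ltnW// ltn_expl.
    by rewrite natrX /L; apply: ler_weXn2l; [rewrite ler1n|exact: leq_addr].
  transitivity (\sum_(i < N) c i).
    by apply: eq_bigr => i _; have [-> _ _] := Zin i z (le_trans z1 (mL i)) (le_trans z2 (mL i)); rewrite mulr1.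
  by rewrite /c -mulr_suml -/W divff// gt_eqF.
pose S i : set (R * R) := box (2 ^ (m + i).+1).
pose Bd i : R := c i ^+ 2 * (16 * (A * (m + i).+2%:R) * (2 * (2 * M / L i) ^+ 2)).
have Bd0 i : 0 <= Bd i.
  apply: mulr_ge0; first exact: sqr_ge0.
  by apply: mulr_ge0; [apply: mulr_ge0 => //; exact: mulr_ge0|apply: mulr_ge0 => //; exact: sqr_ge0].
have [iS ES] := Rintegral_sum_ord N (fun i => indic_box_integrable (2 ^ (m + i).+1) (Bd i)).
apply: (@le_trans _ _ (\int[L2]_z (\sum_(i < N) Bd i * \1_(S i) z))).
  apply: le_Rintegral => // z _.
  (* The shell on which the gradient of the plateau [i] may be nonzero. As the scales double, at
     most one shell contains [z], so the square of the sum has no cross terms. *)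
  pose active i := [/\ `|z.1| < 2 * L i, `|z.2| < 2 * L i & ~ (`|z.1| <= L i /\ `|z.2| <= L i)].
  have nact i : ~ active i -> Z1 i z = 0 /\ Z2 i z = 0.
    move=> na; have [[z1 z2]|zi] := pselect (`|z.1| <= L i /\ `|z.2| <= L i).
      by have [_ ? ?] := Zin i z z1 z2.
    have [z1|z1] := leP (2 * L i) `|z.1|; first by have [_ ? ?] := Zout i z (or_introl z1).
    have [z2|z2] := leP (2 * L i) `|z.2|; first by have [_ ? ?] := Zout i z (or_intror z2).
    by case: na.
  have S0 i : 0 <= Bd i * \1_(S i) z by rewrite mulr_ge0// indicE ler0n.
  have [[i ai]|na] := pselect (exists i : 'I_N, active i); last first.
    have n12 (i : 'I_N) : Z1 i z = 0 /\ Z2 i z = 0 by apply: nact => ai; apply: na; exists i.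
    have -> : eta1 z = 0 by apply: big1 => i _; rewrite (n12 i).1 mulr0.
    have -> : eta2 z = 0 by apply: big1 => i _; rewrite (n12 i).2 mulr0.
    by rewrite expr0n/= addr0 mulr0; exact: sumr_ge0.
  have na (j : 'I_N) : j != i -> ~ active j.
    move=> ji [h1 h2 h3]; have [k1 k2 k3] := ai.
    have [lt|lt|/ord_inj E] := ltngtP i j.
    - by apply: h3; split; apply: ltW; [exact: lt_le_trans k1 (Ldbl _ _ lt)|exact: lt_le_trans k2 (Ldbl _ _ lt)].
    - by apply: k3; split; apply: ltW; [exact: lt_le_trans h1 (Ldbl _ _ lt)|exact: lt_le_trans h2 (Ldbl _ _ lt)].
    - by rewrite E eqxx in ji.
  have -> : eta1 z = c i * Z1 i z.
    by rewrite /eta1 (bigD1 i)//= big1 ?addr0// => j /na/nact[-> _]; rewrite mulr0.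
  have -> : eta2 z = c i * Z2 i z.
    by rewrite /eta2 (bigD1 i)//= big1 ?addr0// => j /na/nact[_ ->]; rewrite mulr0.
  rewrite [leRHS](bigD1 i)//=; apply: (@le_trans _ _ (Bd i * \1_(S i) z)); last first.
    by rewrite lerDl; apply: sumr_ge0.
  have [k1 k2 _] := ai.
  have E2 : 2 ^+ (m + i).+1 = 2 * L i by rewrite exprS.
  have zS : S i z by apply/boxE; rewrite natrX E2; split; exact: ltW.
  rewrite indicE mem_set// mulr1.
  have -> : 16 * q z * ((c i * Z1 i z) ^+ 2 + (c i * Z2 i z) ^+ 2) = c i ^+ 2 * (16 * q z * (Z1 i z ^+ 2 + Z2 i z ^+ 2)) by ring.
  apply: ler_wpM2l; first exact: sqr_ge0.
  apply: ler_pM => //; [exact: mulr_ge0|by rewrite addr_ge0 ?sqr_ge0|].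
  by apply: ler_wpM2l => //; apply: qA; rewrite E2; exact: ltW.
rewrite ES.
have -> : \sum_(i < N) \int[L2]_z (Bd i * \1_(S i) z) = K / W.
  transitivity (\sum_(i < N) (m + i).+2%:R^-1 * (K / W ^+ 2)).
    apply: eq_bigr => i _; rewrite /S Rintegral_indic_box.
    have -> : (2 ^ (m + i).+1)%:R = 2 * L i by rewrite natrX exprS.
    rewrite /Bd /c /K; move: (L i) (L0 i) => l l0.
    have w0 : (m + i).+2%:R != 0 :> R by rewrite pnatr_eq0.
    by move: (_.+2%:R) w0 => w w0; field; rewrite (gt_eqF W0) (gt_eqF l0) w0.
  by rewrite -mulr_suml -/W; field; rewrite gt_eqF.
rewrite ler_pdivrMr// mulrC -ler_pdivrMr//; apply: le_trans HN.
by rewrite lerDl.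
Qed.

End Cutoff.

(** * Vanishing of the angular energy *)

Section Vanishing.
Context {R : realType}.
Notation L2 := (@lebesgue2 R).
Variables (d1 d2 : R) (d_unit : d1 ^+ 2 + d2 ^+ 2 = 1).
Variables (a b P g00 g01 g11 : R * R -> R) (A : R).
Hypotheses (Ha : H1 a g00 g01) (Hb : H1 b g01 g11)
  (HP : H1 P (fun z => b z * g01 z - g11 z * a z) (fun z => a z * g01 z - g00 z * b z))
  (Hang : forall z, 0 < a z ^+ 2 + b z ^+ 2 -> 0 < ang_den d1 d2 (a z) (b z))
  (growth : forall k (z : R * R), `|z.1| <= 2 ^+ k.+1 -> `|z.2| <= 2 ^+ k.+1 -> a z ^+ 2 + b z ^+ 2 <= A * k.+2%:R).

(** For fixed [m] and [j], a nonnegative function has integral at most every positive number. The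
    boxes [m] and the levels [1 / (j + 1)] together exhaust the set where [q > 0]. *)
Lemma angular_energy0 : {ae L2, forall z, 0 < a z ^+ 2 + b z ^+ 2 ->
  (b z * g01 z - g11 z * a z) ^+ 2 + (a z * g01 z - g00 z * b z) ^+ 2 = 0}.
Proof.
have [ca _ _ _ _] := Ha; have [cb _ _ _ _] := Hb.
pose E z := (b z * g01 z - g11 z * a z) ^+ 2 + (a z * g01 z - g00 z * b z) ^+ 2.
pose q z := a z ^+ 2 + b z ^+ 2.
have cq : continuous q by apply: contD; exact: contX2.
have q0 z : 0 <= q z by rewrite addr_ge0 ?sqr_ge0.
have E0 z : 0 <= E z by rewrite addr_ge0 ?sqr_ge0.
have main m j : {ae L2, forall z, \1_(box m) z * (Chi j.+1%:R^-1 (a z) (b z) * E z) = 0}.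
  have [Q1 Q10 HQ1] := cont_box_bound m cq.
  pose Q := Q1 + 1; have Q0 : 0 < Q by rewrite ltr_wpDl.
  have qQ z : box m z -> q z <= Q by move=> /HQ1; rewrite ger0_norm// => h; rewrite (le_trans h)// lerDl.
  have j0 : (0 : R) < j.+1%:R^-1 by rewrite invr_gt0 ltr0n.
  have int0 : \int[L2]_z ((4 * Q)^-1 * (\1_(box m) z * (Chi j.+1%:R^-1 (a z) (b z) * E z))) <= 0.
    apply/ler_addgt0Pr => e e_0; rewrite add0r.
    have [n [eta [eta1 [eta2 [Heta [c1 c2] [s s1 s2] em]]]]] := log_cutoff m cq q0 growth e_0.
    exact/le_trans/(caccioppoli d_unit Ha Hb HP Hang Heta c1 c2 s s1 s2 em qQ Q0 j0).
  have int_g := ChiE_integrable Ha Hb HP m j.+1%:R^-1 (4 * Q)^-1.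
  set g := fun z => (4 * Q)^-1 * (\1_(box m) z * (Chi j.+1%:R^-1 (a z) (b z) * E z)) in int_g int0.
  have g0 z : 0 <= g z.
    apply: mulr_ge0; first by rewrite invr_ge0 mulr_ge0// ltW.
    by apply: mulr_ge0; [rewrite indicE ler0n|apply: mulr_ge0 => //; exact: step_ge0].
  have Z : (\int[L2]_z `|(g z)%:E|)%E = 0%E.
    have -> : (\int[L2]_z `|(g z)%:E|)%E = (\int[L2]_z (g z)%:E)%E.
      by apply: eq_integral => z _; rewrite gee0_abs// lee_fin.
    have fin : (\int[L2]_z (g z)%:E)%E \is a fin_num by exact: integrable_fin_num int_g.
    rewrite -(fineK fin); congr EFin; apply/eqP; rewrite eq_le int0/=.
    by apply: fine_ge0; apply: integral_ge0 => z _; rewrite lee_fin.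
  have mg : measurable_fun setT (EFin \o g) by case/integrableP: int_g.
  have := (ae_eq_integral_abs L2 measurableT mg).1 Z.
  apply: ae_imp => z /(_ I) [] /eqP; rewrite /g mulf_eq0 invr_eq0 mulf_eq0 (gt_eqF Q0) pnatr_eq0/=.
  by move=> /eqP.
have := ae_countable (fun m => ae_countable (main m)).
apply: ae_imp => z H qz.
have [m zm] := in_box z.
have q20 : 0 < q z / 2 by rewrite divr_gt0.
(* Choosing [2 / (j + 1) < q z] makes [Chi] equal to 1 at [z]. *)
have [j _ /(_ j (leqnn j)) /= jq] := near_infty_natSinv_lt (PosNum q20).
have j0 : (0 : R) < j.+1%:R^-1 by rewrite invr_gt0 ltr0n.
have := H m j; rewrite indicE mem_set// mul1r.
have [|-> _] := @Chi_large _ j.+1%:R^-1 (a z) (b z) j0; last by rewrite mul1r.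
rewrite -/(q z); apply: ltW; move: jq; rewrite ltr_pdivlMr//; by rewrite mulrC.
Qed.

End Vanishing.

(** * From parallel gradients to one-dimensional symmetry *)

Section Constancy.
Context {R : realType}.
Notation mu := (@lebesgue_measure R).
Notation L2 := (@lebesgue2 R).
Implicit Types (f g : R * R -> R).

Lemma AC_ae_eq0 (f g : R -> R) (s t : R) : AC f g -> measurable_fun setT g -> s <= t ->
  {ae mu, forall x, s <= x <= t -> g x = 0} -> f s = f t.
Proof.
move=> [lg Hf] mg st g0; apply/esym/eqP; rewrite -subr_eq0 Hf//.
have E : (\int[mu]_(x in `[s, t]) (EFin \o g) x = \int[mu]_(x in `[s, t]) (cst 0%E) x)%E.
  apply: ae_eq_integral.
  - exact: measurable_itv.
  - by apply: measurable_funTS; exact/measurable_EFinP.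
  - exact: measurable_cst.
  - by apply: ae_imp g0 => x gx /=; rewrite in_itv/= => /gx ->.
by rewrite /Rintegral E integral0.
Qed.

Lemma ae_dense (P : R -> Prop) (x e : R) : {ae mu, forall x, P x} -> 0 < e ->
  exists2 y : R, `|y - x| < e & P y.
Proof.
move=> [A [mA A0 PA]] e0; apply: contrapT => H.
pose I : set R := `]x - e, x + e[%classic.
have sub : I `<=` A.
  move=> y; rewrite /I/= in_itv/= => /andP[y1 y2]; apply: PA => Py; apply: H; exists y => //.
  by rewrite ltr_norml; apply/andP; split; lra.
have : (mu I <= mu A)%E.
  by apply: le_measure => //; rewrite inE//; exact: measurable_itv.
rewrite A0 /I lebesgue_measure_itv/= lte_fin.
have xx : x - e < x + e by lra.
by rewrite xx -EFinB lee_fin; lra.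
Qed.

(** Only almost every line is good, but good lines are dense: if [f (x, y)] and [f (x, y')]
    differed, so would the values on a good line close to [x]. *)
Lemma ac2_const f f2 (x0 y0 r : R) : continuous f -> ac2 f f2 -> mf2 f2 ->
  {ae L2, forall z, `|z.1 - x0| < r -> `|z.2 - y0| < r -> f2 z = 0} ->
  forall x y y', `|x - x0| < r -> `|y - y0| < r -> `|y' - y0| < r -> f (x, y) = f (x, y').
Proof.
move=> cf af mf z0 x y y' xr; wlog yy : y y' / y <= y'.
  move=> W yr yr'; have [h|/ltW h] := leP y y'; first exact: W.
  by apply/esym; exact: W.
move=> yr yr'; apply: contrapT => ne.
pose h s := f (s, y) - f (s, y').
have ch : continuous h.
  have cl (t : R) : continuous (fun s => f (s, t)).
    by have := cont_line (cont_sw cf) (x := t).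
  by move=> s; apply: cvgB; exact: cl.
have hx : 0 < `|h x| by rewrite normr_gt0 subr_eq0; apply/eqP.
have /cvgrPdist_lt/(_ _ hx)[d /= d0 Hd] := ch x.
have rx : 0 < r - `|x - x0| by rewrite subr_gt0.
have md : 0 < Num.min d (r - `|x - x0|) by rewrite lt_min d0.
have mfx (s : R) : measurable_fun setT (fun t : R => f2 (s, t)).
  exact: (measurableT_comp mf (pair1_measurable s)).
have [s + [As Z]] := ae_dense x (ae_and af (ae_lines z0)) md.
rewrite lt_min => /andP[sd sr].
have sx0 : `|s - x0| < r.
  have -> : s - x0 = (s - x) + (x - x0) by ring.
  by apply: (le_lt_trans (ler_normD _ _)); move: sr; rewrite ltrBrDr.
have E : f (s, y) = f (s, y').
  apply: (AC_ae_eq0 As) => //; apply: ae_imp Z => t /= Zt /andP[t1 t2]; apply: Zt => //.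
  by move: yr yr'; rewrite !ltr_norml => /andP[p1 p2] /andP[p3 p4]; apply/andP; split; lra.
have := Hd s; rewrite /ball_/= distrC => /(_ sd).
by rewrite /h E subrr subr0 ltxx.
Qed.

Lemma H1_const f f1 f2 (x0 y0 r : R) : H1 f f1 f2 -> 0 < r ->
  {ae L2, forall z, `|z.1 - x0| < r -> `|z.2 - y0| < r -> f1 z = 0 /\ f2 z = 0} ->
  forall x y, `|x - x0| < r -> `|y - y0| < r -> f (x, y) = f (x0, y0).
Proof.
move=> [cf [m1 _] [m2 _] a1 a2] r0 z0 x y xr yr.
have c0 (t : R) : `|t - t| < r by rewrite subrr normr0.
transitivity (f (x, y0)).
  by apply: (ac2_const cf a2 m2 _ xr yr (c0 y0)); apply: ae_imp z0 => z H h1 h2; case: (H h1 h2).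
apply: (@ac2_const (f \o sw) (f1 \o sw) y0 x0 r _ _ _ _ y0 x x0) => //.
- exact: cont_sw.
- exact: mf2_sw.
- by apply: ae_imp (ae_sw z0) => z H h1 h2; case: (H h2 h1).
Qed.

Lemma C1_sd (u a b : R * R -> R) x y :
  (forall z, is_derive z (basis_vec 0) u (a z)) -> (forall z, is_derive z (basis_vec 1) u (b z)) ->
  continuous a -> continuous b -> sd (fun x y => u (x, y)) x y (a (x, y)) (b (x, y)).
Proof.
move=> du0 du1 ca cb e e0.
have [da da0 Ha] := @cont2_near _ a x y e ca e0; have [db db0 Hb] := @cont2_near _ b x y e cb e0.
exists (Num.min da db); first by rewrite lt_min da0.
move=> x1 y1 x2 y2; rewrite !lt_min => /andP[h1 h1'] /andP[h2 h2'] /andP[h3 h3'] /andP[h4 h4'].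
have M1 : `|u (x1, y1) - u (x2, y1) - a (x, y) * (x1 - x2)| <= e * `|x1 - x2|.
  apply: (@mvt_affine_sym _ (fun s => u (s, y1)) (fun s => a (s, y1))).
    by move=> t _; exact: (is_derive_basis0 _ (t, y1) _).1 (du0 (t, y1)).
  by move=> t ht; apply: Ha => //; exact: between_ball ht.
have M2 : `|u (x2, y1) - u (x2, y2) - b (x, y) * (y1 - y2)| <= e * `|y1 - y2|.
  apply: (@mvt_affine_sym _ (fun s => u (x2, s)) (fun s => b (x2, s))).
    by move=> t _; exact: (is_derive_basis1 _ (x2, t) _).1 (du1 (x2, t)).
  by move=> t ht; apply: Hb => //; exact: between_ball ht.
have -> : u (x1, y1) - u (x2, y2) - (a (x, y) * (x1 - x2) + b (x, y) * (y1 - y2)) =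
  (u (x1, y1) - u (x2, y1) - a (x, y) * (x1 - x2)) + (u (x2, y1) - u (x2, y2) - b (x, y) * (y1 - y2)) by ring.
by apply: (le_trans (ler_normD _ _)); rewrite [leRHS]mulrDr; exact: lerD.
Qed.

(** Near each point of the segment an increment is at most [e] times the parameter length;
    [local_to_global] with a linear majorant bounds the total, and [e] is arbitrary. *)
Lemma sd_const_line (G a b : R -> R -> R) x y p1 p2 (T : R) : 0 <= T ->
  (forall x y, sd G x y (a x y) (b x y)) ->
  (forall t, 0 <= t <= T -> p1 * a (x + t * p1) (y + t * p2) + p2 * b (x + t * p1) (y + t * p2) = 0) ->
  G (x + T * p1) (y + T * p2) = G x y.
Proof.
move=> T0 sG H; pose f t := G (x + t * p1) (y + t * p2).
have fT e : 0 < e -> `|f T - f 0| <= e * T - e * 0.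
  move=> e0; pose k := `|p1| + `|p2| + 1.
  have k0 : 0 < k by rewrite ltr_wpDl// addr_ge0.
  apply: (@local_to_global _ f (fun t => e * t) 0 T T0) => t tT.
  have ek : 0 < e / k by rewrite divr_gt0.
  have [d d0 Hd] := sG (x + t * p1) (y + t * p2) _ ek.
  exists (d / k); first by rewrite divr_gt0.
  move=> s s' _ ss' _ hs hs'.
  have n1 : `|p1| <= k by rewrite /k -addrA lerDl addr_ge0.
  have n2 : `|p2| <= k by rewrite /k (addrC `|p1|) -addrA lerDl addr_ge0.
  have B (q v w : R) : `|q| <= k -> `|v - t| < d / k -> `|(w + v * q) - (w + t * q)| < d.
    move=> qk vt; have -> : w + v * q - (w + t * q) = (v - t) * q by ring.
    rewrite normrM; apply: (@le_lt_trans _ _ (`|v - t| * k)); first by rewrite ler_wpM2l.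
    by rewrite -ltr_pdivlMr.
  have := Hd _ _ _ _ (B p1 s' x n1 hs') (B p2 s' y n2 hs') (B p1 s x n1 hs) (B p2 s y n2 hs).
  rewrite -/(f s') -/(f s).
  have -> : x + s' * p1 - (x + s * p1) = (s' - s) * p1 by ring.
  have -> : y + s' * p2 - (y + s * p2) = (s' - s) * p2 by ring.
  set a0 := a _ _; set b0 := b _ _.
  have -> : a0 * ((s' - s) * p1) + b0 * ((s' - s) * p2) = (s' - s) * (p1 * a0 + p2 * b0) by ring.
  rewrite H// mulr0 subr0 => /le_trans; apply.
  rewrite !normrM -mulrDr (ger0_norm (_ : 0 <= s' - s)) ?subr_ge0// -mulrBr.
  have -> : e * (s' - s) = e / k * ((s' - s) * k) by field; rewrite gt_eqF.
  apply: ler_wpM2l; first exact: ltW.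
  by rewrite ler_wpM2l ?subr_ge0// /k lerDl.
have f0 : f 0 = G x y by rewrite /f !mul0r !addr0.
rewrite -/(f T) -f0; apply/eqP; rewrite -subr_eq0 -normr_le0.
apply/ler_addgt0Pr => e e0; rewrite add0r.
have T1 : 0 < T + 1 by rewrite ltr_wpDl.
have := fT (e / (T + 1)); rewrite divr_gt0// => /(_ isT) /le_trans; apply.
rewrite mulr0 subr0 mulrAC ler_pdivrMr// ler_wpM2l// ?(ltW e0)//.
by rewrite lerDl.
Qed.

End Constancy.

(** * Level lines and the global direction of the gradient *)

Section Geometry.
Context {R : realType}.
Variables (u a b : R * R -> R).
Hypotheses (du0 : forall z, is_derive z (basis_vec 0) u (a z)) (du1 : forall z, is_derive z (basis_vec 1) u (b z))
  (ca : continuous a) (cb : continuous b).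
Hypothesis parallel : forall x0 y0 : R, 0 < a (x0, y0) ^+ 2 + b (x0, y0) ^+ 2 -> exists2 r : R, 0 < r &
  forall x y, `|x - x0| < r -> `|y - y0| < r -> a (x0, y0) * b (x, y) - b (x0, y0) * a (x, y) = 0.

Let su x y : sd (fun x y => u (x, y)) x y (a (x, y)) (b (x, y)) .
Proof. exact: C1_sd. Qed.

Lemma const_line_sym (x y p1 p2 T : R) :
  (forall t, `|t| <= `|T| -> p1 * a (x + t * p1, y + t * p2) + p2 * b (x + t * p1, y + t * p2) = 0) ->
  u (x + T * p1, y + T * p2) = u (x, y).
Proof.
move=> H; have [T0|T0] := leP 0 T.
  apply: (@sd_const_line R (fun x y => u (x, y)) (fun x y => a (x, y)) (fun x y => b (x, y)) x y p1 p2 T T0) => //.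
  by move=> t /andP[t0 tT]; apply: H; rewrite !ger0_norm.
have T0' : 0 <= - T by rewrite oppr_ge0 ltW.
have := @sd_const_line R (fun x y => u (x, y)) (fun x y => a (x, y)) (fun x y => b (x, y)) x y (- p1) (- p2) (- T) T0' su.
rewrite !mulrNN; apply => t /andP[t0 tT].
have -> : x + t * - p1 = x + - t * p1 by ring.
have -> : y + t * - p2 = y + - t * p2 by ring.
rewrite -[RHS]oppr0 -(H (- t)); first by ring.
by rewrite normrN ger0_norm// ltr0_norm.
Qed.

(** The partial derivatives are only continuous and cannot be differentiated along the level line.
    Instead [u] is shown invariant, on a small square, under translation in the direction [(- b, a)]
    taken at [(x0, y0)], and the derivatives inherit the invariance. *)
Lemma partials_local (x0 y0 : R) : 0 < a (x0, y0) ^+ 2 + b (x0, y0) ^+ 2 -> exists2 d : R, 0 < d &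
  forall t, `|t| < d -> a (x0 + t * - b (x0, y0), y0 + t * a (x0, y0)) = a (x0, y0) /\
    b (x0 + t * - b (x0, y0), y0 + t * a (x0, y0)) = b (x0, y0).
Proof.
move=> q0; have [r r0 Hr] := parallel q0.
set a0 := a (x0, y0) in Hr *; set b0 := b (x0, y0) in Hr *.
pose k := `|a0| + `|b0| + 1.
have k0 : 0 < k by rewrite ltr_wpDl// addr_ge0.
have r20 : 0 < r / 2 by rewrite divr_gt0.
have d0 : 0 < r / 2 / k by rewrite divr_gt0.
have n1 : `|a0| <= k by rewrite /k -addrA lerDl addr_ge0.
have n2 : `|- b0| <= k by rewrite normrN /k (addrC `|a0|) -addrA lerDl addr_ge0.
have small (t p : R) : `|p| <= k -> `|t| < r / 2 / k -> `|t * p| < r / 2.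
  move=> pk td; rewrite normrM; apply: (@le_lt_trans _ _ (`|t| * k)); first by rewrite ler_wpM2l.
  by rewrite -ltr_pdivlMr.
(* Half of [r] is reserved for the base point and half for the displacement. *)
have inv (t x y : R) : `|t| < r / 2 / k -> `|x - x0| < r / 2 -> `|y - y0| < r / 2 ->
    u (x + t * - b0, y + t * a0) = u (x, y).
  move=> td xr yr; apply: const_line_sym => s st.
  have sd := le_lt_trans st td.
  have := Hr (x + s * - b0) (y + s * a0).
  have -> : forall p q, a0 * p - b0 * q = - b0 * q + a0 * p by move=> p q; ring.
  apply.
    rewrite addrAC; apply: (le_lt_trans (ler_normD _ _)).
    by rewrite [ltRHS](splitr r) ltrD// small.
  rewrite addrAC; apply: (le_lt_trans (ler_normD _ _)).
  by rewrite [ltRHS](splitr r) ltrD// small.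
exists (r / 2 / k) => // t td.
(* Functions that agree near two points up to a translation have the same derivative there. *)
have loc (K1 K2 : R -> R) (l1 l2 c1 c2 : R) : is_derive (c1 : R) 1 K1 l1 -> is_derive (c2 : R) 1 K2 l2 ->
   (forall h, `|h| < r / 2 -> K1 (c1 + h) = K2 (c2 + h)) -> l1 = l2.
  move=> D1 D2 E.
  have D3 : is_derive (c1 : R) 1 K1 l2.
    apply/is_derive_eps => e e0; have [d dp Hd] := (is_derive_eps K2 c2 l2).2 D2 e e0.
    exists (Num.min d (r / 2)); first by rewrite lt_min dp.
    move=> y; rewrite lt_min => /andP[y1 y2].
    have h1 := E (y - c1) y2; have h2 := E 0; rewrite normr0 !addr0 in h2.
    rewrite addrC subrK in h1; rewrite h1 (h2 r20).
    have := Hd (c2 + (y - c1)); rewrite (addrC c2) addrK; exact.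
  by have [_ <-] := D1; have [_ <-] := D3.
split.
- apply: (loc (fun x => u (x, y0 + t * a0)) (fun x => u (x, y0)) _ _ (x0 + t * - b0) x0).
  + exact: (is_derive_basis0 _ (_, _) _).1 (du0 (_, _)).
  + exact: (is_derive_basis0 _ (_, _) _).1 (du0 (_, _)).
  + move=> h hr; have -> : x0 + t * - b0 + h = (x0 + h) + t * - b0 by ring.
    by apply: inv => //; [rewrite addrC addKr|rewrite subrr normr0].
- apply: (loc (fun y => u (x0 + t * - b0, y)) (fun y => u (x0, y)) _ _ (y0 + t * a0) y0).
  + exact: (is_derive_basis1 _ (_, _) _).1 (du1 (_, _)).
  + exact: (is_derive_basis1 _ (_, _) _).1 (du1 (_, _)).
  + move=> h hr; have -> : y0 + t * a0 + h = (y0 + h) + t * a0 by ring.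
    by apply: inv => //; [rewrite subrr normr0|rewrite addrC addKr].
Qed.

(** Connectedness of the line: the good parameters form a closed set by continuity. It is open
    because at a good point the gradient, hence the direction of the line, is the original one and
    [partials_local] applies again. *)
Lemma partials_line (x0 y0 : R) : 0 < a (x0, y0) ^+ 2 + b (x0, y0) ^+ 2 ->
  forall t, a (x0 + t * - b (x0, y0), y0 + t * a (x0, y0)) = a (x0, y0) /\
    b (x0 + t * - b (x0, y0), y0 + t * a (x0, y0)) = b (x0, y0).
Proof.
move=> q0; set a0 := a (x0, y0) in q0 *; set b0 := b (x0, y0) in q0 *.
pose L (t : R) : R * R := (x0 + t * - b0, y0 + t * a0).
pose S := [set t : R | a (L t) = a0 /\ b (L t) = b0].
suff ST : S = setT by move=> t; have : S t by rewrite ST.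
have cL : continuous L.
  have aff (x p : R) : continuous (fun t : R => x + t * p).
    by move=> t; apply: cvgD; [exact: cvg_cst|apply: cvgM; [exact: cvg_id|exact: cvg_cst]].
  by move=> t; exact: (cvg_pair (aff x0 (- b0) t) (aff y0 a0 t)).
have /connected_intervalP conn : is_interval (setT : set R) by [].
apply: conn.
- by exists 0; rewrite /S/= /L !mul0r !addr0.
- exists S; last by rewrite setTI.
  rewrite openE => t [at_ bt].
  have qt : 0 < a (L t) ^+ 2 + b (L t) ^+ 2 by rewrite at_ bt.
  have [d d0 Hd] := partials_local qt.
  exists d => //= s; rewrite /ball_/= distrC => sd.
  have at' : a (x0 + t * - b0, y0 + t * a0) = a0 := at_.
  have bt' : b (x0 + t * - b0, y0 + t * a0) = b0 := bt.
  have := Hd (s - t) sd; rewrite at' bt'.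
  have -> : x0 + t * - b0 + (s - t) * - b0 = x0 + s * - b0 by ring.
  by have -> : y0 + t * a0 + (s - t) * a0 = y0 + s * a0 by ring.
- exists S; last by rewrite setTI.
  have -> : S = ((a \o L) @^-1` [set a0]) `&` ((b \o L) @^-1` [set b0]) by [].
  apply: closedI; apply: preimage_closed => //; try exact: closed1.
    by move=> t _; apply: continuous_comp; [exact: cL|exact: ca].
  by move=> t _; apply: continuous_comp; [exact: cL|exact: cb].
Qed.

Lemma gradients_parallel (z w : R * R) : a z * b w - b z * a w = 0.
Proof.
have pos (v : R * R) : (a v = 0 /\ b v = 0) \/ 0 < a v ^+ 2 + b v ^+ 2.
  have [/eqP q0|q0] := boolP (a v ^+ 2 + b v ^+ 2 == 0); last first.
    by right; rewrite lt_neqAle eq_sym q0 addr_ge0 ?sqr_ge0.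
  left; move/eqP: q0; rewrite paddr_eq0 ?sqr_ge0// !sqrf_eq0 => /andP[/eqP -> /eqP ->]; by [].
have [[-> ->]|qz] := pos z; first by rewrite !mul0r subrr.
have [[-> ->]|qw] := pos w; first by rewrite !mulr0 subrr.
apply: contrapT => /eqP D0.
move: z w qz qw D0 => [x0 y0] [x1 y1] qz qw D0.
have Hz := partials_line qz; have Hw := partials_line qw.
set a0 := a (x0, y0) in Hz D0; set b0 := b (x0, y0) in Hz D0.
set a1 := a (x1, y1) in Hw D0; set b1 := b (x1, y1) in Hw D0.
pose D := a0 * b1 - b0 * a1.
(* Cramer's rule for the intersection of the two level lines. The gradient at that point would equal
   both given gradients, which are not parallel. *)
pose t := ((x1 - x0) * a1 + (y1 - y0) * b1) / D.
pose s := ((x1 - x0) * a0 + (y1 - y0) * b0) / D.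
have [Az Bz] := Hz t; have [Aw Bw] := Hw s.
have E1 : x0 + t * - b0 = x1 + s * - b1 by rewrite /t /s /D; field.
have E2 : y0 + t * a0 = y1 + s * a1 by rewrite /t /s /D; field.
rewrite E1 E2 in Az Bz.
have A01 : a0 = a1 by rewrite -[LHS]Az -[RHS]Aw.
have B01 : b0 = b1 by rewrite -[LHS]Bz -[RHS]Bw.
by move: D0; rewrite A01 B01 mulrC subrr eqxx.
Qed.

Lemma one_dimensional_of_parallel : one_dimensional u.
Proof.
have [e1 [e2 [e_unit He]]] : exists e1 e2 : R, e1 ^+ 2 + e2 ^+ 2 = 1 /\ forall z, - e2 * a z + e1 * b z = 0.
  have [[z qz]|nz] := pselect (exists z, 0 < a z ^+ 2 + b z ^+ 2).
    pose r := Num.sqrt (a z ^+ 2 + b z ^+ 2).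
    have r0 : 0 < r by rewrite sqrtr_gt0.
    have rr : r ^+ 2 = a z ^+ 2 + b z ^+ 2 by rewrite sqr_sqrtr// ltW.
    exists (a z / r), (b z / r); split.
      by rewrite !expr_div_n -mulrDl -rr divff// expf_neq0// gt_eqF.
    move=> w; transitivity ((a z * b w - b z * a w) / r); first by ring.
    by rewrite gradients_parallel mul0r.
  (* The gradient vanishes identically, so any direction will do. *)
  exists 1, 0; split; first by rewrite expr1n expr0n/= addr0.
  move=> w; rewrite oppr0 mul0r add0r mul1r; apply/eqP; rewrite -sqrf_eq0 eq_le sqr_ge0 andbT.
  rewrite leNgt; apply/negP => bw; apply: nz; exists w; apply: (lt_le_trans bw).
  by rewrite lerDr sqr_ge0.
exists (e1, e2), (fun t => u (t * e1, t * e2)); split.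
  by rewrite /enorm /dot/= -!expr2 e_unit sqrtr1.
move=> [x y]; rewrite /dot/=.
pose s := e1 * x + e2 * y; pose t := - e2 * x + e1 * y.
have Ex : x = s * e1 + t * - e2.
  rewrite /s /t -[LHS]mulr1 -e_unit; ring.
have Ey : y = s * e2 + t * e1.
  rewrite /s /t -[LHS]mulr1 -e_unit; ring.
rewrite -/s [in LHS]Ex [in LHS]Ey; apply: const_line_sym => r _; exact: He.
Qed.

End Geometry.

(** * Conclusion *)

Section Conclusion.
Context {R : realType}.
Notation L2 := (@lebesgue2 R).

Lemma enorm_sqr (z : R * R) : enorm z ^+ 2 = z.1 ^+ 2 + z.2 ^+ 2.
Proof. by rewrite /enorm sqr_sqrtr /dot -?expr2// addr_ge0 ?sqr_ge0. Qed.

(* Cauchy-Schwarz, with equality only in the direction [(d1, d2)]. *)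
Lemma ang_den_gt0 (v : R * R -> R * R) d1 d2 z : d1 ^+ 2 + d2 ^+ 2 = 1 ->
  ~ flow_angles v setT (d1, d2) -> 0 < (v z).1 ^+ 2 + (v z).2 ^+ 2 -> 0 < ang_den d1 d2 (v z).1 (v z).2.
Proof.
move=> d_unit nd q0; set a := (v z).1 in q0 *; set b := (v z).2 in q0 *.
have -> : ang_den d1 d2 a b = enorm (v z) - (d1 * a + d2 * b).
  by rewrite /ang_den /enorm /dot -!expr2 -/a -/b; ring.
set r := enorm (v z); set c := d1 * a + d2 * b; pose n := d2 * a - d1 * b.
have rr : r ^+ 2 = a ^+ 2 + b ^+ 2 by exact: enorm_sqr.
have r0 : 0 < r by rewrite sqrtr_gt0 /dot -!expr2.
have cn : c ^+ 2 + n ^+ 2 = r ^+ 2 by rewrite rr -[RHS]mul1r -d_unit /c /n; ring.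
rewrite subr_gt0 ltNge; apply/negP => rc; apply: nd.
have c0 : 0 < c by exact: lt_le_trans rc.
have c2 : r ^+ 2 <= c ^+ 2 by rewrite lerXn2r// nnegrE ltW.
have n0 : n = 0.
  by apply/eqP; rewrite -sqrf_eq0 eq_le sqr_ge0 andbT; move: cn c2; move: (n ^+ 2) => t; lra.
have cr : c = r.
  apply/le_anti; rewrite rc andbT -(@ler_pXn2r _ 2 isT) ?nnegrE ?(ltW c0) ?(ltW r0)//.
  by rewrite -cn n0 expr0n/= addr0.
exists z; first by split => //=.
have ea : a = d1 * r + d2 * n by rewrite -cr /c /n -[LHS]mul1r -d_unit; ring.
have eb : b = d2 * r - d1 * n by rewrite -cr /c /n -[LHS]mul1r -d_unit; ring.
rewrite n0 !mulr0 addr0 in ea; rewrite n0 mulr0 subr0 in eb.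
rewrite -/r [v z]surjective_pairing -/a -/b ea eb.
change ((r^-1 * (d1 * r), r^-1 * (d2 * r)) = (d1, d2)).
by congr pair; rewrite mulrC mulfK// gt_eqF.
Qed.

(** In the frame of [(d1, d2)] a vector with half-angle tangent [t] is proportional to
    [(t^2 - 1, 2 * t)], the rational parametrisation of the circle, so [t] determines its line. *)
Lemma Theta_eq_parallel d1 d2 (a b a' b' : R) : d1 ^+ 2 + d2 ^+ 2 = 1 ->
  0 < ang_den d1 d2 a b -> 0 < ang_den d1 d2 a' b' -> Theta d1 d2 a b = Theta d1 d2 a' b' ->
  a * b' - b * a' = 0.
Proof.
move=> d_unit.
have polar (x y t : R) : 0 < ang_den d1 d2 x y -> (d2 * x + - d1 * y) / ang_den d1 d2 x y = t ->
   exists D, d1 * x + d2 * y = (t ^+ 2 - 1) * D /\ d2 * x - d1 * y = 2 * t * D.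
  move=> D0 Dt; exists (ang_den d1 d2 x y / 2).
  pose r := Num.sqrt (x ^+ 2 + y ^+ 2).
  have rr : r ^+ 2 = x ^+ 2 + y ^+ 2 by rewrite sqr_sqrtr// addr_ge0 ?sqr_ge0.
  have n_t : d2 * x - d1 * y = t * ang_den d1 d2 x y.
    by rewrite -Dt; field; rewrite gt_eqF.
  have cD : d1 * x + d2 * y = r - ang_den d1 d2 x y by rewrite /ang_den -/r; ring.
  have key : t ^+ 2 * ang_den d1 d2 x y = 2 * r - ang_den d1 d2 x y.
    have Dn : ang_den d1 d2 x y != 0 by rewrite gt_eqF.
    apply: (mulIf Dn).
    transitivity ((d2 * x - d1 * y) ^+ 2); first by rewrite n_t; ring.
    have : (d1 * x + d2 * y) ^+ 2 + (d2 * x - d1 * y) ^+ 2 = r ^+ 2 by rewrite rr -[RHS]mul1r -d_unit; ring.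
    move: (d2 * x - d1 * y) => n; rewrite cD => /(canRL (addKr _)) ->; ring.
  split; last by rewrite n_t; field.
  by rewrite mulrA mulrBl key mul1r cD; field.
move=> D0 D0' /(can_inj (@atanK R)) E.
have [D [c1 n1]] := polar _ _ _ D0 E; have [D' [c2 n2]] := polar _ _ _ D0' erefl.
have -> : a * b' - b * a' = - ((d1 * a + d2 * b) * (d2 * a' - d1 * b') - (d2 * a - d1 * b) * (d1 * a' + d2 * b')).
  by rewrite -[LHS]mul1r -d_unit; ring.
by rewrite c1 n1 c2 n2; ring.
Qed.

Lemma growth_dyadic (u : R * R -> R) :
  (exists2 C : R, 0 < C & forall r : R, 100 < r ->
     (ereal_sup [set (enorm (grad u x))%:E | x in [set x | (enorm x <= r)%R]]
      <= (C * Num.sqrt (ln r))%:E)%E) ->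
  exists A : R, forall k (z : R * R), `|z.1| <= 2 ^+ k.+1 -> `|z.2| <= 2 ^+ k.+1 ->
    'D_(basis_vec 0) u z ^+ 2 + 'D_(basis_vec 1) u z ^+ 2 <= A * k.+2%:R.
Proof.
move=> [C C0 HC]; exists (4 * C ^+ 2) => k z z1 z2.
have -> : 'D_(basis_vec 0) u z ^+ 2 + 'D_(basis_vec 1) u z ^+ 2 = enorm (grad u z) ^+ 2 by rewrite enorm_sqr.
(* The exponent 7 gives [r >= 128 > 100] already for [k = 0]. Then [ln r <= k + 7 <= 4 * (k + 2)],
   whence the constant [4 * C ^+ 2]. *)
pose r : R := 2 ^+ (k + 7).
have k1 : 1 <= 2 ^+ k :> R by rewrite exprn_ege1// ler1n.
have r100 : 100 < r.
  rewrite /r exprD; have -> : 2 ^+ 7 = 128 :> R by rewrite -natrX.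
  by move: (2 ^+ k) k1 => t; lra.
have zr : enorm z <= r.
  rewrite -(@ler_pXn2r _ 2 isT) ?nnegrE ?sqrtr_ge0 ?exprn_ge0// enorm_sqr.
  have sq (t : R) : `|t| <= 2 ^+ k.+1 -> t ^+ 2 <= (2 ^+ k.+1) ^+ 2.
    by move=> h; rewrite -real_normK ?num_real// lerXn2r ?nnegrE// exprn_ge0.
  apply: (le_trans (lerD (sq _ z1) (sq _ z2))).
  have -> : r = 64 * 2 ^+ k.+1.
    by rewrite /r addnC (_ : 7 = 6 + 1)%N// -addnA add1n exprD; congr (_ * _); rewrite -natrX.
  rewrite exprMn; have := sqr_ge0 (2 ^+ k.+1 : R); move: ((_ : R) ^+ 2) => t; lra.
have le1 : enorm (grad u z) <= C * Num.sqrt (ln r).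
  rewrite -lee_fin; apply: (le_trans _ (HC r r100)).
  by apply: ereal_sup_ubound; exists z.
have lr0 : 0 <= ln r by rewrite ln_ge0// ltW// (lt_trans _ r100)// ltr1n.
have := le1; rewrite -(@ler_pXn2r _ 2 isT) ?nnegrE ?sqrtr_ge0 ?mulr_ge0 ?sqrtr_ge0 ?(ltW C0)//.
move/le_trans; apply; rewrite exprMn sqr_sqrtr// (mulrC 4) -[leRHS]mulrA; apply: ler_wpM2l; first exact: sqr_ge0.
rewrite /r lnXn// -[leLHS]mulr_natr.
have ln2 : ln (2 : R) <= 1.
  by have := @le_ln1Dx R 1; rewrite -[1 + 1]/(2 : R); apply; lra.
apply: (@le_trans _ _ (1 * (k + 7)%:R)); first exact: ler_wpM2r.
by rewrite mul1r -natrM ler_nat; lia.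
Qed.

(** The direction opposite to the axis of the sector would need a [t] with [cos (t - theta0) = -1]
    and [|t - theta0| < pi]. *)
Lemma sector_avoids (theta0 beta : R) : 0 < beta < pi -> ~ sector theta0 beta (- cos theta0, - sin theta0).
Proof.
move=> /andP[b0 bpi] [t /= /andP[t1 t2] [ct st]].
have c1 : cos (t - theta0) = - 1.
  rewrite cosB ct st.
  have -> : - cos theta0 * cos theta0 + - sin theta0 * sin theta0 = - (cos theta0 ^+ 2 + sin theta0 ^+ 2) by ring.
  by rewrite cos2Dsin2.
have c2 : cos `|t - theta0| = cos pi.
  by rewrite cospi -c1; case: (ler0P (t - theta0)) => _; rewrite ?cosN.
have tp : `|t - theta0| < pi by rewrite ltr_norml; apply/andP; split; lra.
have := cos_inj _ _ c2; rewrite !in_itv/= normr_ge0 (ltW tp) pi_ge0 lexx => /(_ isT isT) E.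
by rewrite E ltxx in tp.
Qed.

Lemma missing_angle (u : R * R -> R) (W : Prop) :
  (exists theta0 beta : R, 0 < beta < pi /\ flow_angles (grad u) setT `<=` sector theta0 beta) \/
  (W /\ flow_angles (grad u) setT `<` circle) ->
  exists d1 d2 : R, d1 ^+ 2 + d2 ^+ 2 = 1 /\ ~ flow_angles (grad u) setT (d1, d2).
Proof.
case=> [[t0 [beta [hb sub]]]|[_ [_ nsub]]].
  exists (- cos t0), (- sin t0); split; first by rewrite !sqrrN cos2Dsin2.
  by move/sub; exact: sector_avoids.
have [[d1 d2] [d_unit nd]] : exists d, circle d /\ ~ flow_angles (grad u) setT d.
  by apply: contrapT => H; apply: nsub => d dc; apply: contrapT => nd; apply: H; exists d.
exists d1, d2; split => //.
by have := enorm_sqr (d1, d2); rewrite /= d_unit expr1n => <-.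
Qed.

(** Near a point with nonzero gradient the truncated angle is [Theta] itself. Its derivatives are
    the components of [V] over [2 * q], zero almost everywhere, so the angle is locally constant. *)
Lemma level_parallel d1 d2 (a b g00 g01 g11 : R * R -> R) : d1 ^+ 2 + d2 ^+ 2 = 1 ->
  H1 a g00 g01 -> H1 b g01 g11 ->
  (forall z, 0 < a z ^+ 2 + b z ^+ 2 -> 0 < ang_den d1 d2 (a z) (b z)) ->
  {ae L2, forall z, 0 < a z ^+ 2 + b z ^+ 2 ->
    (b z * g01 z - g11 z * a z) ^+ 2 + (a z * g01 z - g00 z * b z) ^+ 2 = 0} ->
  forall x0 y0, 0 < a (x0, y0) ^+ 2 + b (x0, y0) ^+ 2 -> exists2 r : R, 0 < r &
    forall x y, `|x - x0| < r -> `|y - y0| < r -> a (x0, y0) * b (x, y) - b (x0, y0) * a (x, y) = 0.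
Proof.
move=> d_unit Ha Hb Hang E0 x0 y0 q0.
have [ca _ _ _ _] := Ha; have [cb _ _ _ _] := Hb.
pose q z := a z ^+ 2 + b z ^+ 2; rewrite -/(q (x0, y0)) in q0.
have cq : continuous q by apply: contD; exact: contX2.
(* By continuity [q] stays above half its value, which is [2 * e]; there the truncation is
   inactive. *)
pose e := q (x0, y0) / 4; have e0 : 0 < e by rewrite divr_gt0.
have q20 : 0 < q (x0, y0) / 2 by rewrite divr_gt0.
have [r r0 Hr] : exists2 r : R, 0 < r & forall x y, `|x - x0| < r -> `|y - y0| < r -> 2 * e <= q (x, y).
  have [r r0 Hr] := @cont2_near _ q x0 y0 _ cq q20.
  exists r => // x y xr yr; have := Hr x y xr yr; rewrite ler_norml => /andP[h _].
  by move: h; rewrite /e; move: (q (x, y)) (q (x0, y0)) => s t; lra.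
have qpos x y : `|x - x0| < r -> `|y - y0| < r -> 0 < q (x, y).
  by move=> xr yr; apply: lt_le_trans (Hr x y xr yr); rewrite mulr_gt0.
have TE x y : `|x - x0| < r -> `|y - y0| < r -> TT d1 d2 e (a (x, y)) (b (x, y)) = Theta d1 d2 (a (x, y)) (b (x, y)).
  by move=> xr yr; rewrite /TT; have [-> _] := Chi_large e0 (Hr x y xr yr); rewrite mul1r.
exists r => // x y xr yr.
have c0 (t : R) : `|t - t| < r by rewrite subrr normr0.
apply: (Theta_eq_parallel d_unit (Hang _ (qpos _ _ (c0 _) (c0 _))) (Hang _ (qpos _ _ xr yr))).
rewrite -!TE//; apply/esym.
apply: (H1_const (TT_H1 d_unit Ha Hb Hang e0) r0 _ xr yr).
apply: ae_imp E0 => -[s t] /= E st tt.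
have qst := qpos s t st tt.
have := E qst; move/eqP; rewrite paddr_eq0 ?sqr_ge0// !sqrf_eq0 => /andP[/eqP p1 /eqP p2].
rewrite /TT1 /TT2; have [-> ->] := Chi_large e0 (Hr s t st tt).
rewrite !(mul0r, mulr0, add0r, mul1r); move: p1 p2 qst; rewrite /q.
move: (a _) (b _) (g00 _) (g01 _) (g11 _) => A B h0 m h1 p1 p2 qst.
split.
- transitivity ((A * m - h0 * B) / (2 * (A ^+ 2 + B ^+ 2))); last by rewrite p2 mul0r.
  by ring.
- transitivity (- (B * m - h1 * A) / (2 * (A ^+ 2 + B ^+ 2))); last by rewrite p1 oppr0 mul0r.
  by ring.
Qed.

End Conclusion.

Theorem corollary1p4 (R : realType) (F : R -> R) (u : R * R -> R)
  (F_lip : locally_lipschitz F)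
  (u_H2 : Wloc 2 2%:E u)
  (u_C1 : class_C 1 u)
  (u_sol : solves_semilinear F u)
  (u_growth : exists2 C : R, 0 < C & forall r : R, 100 < r ->
     (ereal_sup [set (enorm (grad u x))%:E | x in [set x | (enorm x <= r)%R]]
      <= (C * Num.sqrt (ln r))%:E)%E)
  (u_cond :
     (exists theta0 beta : R, 0 < beta < pi /\
        flow_angles (grad u) setT `<=` sector theta0 beta)
     \/
     (Wloc 3 1%:E u /\ flow_angles (grad u) setT `<` circle)) :
  one_dimensional u.
Proof.
have [d1 [d2 [d_unit nd]]] := missing_angle u_cond.
have [A growth] := growth_dyadic u_growth.
have [g00 [g01 [g11 [Ha Hb HF]]]] := semilinear_H1 F_lip u_H2 u_C1 u_sol.
set a := 'D_(basis_vec 0) u in Ha; set b := 'D_(basis_vec 1) u in Hb.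
have {}HF : H1 (F \o u) (fun z => (g00 z + g11 z) * a z) (fun z => (g00 z + g11 z) * b z) := HF.
have Hang z : 0 < a z ^+ 2 + b z ^+ 2 -> 0 < ang_den d1 d2 (a z) (b z) := @ang_den_gt0 R (grad u) d1 d2 z d_unit nd.
have Hq : H1 (fun z => a z ^+ 2 + b z ^+ 2) (fun z => 2 * a z * g00 z + 2 * b z * g01 z)
    (fun z => 2 * a z * g01 z + 2 * b z * g11 z).
  apply: (H1_sd (G := fun x y => x ^+ 2 + y ^+ 2) (v1 := fun x y => 2 * x) (v2 := fun x y => 2 * y) Ha Hb) => z.
  by exists 1 => // x y _ _; exact: sd_sqn.
(* In the gradient of [P] the Laplacian term of [F \o u] cancels the pure second derivative [g00] in
   the first component and [g11] in the second. What remains is [V] turned by a right angle. *)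
pose P z := 2^-1 * (a z ^+ 2 + b z ^+ 2) + (- 1) * (F \o u) z.
have HP : H1 P (fun z => b z * g01 z - g11 z * a z) (fun z => a z * g01 z - g00 z * b z).
  by have := H1_lin 2^-1 (- 1) Hq HF; congr H1; apply/funext => z; field.
apply: (@one_dimensional_of_parallel R u a b).
- exact: C1_is_derive.
- exact: C1_is_derive.
- by case: Ha.
- by case: Hb.
- exact: (level_parallel d_unit Ha Hb Hang (angular_energy0 d_unit Ha Hb HP Hang growth)).
Qed.
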